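(* Let $\mathbb F$ be a field and let $\mathcal A$ and $\mathcal B$ be two Bloch-Kato Lie algebras over $\mathbb F$, with $\dim_{\mathbb F}\mathcal A_1<\infty$ and $\dim_{\mathbb F}\mathcal B_1<\infty$. Then their free product $\mathcal A\amalg\mathcal B$ is Bloch-Kato, too.
   Context: An $\mathbb N$-graded Lie algebra over $\mathbb F$ is $\mathcal L=\bigoplus_{i\ge1}\mathcal L_i$ with $[\mathcal L_n,\mathcal L_m]\subseteq\mathcal L_{n+m}$. A graded Lie algebra (or subalgebra) is $1$-generated if it is generated as a Lie algebra by elements of degree $1$. The universal envelope $\mathcal U(\mathcal L)$ inherits an $\mathbb N_0$-grading. For graded left $\mathcal U(\mathcal L)$-modules $M,N$, $\operatorname{Ext}^{i,j}_{\mathcal U(\mathcal L)}(M,N)$ is the $i$-th right derived functor (in graded modules) of $\operatorname{Hom}^j(M,N)=\{f:M\to N\ \text{linear over }\mathcal U(\mathcal L): f(M_k)\subseteq N_{k-j}\ \forall k\}$; $H^{i,j}(\mathcal L,\mathbb F)=\operatorname{Ext}^{i,j}_{\mathcal U(\mathcal L)}(\mathbb F,\mathbb F)$, with $\mathbb F$ the trivial module in degree $0$. $\mathcal L$ is Koszul if $H^{i,j}(\mathcal L,\mathbb F)=0$ for all $i\neq j$. A $1$-generated $\mathbb N$-graded Lie algebra is Bloch-Kato if all of its $1$-generated Lie subalgebras (including itself) are Koszul. The free product $\mathcal A\amalg\mathcal B$ is the coproduct of $\mathcal A$ and $\mathcal B$ in the category of $\mathbb N$-graded Lie algebras over $\mathbb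 F$ and graded homomorphisms. *)

(* Defs.v *)
From HB Require Import structures.
From mathcomp Require Import all_boot all_order all_algebra.
From mathcomp Require Import generic_quotient boolp.

Set Implicit Arguments.
Unset Strict Implicit.
Unset Printing Implicit Defensive.

Import GRing.Theory.
Local Open Scope ring_scope.
Local Open Scope quotient_scope.

(* The subgroups D i are independent and their sum is V: V = \bigoplus_i D i. *)
Definition is_grading (I : eqType) (V : zmodType) (D : I -> V -> Prop) : Prop :=
  [/\ forall i, D i 0 /\ (forall x y, D i x -> D i y -> D i (x - y)),
      forall v, exists2 s : seq V,
        (forall x, x \in s -> exists i, D i x) & v = \sum_(x <- s) x
    & forall (s : seq I) (f : I -> V), uniq s -> (forall i, D i (f i)) ->
        \sum_(i <- s) f i = 0 -> forall i, i \in s -> f i = 0].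

HB.mixin Record isLieAlgebra (F : fieldType) L of GRing.Lmodule F L := {
  bracket : L -> L -> L;
  bracket_linearl : forall y : L, linear (bracket^~ y);
  bracket_linearr : forall x : L, linear (bracket x);
  bracketxx : forall x : L, bracket x x = 0;
  bracket_jacobi : forall x y z : L,
    bracket x (bracket y z) + bracket y (bracket z x)
      + bracket z (bracket x y) = 0
}.

#[short(type="lieAlgType")]
HB.structure Definition LieAlgebra (F : fieldType) :=
  {L of GRing.Lmodule F L & isLieAlgebra F L}.

(* Degrees are indexed by nat; the component of degree 0 is null, so that     *)
(* L = \bigoplus_(i >= 1) L_i.                                                *)
HB.mixin Record LieAlgebra_isNGraded (F : fieldType) L of LieAlgebra F L := {
  ldeg : nat -> L -> Prop;
  ldeg_grading : is_grading ldeg;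
  ldegZ : forall (n : nat) (c : F) (x : L), ldeg n x -> ldeg n (c *: x);
  ldeg0_eq0 : forall x : L, ldeg 0%N x -> x = 0;
  ldeg_bracket : forall (n m : nat) (x y : L),
    ldeg n x -> ldeg m y -> ldeg (n + m)%N (bracket x y)
}.

#[short(type="gradedLieType")]
HB.structure Definition GradedLie (F : fieldType) :=
  {L of LieAlgebra F L & LieAlgebra_isNGraded F L}.

Definition is_lie_subalgebra (F : fieldType) (L : lieAlgType F)
    (S : L -> Prop) : Prop :=
  [/\ S 0, forall (c : F) x y, S x -> S y -> S (c *: x + y)
    & forall x y, S x -> S y -> S (bracket x y)].

Definition one_generated (F : fieldType) (L : gradedLieType F) : Prop :=
  forall S : L -> Prop, is_lie_subalgebra S ->
    (forall x, ldeg 1%N x -> S x) -> forall x, S x.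

Definition graded_lie_hom (F : fieldType) (A B : gradedLieType F)
    (f : {linear A -> B}) : Prop :=
  (forall x y, f (bracket x y) = bracket (f x) (f y)) /\
  (forall n x, ldeg n x -> ldeg n (f x)).

(* Coproduct in the category of N-graded Lie algebras and graded              *)
(* homomorphisms: (P, iA, iB) is a free product of A and B.                   *)
Definition is_free_product (F : fieldType) (A B P : gradedLieType F)
    (iA : {linear A -> P}) (iB : {linear B -> P}) : Prop :=
  [/\ graded_lie_hom iA, graded_lie_hom iB
    & forall (C : gradedLieType F) (f : {linear A -> C}) (g : {linear B -> C}),
        graded_lie_hom f -> graded_lie_hom g ->
        exists h : {linear P -> C},
          [/\ graded_lie_hom h, h \o iA =1 f, h \o iB =1 g
            & forall h' : {linear P -> C}, graded_lie_hom h' ->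
                h' \o iA =1 f -> h' \o iB =1 g -> h' =1 h]].

Definition finite_dim_degree1 (F : fieldType) (L : gradedLieType F) : Prop :=
  exists s : seq L, (forall x, x \in s -> ldeg 1%N x) /\
    forall x, ldeg 1%N x ->
      exists c : 'I_(size s) -> F, x = \sum_(i < size s) c i *: s`_i.

Definition homogeneous (F : fieldType) (L : gradedLieType F)
    (S : L -> Prop) : Prop :=
  forall x, S x -> exists2 s : seq L,
    (forall y, y \in s -> S y /\ exists n, ldeg n y) & x = \sum_(y <- s) y.

(* S being a subalgebra, the hypothesis says that S is generated by S_1.      *)
Lemma one_generated_homogeneous (F : fieldType) (L : gradedLieType F)
    (S : L -> Prop) :
  is_lie_subalgebra S ->
  (forall T : L -> Prop, is_lie_subalgebra T ->
     (forall x, ldeg 1%N x -> S x -> T x) -> forall x, S x -> T x) ->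
  homogeneous S.
Proof.
move=> [S0 Sl Sb]; apply; last first.
  move=> x Dx Sx; exists [:: x] => [y|]; last by rewrite big_seq1.
  by rewrite inE => /eqP->; split=> //; exists 1%N.
have SZ c x : S x -> S (c *: x) by move=> Sx; rewrite -[_ *: _]addr0; apply: Sl.
split=> [|c x y [s Hs ->] [t Ht ->]|x y [s Hs ->] [t Ht ->]].
- by exists [::] => //; rewrite big_nil.
- exists ([seq c *: z | z <- s] ++ t) => [z|].
    rewrite mem_cat => /orP[/mapP[z' /Hs[Sz [n Dz]] ->]|/Ht //].
    by split; [apply: SZ | exists n; apply: ldegZ].
  by rewrite big_cat big_map scaler_sumr.
- exists [seq bracket u v | u <- s, v <- t] => [z|].
    case/allpairsP=> -[u v] /= [/Hs[Su [n Du]] /Ht[Sv [m Dv]] ->].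
    by split; [apply: Sb | exists (n + m)%N; apply: ldeg_bracket].
  have bl0 v : bracket (0 : L) v = 0.
    by have := bracket_linearl v (-1) 0 0; rewrite scaler0 add0r scaleN1r addNr.
  have br0 u : bracket u (0 : L) = 0.
    by have := bracket_linearr u (-1) 0 0; rewrite scaler0 add0r scaleN1r addNr.
  rewrite big_allpairs_dep /=.
  elim: (s) => [|u s' IH]; first by rewrite !big_nil bl0.
  rewrite !big_cons -IH -[u in LHS]scale1r bracket_linearl scale1r.
  congr (_ + _); elim: (t) => [|v t' IHt]; first by rewrite !big_nil br0.
  by rewrite !big_cons -IHt -[v in LHS]scale1r bracket_linearr scale1r.
Qed.

Record gradedSubalgebra (F : fieldType) (L : gradedLieType F) :=
  GradedSubalgebra {
    gsub_pred :> L -> Prop;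
    gsub_subalgebra : is_lie_subalgebra gsub_pred;
    gsub_homogeneous : homogeneous gsub_pred
  }.

Section SubLie.
Variables (F : fieldType) (L : gradedLieType F) (S : gradedSubalgebra L).

Definition gsub_mem : {pred L} := fun x => `[< S x >].

Lemma gsub_memP x : reflect (S x) (x \in gsub_mem).
Proof. exact: asboolP. Qed.

Lemma gsub_submod_closed : submod_closed gsub_mem.
Proof.
have [S0 Sl _] := gsub_subalgebra S.
by split=> [|c x y /gsub_memP Sx /gsub_memP Sy]; apply/gsub_memP => //; apply: Sl.
Qed.

HB.instance Definition _ :=
  GRing.isSubmodClosed.Build F L gsub_mem gsub_submod_closed.

Record gsub : Type := Gsub { gsub_val : L; _ : gsub_val \in gsub_mem }.

HB.instance Definition _ := [isSub for gsub_val].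
HB.instance Definition _ := [Choice of gsub by <:].
HB.instance Definition _ := [SubChoice_isSubLmodule of gsub by <:].

Lemma gsub_bracket_mem (x y : gsub) : bracket (\val x) (\val y) \in gsub_mem.
Proof.
have [_ _ Sb] := gsub_subalgebra S.
by apply/gsub_memP/Sb; apply/gsub_memP; apply: valP.
Qed.

Definition gsub_bracket (x y : gsub) : gsub := Gsub (gsub_bracket_mem x y).

Fact gsub_bracket_linearl (y : gsub) : linear (gsub_bracket^~ y).
Proof. by move=> c x x'; apply/val_inj; rewrite /= bracket_linearl. Qed.

Fact gsub_bracket_linearr (x : gsub) : linear (gsub_bracket x).
Proof. by move=> c y y'; apply/val_inj; rewrite /= bracket_linearr. Qed.

Fact gsub_bracketxx (x : gsub) : gsub_bracket x x = 0.
Proof. by apply/val_inj; rewrite /= bracketxx. Qed.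

Fact gsub_jacobi (x y z : gsub) :
  gsub_bracket x (gsub_bracket y z) + gsub_bracket y (gsub_bracket z x)
    + gsub_bracket z (gsub_bracket x y) = 0.
Proof. by apply/val_inj; rewrite /= bracket_jacobi. Qed.

HB.instance Definition _ := isLieAlgebra.Build F gsub
  gsub_bracket_linearl gsub_bracket_linearr gsub_bracketxx gsub_jacobi.

Definition gsub_deg (n : nat) (x : gsub) : Prop := ldeg n (\val x).

Fact gsub_grading : is_grading gsub_deg.
Proof.
have [D0 _ Dind] := @ldeg_grading F L.
split=> [i | v | s f us Df f0 i si].
- by have [Di0 DiB] := D0 i; split=> [//|x y]; apply: DiB.
- have [s Hs Ev] := gsub_homogeneous (elimT (gsub_memP _) (valP v)).
  have vK x : x \in s -> \val (insubd (0 : gsub) x) = x.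
    by move=> /Hs[/gsub_memP Sx _]; rewrite insubdK.
  exists (map (insubd 0) s) => [_ /mapP[x sx ->]|].
    by have [_ [n Dx]] := Hs x sx; exists n; rewrite /gsub_deg vK.
  apply/val_inj; rewrite Ev raddf_sum big_map big_seq [RHS]big_seq.
  by apply: eq_bigr => x /vK.
- apply/val_inj; apply: (Dind s (fun i => \val (f i))) => //.
  by rewrite -raddf_sum f0 raddf0.
Qed.

Fact gsub_degZ n (c : F) x : gsub_deg n x -> gsub_deg n (c *: x).
Proof. exact: ldegZ. Qed.

Fact gsub_deg0_eq0 x : gsub_deg 0%N x -> x = 0.
Proof. by move=> Dx; apply/val_inj; apply: ldeg0_eq0. Qed.

Fact gsub_deg_bracket n m x y :
  gsub_deg n x -> gsub_deg m y -> gsub_deg (n + m)%N (bracket x y).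
Proof. exact: ldeg_bracket. Qed.

HB.instance Definition _ := LieAlgebra_isNGraded.Build F gsub
  gsub_grading gsub_degZ gsub_deg0_eq0 gsub_deg_bracket.

End SubLie.

Section Envelope.
Variables (F : fieldType) (L : lieAlgType F).

Definition is_lie_rep (A : algType F) (f : L -> A) : Prop :=
  linear f /\ forall x y, f (bracket x y) = f x * f y - f y * f x.

(* Associative algebra expressions over L. U(L) is the quotient of these      *)
(* expressions identifying two of them when they have the same value under    *)
(* every Lie homomorphism of L to an associative algebra; this is             *)
(* the solution of the universal problem, see uiota_lie_rep, uenv_lift_mor,   *)
(* uenv_lift_iota and uenv_lift_unique.                                      *)
Inductive uterm : Type :=
  | Uzero | Uone | Uvar of L
  | Uadd of uterm & uterm | Umul of uterm & uterm | Uscale of F & uterm.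

HB.instance Definition _ := gen_eqMixin uterm.
HB.instance Definition _ := gen_choiceMixin uterm.

Fixpoint ueval (A : algType F) (f : L -> A) (t : uterm) : A :=
  match t with
  | Uzero => 0
  | Uone => 1
  | Uvar x => f x
  | Uadd t1 t2 => ueval f t1 + ueval f t2
  | Umul t1 t2 => ueval f t1 * ueval f t2
  | Uscale c t1 => c *: ueval f t1
  end.

Definition ueqv (t1 t2 : uterm) : bool :=
  `[< forall (A : algType F) (f : L -> A),
        is_lie_rep f -> ueval f t1 = ueval f t2 >].

Fact ueqv_is_equiv : equiv_class_of ueqv.
Proof.
split=> [t | t1 t2 | t2 t1 t3]; first exact/asboolP.
  by apply/asboolP/asboolP => H A f /H.
by move=> /asboolP H12 /asboolP H23; apply/asboolP => A f Hf; rewrite H12 ?H23.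
Qed.

Canonical ueqv_equiv := EquivRelPack ueqv_is_equiv.

Definition uenv : Type := {eq_quot ueqv}.
HB.instance Definition _ := Choice.on uenv.

Definition upi (t : uterm) : uenv := \pi_{eq_quot ueqv} t.
Definition urepr (u : uenv) : uterm := repr (u : {eq_quot ueqv}).

Fact upi_eq t1 t2 :
  upi t1 = upi t2 <->
  forall (A : algType F) (f : L -> A), is_lie_rep f -> ueval f t1 = ueval f t2.
Proof.
split=> [/eqmodP/asboolP // | H]; apply/eqmodP; exact/asboolP.
Qed.

Fact ureprK u : upi (urepr u) = u.
Proof. exact: reprK. Qed.

Definition uenv_lift (A : algType F) (f : L -> A) (u : uenv) : A :=
  ueval f (urepr u).

Fact uenv_lift_pi (A : algType F) (f : L -> A) t :
  is_lie_rep f -> uenv_lift f (upi t) = ueval f t.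
Proof. by move=> Hf; apply: (upi_eq _ _).1 => //; rewrite ureprK. Qed.

Fact uenv_ext (u v : uenv) :
  (forall (A : algType F) (f : L -> A), is_lie_rep f ->
     uenv_lift f u = uenv_lift f v) -> u = v.
Proof. by move=> H; rewrite -(ureprK u) -(ureprK v); apply/upi_eq. Qed.

Definition uadd (u v : uenv) := upi (Uadd (urepr u) (urepr v)).
Definition umul (u v : uenv) := upi (Umul (urepr u) (urepr v)).
Definition uscale (c : F) (u : uenv) := upi (Uscale c (urepr u)).
Definition uopp (u : uenv) := uscale (-1) u.
Definition uiota (x : L) : uenv := upi (Uvar x).

Section Lift.
Variables (A : algType F) (f : L -> A) (Hf : is_lie_rep f).

Let lift0 : uenv_lift f (upi Uzero) = 0. Proof. exact: uenv_lift_pi. Qed.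
Let lift1 : uenv_lift f (upi Uone) = 1. Proof. exact: uenv_lift_pi. Qed.
Let liftX x : uenv_lift f (uiota x) = f x. Proof. exact: uenv_lift_pi. Qed.
Let liftD u v : uenv_lift f (uadd u v) = uenv_lift f u + uenv_lift f v.
Proof. exact: uenv_lift_pi. Qed.
Let liftM u v : uenv_lift f (umul u v) = uenv_lift f u * uenv_lift f v.
Proof. exact: uenv_lift_pi. Qed.
Let liftZ c u : uenv_lift f (uscale c u) = c *: uenv_lift f u.
Proof. exact: uenv_lift_pi. Qed.
Let liftN u : uenv_lift f (uopp u) = - uenv_lift f u.
Proof. by rewrite liftZ scaleN1r. Qed.

Definition liftE := (lift0, lift1, liftX, liftN, liftD, liftM, liftZ).
End Lift.

Fact uaddA : associative uadd.
Proof. by move=> *; apply: uenv_ext => A f Hf; rewrite !(liftE Hf) addrA. Qed.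
Fact uaddC : commutative uadd.
Proof. by move=> *; apply: uenv_ext => A f Hf; rewrite !(liftE Hf) addrC. Qed.
Fact uadd0 : left_id (upi Uzero) uadd.
Proof. by move=> *; apply: uenv_ext => A f Hf; rewrite !(liftE Hf) add0r. Qed.
Fact uaddN : left_inverse (upi Uzero) uopp uadd.
Proof. by move=> *; apply: uenv_ext => A f Hf; rewrite !(liftE Hf) addNr. Qed.

HB.instance Definition _ := GRing.isZmodule.Build uenv uaddA uaddC uadd0 uaddN.

Fact umulA : associative umul.
Proof. by move=> *; apply: uenv_ext => A f Hf; rewrite !(liftE Hf) mulrA. Qed.
Fact umul1l : left_id (upi Uone) umul.
Proof. by move=> *; apply: uenv_ext => A f Hf; rewrite !(liftE Hf) mul1r. Qed.
Fact umul1r : right_id (upi Uone) umul.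
Proof. by move=> *; apply: uenv_ext => A f Hf; rewrite !(liftE Hf) mulr1. Qed.
Fact umulDl : left_distributive umul uadd.
Proof. by move=> *; apply: uenv_ext => A f Hf; rewrite !(liftE Hf) mulrDl. Qed.
Fact umulDr : right_distributive umul uadd.
Proof. by move=> *; apply: uenv_ext => A f Hf; rewrite !(liftE Hf) mulrDr. Qed.

Fact lie_rep0 : is_lie_rep (fun _ : L => 0 : F^o).
Proof. by split=> [c x y|x y]; rewrite ?scaler0 ?addr0 // mulr0 subr0. Qed.

Fact uone_neq0 : upi Uone != 0.
Proof.
apply/eqP => /upi_eq /(_ _ _ lie_rep0) /= /eqP.
by rewrite oner_eq0.
Qed.

HB.instance Definition _ := GRing.Zmodule_isNzRing.Build uenv
  umulA umul1l umul1r umulDl umulDr uone_neq0.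

Fact uscaleA c d u : uscale c (uscale d u) = uscale (c * d) u.
Proof. by apply: uenv_ext => A f Hf; rewrite !(liftE Hf) scalerA. Qed.
Fact uscale1 : left_id 1 uscale.
Proof. by move=> *; apply: uenv_ext => A f Hf; rewrite !(liftE Hf) scale1r. Qed.
Fact uscaleDr : right_distributive uscale uadd.
Proof. by move=> *; apply: uenv_ext => A f Hf; rewrite !(liftE Hf) scalerDr. Qed.
Fact uscaleDl u : {morph uscale^~ u : c d / c + d >-> uadd c d}.
Proof. by move=> *; apply: uenv_ext => A f Hf; rewrite !(liftE Hf) scalerDl. Qed.

HB.instance Definition _ := GRing.Zmodule_isLmodule.Build F uenv
  uscaleA uscale1 uscaleDr uscaleDl.

Fact uscaleAl (c : F) (u v : uenv) : uscale c (umul u v) = umul (uscale c u) v.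
Proof. by apply: uenv_ext => A f Hf; rewrite !(liftE Hf) scalerAl. Qed.
Fact uscaleAr (c : F) (u v : uenv) : uscale c (umul u v) = umul u (uscale c v).
Proof. by apply: uenv_ext => A f Hf; rewrite !(liftE Hf) scalerAr. Qed.

HB.instance Definition _ := GRing.Lmodule_isLalgebra.Build F uenv uscaleAl.
HB.instance Definition _ := GRing.Lalgebra_isAlgebra.Build F uenv uscaleAr.

Lemma uiota_lie_rep : is_lie_rep (uiota : L -> uenv).
Proof.
split=> [c x y|x y]; apply: uenv_ext => A f Hf; have [Hl Hb] := Hf.
  transitivity (uenv_lift f (uadd (uscale c (uiota x)) (uiota y))) => //.
  by rewrite !(liftE Hf) Hl.
transitivity (uenv_lift f (uadd (umul (uiota x) (uiota y))
  (uopp (umul (uiota y) (uiota x))))) => //.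
by rewrite !(liftE Hf) Hb.
Qed.

Lemma uenv_lift_mor (A : algType F) (f : L -> A) : is_lie_rep f ->
  [/\ linear (uenv_lift f), {morph uenv_lift f : u v / u * v}
    & uenv_lift f 1 = 1].
Proof.
move=> Hf; split=> [c u v|u v|]; last by rewrite (_ : 1 = upi Uone) ?(liftE Hf).
  by rewrite (_ : c *: u + v = uadd (uscale c u) v) // !(liftE Hf).
by rewrite (_ : u * v = umul u v) // (liftE Hf).
Qed.

Lemma uenv_lift_iota (A : algType F) (f : L -> A) x :
  is_lie_rep f -> uenv_lift f (uiota x) = f x.
Proof. by move=> Hf; rewrite (liftE Hf). Qed.

Lemma uenv_lift_unique (A : algType F) (f : L -> A) (g : uenv -> A) :
  linear g -> {morph g : u v / u * v} -> g 1 = 1 ->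
  (forall x, g (uiota x) = f x) -> g =1 uenv_lift f.
Proof.
move=> gl gM g1 gf u; rewrite -{1}(ureprK u) /uenv_lift.
have gD v w : g (v + w) = g v + g w by have := gl 1 v w; rewrite !scale1r.
have g0 : g 0 = 0 by apply: (addrI (g 0)); rewrite -gD !addr0.
elim: (urepr u) => [||x|s IHs t IHt|s IHs t IHt|c t IHt] /=.
- exact: g0.
- exact: g1.
- exact: gf.
- rewrite -IHs -IHt -gD; congr (g _).
  by apply: uenv_ext => B h Hh; rewrite (liftE Hh) !uenv_lift_pi.
- rewrite -IHs -IHt -gM; congr (g _).
  by apply: uenv_ext => B h Hh; rewrite (liftE Hh) !uenv_lift_pi.
- rewrite -IHt -[c *: _]addr0 -g0 -gl addr0; congr (g _).
  by apply: uenv_ext => B h Hh; rewrite (liftE Hh) !uenv_lift_pi.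
Qed.

(* The augmentation U(L) -> F, which is null on L.                            *)
Definition uaug (u : uenv) : F := uenv_lift (fun=> 0 : F^o) u.

Definition trivmod (M : lieAlgType F) : Type := F.
HB.instance Definition _ := GRing.Zmodule.on (trivmod L).

Definition triv_scale (u : uenv) (a : trivmod L) : trivmod L := uaug u * a.

Fact triv_scaleA u v a : triv_scale u (triv_scale v a) = triv_scale (u * v) a.
Proof.
have [_ Lm _] := uenv_lift_mor lie_rep0.
by rewrite /triv_scale mulrA; congr (_ * _); rewrite /uaug Lm.
Qed.
Fact triv_scale1 : left_id 1 triv_scale.
Proof.
have [_ _ L1] := uenv_lift_mor lie_rep0.
by move=> a; rewrite /triv_scale /uaug L1 mul1r.
Qed.
Fact triv_scaleDr : right_distributive triv_scale +%R.
Proof. by move=> u a b; exact: mulrDr. Qed.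
Fact triv_scaleDl a : {morph triv_scale^~ a : u v / u + v}.
Proof.
have [Ll _ _] := uenv_lift_mor lie_rep0.
move=> u v; rewrite /triv_scale -mulrDl; congr (_ * _).
by have := Ll 1 u v; rewrite !scale1r.
Qed.

HB.instance Definition _ := GRing.Zmodule_isLmodule.Build uenv (trivmod L)
  triv_scaleA triv_scale1 triv_scaleDr triv_scaleDl.

End Envelope.

(* U(L)_n is spanned by the monomials x_1 ... x_k with x_i in L_(n_i) and     *)
(* n = n_1 + ... + n_k.                                                       *)
Inductive uenv_deg (F : fieldType) (L : gradedLieType F) :
    nat -> uenv L -> Prop :=
  | uenv_deg0 n : uenv_deg n 0
  | uenv_degD n u v : uenv_deg n u -> uenv_deg n v -> uenv_deg n (u + v)
  | uenv_degZ n (c : F) u : uenv_deg n u -> uenv_deg n (c *: u)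
  | uenv_deg1 : uenv_deg 0%N 1
  | uenv_degM n m x u : ldeg n x -> uenv_deg m u ->
      uenv_deg (n + m)%N (uiota x * u).

Section GradedModules.
Variables (U : nzRingType) (G : nat -> U -> Prop).

Record gradedModule := GradedModule {
  gmod_sort :> lmodType U;
  mdeg : int -> gmod_sort -> Prop;
  mdeg_grading : is_grading mdeg;
  mdeg_scale : forall (n : nat) (k : int) (u : U) (x : gmod_sort),
    G n u -> mdeg k x -> mdeg (n%:Z + k) (u *: x)
}.

(* f belongs to Hom^j(M, N). The morphisms of graded modules are the elements *)
(* of Hom^0.                                                                  *)
Definition in_hom (M N : gradedModule) (j : int) (f : {linear M -> N}) : Prop :=
  forall (k : int) (x : M), mdeg k x -> mdeg (k - j) (f x).

Definition graded_projective (P : gradedModule) : Prop :=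
  forall (M N : gradedModule) (g : {linear M -> N}) (f : {linear P -> N}),
    in_hom 0 g -> in_hom 0 f -> (forall y, exists x, g x = y) ->
    exists2 h : {linear P -> M}, in_hom 0 h & g \o h =1 f.

Record projResolution (M : gradedModule) := ProjResolution {
  res_mod :> nat -> gradedModule;
  res_d : forall n, {linear res_mod n.+1 -> res_mod n};
  res_aug : {linear res_mod 0%N -> M};
  res_proj : forall n, graded_projective (res_mod n);
  res_d_hom : forall n, in_hom 0 (res_d n);
  res_aug_hom : in_hom 0 res_aug;
  res_aug_surj : forall y, exists x, res_aug x = y;
  res_exact0 : forall x, res_aug x = 0 <-> exists y, res_d 0%N y = x;
  res_exact : forall n x, res_d n x = 0 <-> exists y, res_d n.+1 y = x
}.

(* Cocycles and coboundaries of degree i of the complex Hom^j(P, N).          *)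
Definition cocycle (M N : gradedModule) (P : projResolution M)
    (i : nat) (j : int) (f : {linear P i -> N}) : Prop :=
  in_hom j f /\ forall x, f (res_d P i x) = 0.

Definition coboundary (M N : gradedModule) (P : projResolution M)
    (i : nat) (j : int) : {linear P i -> N} -> Prop :=
  match i with
  | 0%N => fun f => forall x, f x = 0
  | i'.+1 => fun f => exists2 g : {linear P i' -> N},
                 in_hom j g & forall x, f x = g (res_d P i' x)
  end.

(* Ext^{i,j}(M, N) = 0. As the cohomology of Hom^j(P, N) does not depend on   *)
(* the projective resolution P of M, all of them are considered.              *)
Definition Ext_eq0 (M N : gradedModule) (i : nat) (j : int) : Prop :=
  forall (P : projResolution M) (f : {linear P i -> N}),
    cocycle j f -> coboundary j f.

End GradedModules.

Section Koszul.
Variables (F : fieldType) (L : gradedLieType F).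

Definition triv_deg (k : int) (a : trivmod L) : Prop := k = 0 \/ a = 0.

Fact triv_grading : is_grading triv_deg.
Proof.
split=> [k | a | s f us Df f0 i si].
- split; first by right.
  by move=> a b [->|->] [|->]; [left | left | move=> ->; left | right; rewrite subr0].
- exists [:: a]; last by rewrite big_seq1.
  by move=> b _; exists 0; left.
- case: (Df i) => // i0; rewrite {}i0 in si *.
  move: f0; rewrite (bigD1_seq 0) //= big1 ?addr0 // => k k0.
  by case: (Df k) => // /eqP; rewrite (negbTE k0).
Qed.

Fact triv_deg_scale (n : nat) (k : int) (u : uenv L) (a : trivmod L) :
  uenv_deg n u -> triv_deg k a -> triv_deg (n%:Z + k) (u *: a).
Proof.
have [Ll Lm L1] := uenv_lift_mor (@lie_rep0 F L).
move=> Du [->|->]; last by right; rewrite scaler0.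
suff: n = 0%N \/ uaug u = 0.
  by case=> [->|Hu]; [left | right; rewrite /GRing.scale /= /triv_scale Hu mul0r].
have lift0 : uenv_lift (fun=> 0 : F^o) (0 : uenv L) = 0.
  by have := Ll (-1) 0 0; rewrite scaleN1r addNr scaleN1r addNr.
rewrite /uaug; elim: Du => [i|i v w _ IHv _ IHw|i c v _ IHv||i m x v _ _ _].
- by right.
- case: IHv IHw => [->|Hv] [i0|Hw]; [by left | by left | by left |].
  by right; have := Ll 1 v w; rewrite !scale1r Hv Hw addr0.
- case: IHv => [->|Hv]; [by left | right].
  by have := Ll c v 0; rewrite addr0 Hv scaler0 add0r lift0.
- by left.
- by right; rewrite Lm uenv_lift_iota ?mul0r //; apply: lie_rep0.
Qed.

Definition trivial_module : gradedModule (@uenv_deg F L) :=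
  GradedModule triv_grading triv_deg_scale.

Definition cohomology_eq0 (i : nat) (j : int) : Prop :=
  Ext_eq0 trivial_module trivial_module i j.

Definition koszul : Prop :=
  forall (i : nat) (j : int), i%:Z <> j -> cohomology_eq0 i j.

End Koszul.

(* Every 1-generated subalgebra is graded by one_generated_homogeneous; the   *)
(* case of L itself is the subalgebra S = L.                                  *)
Definition bloch_kato (F : fieldType) (L : gradedLieType F) : Prop :=
  one_generated L /\
  forall S : gradedSubalgebra L, one_generated (gsub S) -> koszul (gsub S).

(* Main.v *)
(* A graded Lie algebra M generated by a finite-dimensional M_1 is Koszul as    *)
(* soon as, for y_1, ..., y_k, x linearly independent in M_1, the colon ideal   *)
(* {r | r x \in \sum_i U(M) y_i} is a left ideal generated by elements of M_1:  *)
(* iterated mapping cones then resolve the trivial module by free modules whose *)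
(* i-th term is generated in degree i. By the Poincare-Birkhoff-Witt theorem    *)
(* U(P) is free over U(M) for every subalgebra M of P, and the condition passes *)
(* from P to M; so it is enough to check it for the free product P of A and B.  *)
(*   The augmentation ideal of U(P) is the direct sum of U(P) A and U(P) B; the *)
(* projections are Fox derivatives. A relation \sum_i r_i v_i = 0 between       *)
(* independent elements v_i of A_1 + B_1 splits accordingly in one relation     *)
(* between elements of A_1 and one between elements of B_1. The former is a     *)
(* relation over the subalgebra of A generated by the elements involved; this   *)
(* is Koszul, as A is Bloch-Kato, and H^{2,j} = 0 for j <> 2 says that the      *)
(* relations between its generators are consequences of those whose             *)
(* coefficients have degree 1.                                                  *)
From HB Require Import structures.
From mathcomp Require Import all_boot all_order all_algebra.
From mathcomp Require Import boolp functions wochoice finmap monalg zify.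
Require Import Defs.

Set Implicit Arguments.
Unset Strict Implicit.
Unset Printing Implicit Defensive.

Import Order.TTheory GRing.Theory Num.Theory.
Local Open Scope ring_scope.

(** * Linear algebra *)

(** Koszulness is deduced from a property of left ideals, close to the existence of a Koszul
    filtration. Suppose that [M] is generated by a finite-dimensional M_1 and that, for independent
    y_1, ..., y_k, x in M_1, the colon ideal {r | r x in the sum of the U(M) y_i} is generated in
    degree 1. Its generators may be taken independent in M_1, so the property applies to them in
    turn. Every syzygy of the trivial module then has generators in a single degree, one more at
    each step, and Ext^{i,j}(F, F) = 0 for i <> j ([linear_syzygies], [linear_colons_pure],
    [pure_Ext_eq0], [koszul_criterion], [linear_colon_koszul]).

    The property passes from a Lie algebra to its graded subalgebras, because U(P) is free over U(M)
    by Poincare-Birkhoff-Witt ([uenv_free], [linear_colon_restrict]). So only the free product [P]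
    itself has to be examined ([colon_linear]).

    The augmentation ideal of U(P) is the direct sum of U(P) A and U(P) B ([fox_derivative]). Let V
    be the span of y_1, ..., y_k, x. It has a basis made of a basis u of its intersection with A, a
    basis w of its intersection with B, and a rest d. A relation between these vectors projects to a
    relation between the A-components of u and d, which are independent in A_1. They generate a
    subalgebra of [A], Koszul because [A] is Bloch-Kato, and H^{2,j} = 0 for j <> 2 says that the
    relations between its generators follow from those with coefficients of degree 1
    ([linear_relations]). Freeness of U(P) over the envelope of this subalgebra gives the same with
    coefficients in U(P) ([bk_linear_relations]). In particular the coefficients of d lie in U(P) A
    and, by symmetry, in U(P) B; they are 0. The relation splits into a relation over A and one over
    B, both generated by linear ones, and reading the coefficient of x yields generators of degree 1
    of the colon ideal. *)

Section Span.
Variables (R : pzRingType) (V : lmodType R).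

Definition subspace (W : V -> Prop) :=
  W 0 /\ forall c x y, W x -> W y -> W (c *: x + y).

Inductive span (S : V -> Prop) : V -> Prop :=
  | span0 : span S 0
  | spanI x : S x -> span S x
  | spanL c x y : span S x -> span S y -> span S (c *: x + y).

Lemma span_subspace S : subspace (span S).
Proof. by split; [exact: span0 | exact: spanL]. Qed.

Lemma subspaceD W x y : subspace W -> W x -> W y -> W (x + y).
Proof. by move=> [_ H] Wx Wy; rewrite -[x]scale1r; apply: H. Qed.
Lemma subspaceZ W c x : subspace W -> W x -> W (c *: x).
Proof. by move=> [W0 H] Wx; rewrite -[_ *: _]addr0; apply: H. Qed.
Lemma subspaceN W x : subspace W -> W x -> W (- x).
Proof. by move=> H Wx; rewrite -scaleN1r; apply: subspaceZ. Qed.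
Lemma subspaceB W x y : subspace W -> W x -> W y -> W (x - y).
Proof. by move=> H Wx Wy; apply: subspaceD => //; apply: subspaceN. Qed.
Lemma subspace_sum W (I : Type) (r : seq I) (P : pred I) (f : I -> V) :
  subspace W -> (forall i, P i -> W (f i)) -> W (\sum_(i <- r | P i) f i).
Proof. by move=> H Hf; elim/big_rec: _ => [|i x /Hf]; [case: H | apply: subspaceD]. Qed.

Lemma span_sub S W : subspace W -> (forall x, S x -> W x) -> forall x, span S x -> W x.
Proof. by move=> [W0 Wl] SW x; elim=> // c y z _ Wy _; apply: Wl. Qed.

Lemma span_mono S S' : (forall x, S x -> S' x) -> forall x, span S x -> span S' x.
Proof. by move=> H; apply: span_sub (span_subspace _) _ => x /H; apply: spanI. Qed.

Lemma spanD S x y : span S x -> span S y -> span S (x + y).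
Proof. exact: subspaceD (span_subspace S). Qed.
Lemma spanB S x y : span S x -> span S y -> span S (x - y).
Proof. exact: subspaceB (span_subspace S). Qed.
Lemma spanZ S c x : span S x -> span S (c *: x).
Proof. exact: subspaceZ (span_subspace S). Qed.
Lemma span_sum S (I : Type) (r : seq I) (P : pred I) (f : I -> V) :
  (forall i, P i -> span S (f i)) -> span S (\sum_(i <- r | P i) f i).
Proof. exact: subspace_sum (span_subspace S). Qed.

Definition lspan (s : seq V) : V -> Prop := span (fun x => x \in s).

Lemma lspan_mem s x : x \in s -> lspan s x.
Proof. exact: spanI. Qed.

Lemma lspan_nil x : lspan [::] x -> x = 0.
Proof. by elim=> // c y z _ -> _ ->; rewrite scaler0 addr0. Qed.

Lemma lspan_rcons s y x : lspan (rcons s y) x <-> exists c, lspan s (x - c *: y).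
Proof.
split=> [|[c]].
  elim=> [|z|c u v _ [d Hd] _ [e He]].
  - by exists 0; rewrite scale0r subr0; apply: span0.
  - rewrite mem_rcons inE => /orP[/eqP->|sz].
      by exists 1; rewrite scale1r subrr; apply: span0.
    by exists 0; rewrite scale0r subr0; apply: spanI.
  - exists (c * d + e); rewrite scalerDl -scalerA opprD addrACA -scalerBr.
    exact: spanL.
move=> H; rewrite -[x](subrK (c *: y)); apply: spanD.
  by apply: span_mono H => z sz; rewrite mem_rcons inE sz orbT.
by apply/spanZ/spanI; rewrite mem_rcons inE eqxx.
Qed.

Lemma lspan_sub s t : (forall x, x \in s -> lspan t x) -> forall x, lspan s x -> lspan t x.
Proof. exact: span_sub (span_subspace _). Qed.

Lemma lspan_sumE s x : lspan s x -> exists c : 'I_(size s) -> R, x = \sum_i c i *: s`_i.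
Proof.
elim=> [|y sy|c y z _ [d ->] _ [e ->]].
- by exists (fun=> 0); rewrite big1 // => i _; rewrite scale0r.
- have ly : (index y s < size s)%N by rewrite index_mem.
  exists (fun i => if i == Ordinal ly then 1 else 0).
  rewrite (bigD1 (Ordinal ly)) //= eqxx scale1r nth_index // big1 ?addr0 //.
  by move=> i /negbTE->; rewrite scale0r.
- exists (fun i => c * d i + e i); rewrite scaler_sumr -big_split.
  by apply: eq_bigr => i _; rewrite scalerDl scalerA.
Qed.

Lemma lspan_cat (s t : seq V) x : lspan (s ++ t) x -> exists y z, [/\ lspan s y, lspan t z & x = y + z].
Proof.
elim=> [|y|c y z _ [a [b [ua wb ->]]] _ [a' [b' [ua' wb' ->]]]].
- by exists 0, 0; rewrite addr0; split=> //; apply: span0.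
- rewrite mem_cat => /orP[uy|wy]; [exists y, 0|exists 0, y];
    by rewrite ?addr0 ?add0r; split=> //; (exact: span0 || exact: spanI).
- exists (c *: a + a'), (c *: b + b'); rewrite scalerDr addrACA.
  by split=> //; apply: spanL.
Qed.

End Span.

Lemma linear_span (R : pzRingType) (V W : lmodType R) (g : {linear V -> W}) S T :
  (forall x, S x -> span T (g x)) -> forall x, span S x -> span T (g x).
Proof.
move=> H x; elim=> [|y /H //|c y z _ Hy _ Hz]; first by rewrite raddf0; apply: span0.
by rewrite linearP; apply: spanL.
Qed.

Lemma linear_eq_span (R : pzRingType) (V W : lmodType R) (g h : {linear V -> W}) S :
  (forall x, S x -> g x = h x) -> forall x, span S x -> g x = h x.
Proof.
move=> H x; elim=> [|y /H //|c y z _ Hy _ Hz]; first by rewrite !raddf0.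
by rewrite !linearP Hy Hz.
Qed.

Lemma lspan_map (R : pzRingType) (V W : lmodType R) (g : {linear V -> W}) (s : seq V) y :
  lspan (map g s) y -> exists2 x, lspan s x & g x = y.
Proof.
elim=> [|_ /mapP[x sx ->]|c _ _ _ [x Hx <-] _ [z Hz <-]].
- by exists 0; [apply: span0 | rewrite linear0].
- by exists x => //; apply: lspan_mem.
- by exists (c *: x + z); [apply: spanL | rewrite linearP].
Qed.

Section MkLin.
Variables (R : pzRingType) (V W : lmodType R) (f : V -> W) (Hf : linear f).
Definition mklin_fun := f.
HB.instance Definition _ := GRing.isLinear.Build R V W *:%R mklin_fun Hf.
Definition mklin : {linear V -> W} := mklin_fun.
Lemma mklinE x : mklin x = f x. Proof. by []. Qed.
End MkLin.

(** * Bases adapted to a subset, by well-ordering *)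

Section Basis.
Variables (F : fieldType) (V : lmodType F) (W : V -> Prop).

Let wo : {R : rel V | well_order R} := well_ordering_principle V.
Let R : rel V := sval wo.
Let RP : well_order R := svalP wo.

Let inW x := `[< W x >].
Let le x y := if inW x == inW y then R x y else inW x.
Let lt x y := (x != y) && le x y.

Let R_min (P : V -> Prop) : (exists x, P x) -> exists2 x, P x & forall y, P y -> R x y.
Proof.
move=> [x Px]; have [|z [[zA zm] _]] := RP (A := [pred x | `[< P x >]]).
  by exists x; apply/asboolP.
exists z; first exact/asboolP.
by move=> y Py; apply: zm; apply/asboolP.
Qed.

Let le_min (P : V -> Prop) : (exists x, P x) -> exists2 x, P x & forall y, P y -> le x y.
Proof.
move=> exP; case: (pselect (exists x, P x /\ inW x)) => [H|H].
  have [x [Px Wx] xm] := R_min H; exists x => // y Py.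
  by rewrite /le Wx; case: (boolP (inW y)) => Wy //=; apply: xm.
have [x Px xm] := R_min exP; exists x => // y Py.
have nW z : P z -> inW z = false.
  by move=> Pz; apply/negP => Wz; apply: H; exists z.
by rewrite /le !nW //; apply: xm.
Qed.

Let R_anti : antisymmetric R.
Proof.
have Rxx x : R x x.
  by have [z /eqP-> H] : exists2 z, z == x & forall y, y = x -> R z y;
    [have [|z Ez zm] := @R_min (fun z => z = x); [exists x|exists z; [apply/eqP|]] | apply: H].
move=> x y /andP[Rxy Ryx].
have [|z [_ Uz]] := RP (A := [pred z | (z == x) || (z == y)]).
  by exists x; rewrite inE eqxx.
have zx : z = x.
  by apply: Uz; split=> [|t]; rewrite inE ?eqxx // => /orP[]/eqP->.
by rewrite -zx; apply: Uz; split=> [|t]; rewrite inE ?eqxx ?orbT // => /orP[]/eqP->.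
Qed.

Let le_anti x y : le x y -> le y x -> x = y.
Proof.
rewrite /le [inW y == _]eq_sym; case: eqP => [_ Rx Ry|/eqP].
  by apply: R_anti; rewrite Rx Ry.
by case: (inW x); case: (inW y).
Qed.

Let le_total x y : le x y \/ le y x.
Proof.
have [|z] := @le_min (fun z => z = x \/ z = y); first by exists x; left.
by move=> [->|->] H; [left|right]; apply: H; auto.
Qed.

Let lt_ind (P : V -> Prop) : (forall x, (forall y, lt y x -> P y) -> P x) -> forall x, P x.
Proof.
move=> H x; apply: contrapT => nPx.
have [|z nPz zm] := @le_min (fun x => ~ P x); first by exists x.
apply: nPz; apply: H => y /andP[yz leyz]; apply: contrapT => nPy.
by move/eqP: yz; apply; apply: le_anti => //; apply: zm.
Qed.

Let lt_cases x y : [\/ lt x y, x = y | lt y x].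
Proof.
have [->|xy] := eqVneq x y; first by constructor 2.
by have [H|H] := le_total x y; [constructor 1|constructor 3]; rewrite /lt ?xy ?[y == x]eq_sym ?xy.
Qed.

Let le_trans x y z : le x y -> le y z -> le x z.
Proof.
move=> Hxy Hyz.
have [|m] := @le_min (fun u => [\/ u = x, u = y | u = z]).
  by exists x; constructor 1.
case=> -> H.
- by apply: H; constructor 3.
- have <- : y = x by apply: le_anti => //; apply: H; constructor 1.
  by [].
- have -> : z = y by apply: le_anti => //; apply: H; constructor 2.
  by [].
Qed.

Let lt_trans x y z : lt x y -> lt y z -> lt x z.
Proof.
move=> /andP[xy Lxy] /andP[yz Lyz]; rewrite /lt (le_trans Lxy Lyz) andbT.
apply/eqP => xz; move/eqP: xy; apply; apply: le_anti => //.
by rewrite xz.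
Qed.

(** Transfinite Gaussian elimination: a vector is kept when the smaller ones do not span it. The
    elements of [W] precede all others for [le], so the elimination inside [W] only involves
    elements of [W], whence [basis_spanW]. *)
Let basis b := ~ span (lt^~ b) b.

Let basis_span v : span basis v.
Proof.
elim/lt_ind: v => v IH; case: (pselect (span (lt^~ v) v)) => [H|H].
  by apply: span_sub H => //; apply: span_subspace.
exact: spanI.
Qed.

Let basis_spanW w : W w -> span (fun b => basis b /\ W b) w.
Proof.
elim/lt_ind: w => w IH Ww; case: (pselect (span (lt^~ w) w)) => [H|H]; last exact: spanI.
apply: span_sub H; first exact: span_subspace.
move=> y lty; apply: IH => //.
move: lty => /andP[_]; rewrite /le; have -> : inW w = true by apply/asboolP.
by case: eqP => [/asboolP //|_ /asboolP].
Qed.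

Section Extend.
Variables (N : lmodType F) (f : V -> N).

(** The linear extension of [f] is built as a graph, spanned by the pairs (b, f b). It remains to
    see that the graph is total and single-valued. *)
Let gr (D : V -> Prop) : (V * N)%type -> Prop :=
  span (fun p => exists b, [/\ D b, basis b & p = (b, f b)]).

Let gr_lead D p : gr D p -> (p = 0) \/
  exists b c q, [/\ D b, basis b, gr (lt^~ b) q & p = c *: (b, f b) + q].
Proof.
elim=> [|q [b [Db Bb ->]]|c q r _ IHq _ IHr]; first by left.
  right; exists b, 1, 0; split=> //; first exact: span0.
  by rewrite scale1r addr0.
case: IHq => [->|[b [d [q' [Db Bb Hq' Eq]]]]]; first by rewrite scaler0 add0r.
case: IHr => [->|[b' [d' [r' [Db' Bb' Hr' Er]]]]]; right.
  exists b, (c * d), (c *: q'); split=> //; first exact: spanZ.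
  by rewrite Eq addr0 scalerDr scalerA.
have up x y z e : lt x y -> basis x -> gr (lt^~ x) z -> gr (lt^~ y) (e *: (x, f x) + z).
  move=> ltxy Bx Hz; apply: spanL; first by apply: spanI; exists x.
  apply: span_mono Hz => p' [b0 [L0 B0 E0]]; exists b0; split=> //.
  exact: lt_trans ltxy.
case: (lt_cases b b') => [L|E|L].
- exists b', d', (c *: q + r'); split=> //; last by rewrite Er addrCA.
  by apply: spanL => //; rewrite Eq; apply: up.
- exists b, (c * d + d'), (c *: q' + r'); split=> //.
    by apply: spanL => //; rewrite E.
  by rewrite Eq Er -E scalerDl scalerDr scalerA addrACA.
- exists b, (c * d), (c *: q' + r); split=> //; last first.
    by rewrite Eq scalerDr scalerA addrA.
  by apply: spanL => //; rewrite Er; apply: up.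
Qed.

Let gr_fst D p : gr D p -> span D p.1.
Proof.
elim=> [|q [b [Db _ ->]]|c q r _ IHq _ IHr]; first exact: span0.
  exact: spanI.
exact: spanL.
Qed.

(** If the leading term of (0, n) had a nonzero coefficient, its basis vector would be a combination
    of smaller ones; so the leading term disappears and well-founded induction applies to the
    rest. *)
Let gr_fun_step D n : (forall b m, D b -> gr (lt^~ b) (0, m) -> m = 0) -> gr D (0, n) -> n = 0.
Proof.
move=> IH /gr_lead [[]//|[b [c [q [Db Bb Hq]]]]].
case: q Hq => q1 q2 Hq [E1 E2].
have c0 : c = 0.
  apply: contrapT => /eqP cn0; apply: Bb.
  have -> : span (lt^~ b) b = span (lt^~ b) (- c^-1 *: q1).
    congr (span _ _).
    apply: (scalerI cn0); rewrite scaleNr scalerN scalerA mulfV // scale1r.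
    by apply: subr0_eq; rewrite opprK -E1.
  by apply: spanZ; apply: (gr_fst Hq).
move: E1 E2; rewrite c0 !scale0r !add0r => E1 ->.
by apply: (IH b) => //; rewrite E1.
Qed.

Let gr_fun b n : gr (lt^~ b) (0, n) -> n = 0.
Proof.
elim/lt_ind: b n => b IH n; apply: gr_fun_step => b' m lb'.
exact: IH.
Qed.

Let gr_funT n : gr (fun=> True) (0, n) -> n = 0.
Proof. by apply: gr_fun_step => b m _; apply: gr_fun. Qed.

Let gr_tot v : exists n, gr (fun=> True) (v, n).
Proof.
elim: (basis_span v) => [|b Bb|c x y _ [n Hn] _ [m Hm]].
- by exists 0; apply: span0.
- by exists (f b); apply: spanI; exists b.
- exists (c *: n + m); rewrite (_ : (_, _) = c *: (x, n) + (y, m)) //.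
  exact: spanL.
Qed.

Lemma basis_lift : exists g : {linear V -> N}, forall b, basis b -> g b = f b.
Proof.
pose g v := sval (cid (gr_tot v)).
have gP v : gr (fun=> True) (v, g v) by exact: (svalP (cid (gr_tot v))).
have gE v n : gr (fun=> True) (v, n) -> g v = n.
  move=> H; apply: subr0_eq; apply: gr_funT.
  have -> : (0, g v - n) = (v, g v) - (v, n) by rewrite -[RHS]/(v - v, _) subrr.
  exact: (spanB (gP v) H).
have gl : linear g.
  move=> c x y; apply: gE.
  rewrite (_ : (_, _) = c *: (x, g x) + (y, g y)) //; exact: (spanL c (gP x) (gP y)).
exists (mklin gl) => b Bb; rewrite mklinE; apply: gE; apply: spanI; exists b; split=> //.
Qed.

End Extend.

(* The total order puts the part of the basis outside W first. *)
Theorem adapted_basis :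
  exists (B : V -> Prop) (ord : rel V),
  [/\ forall (N : lmodType F) (f : V -> N),
        exists g : {linear V -> N}, forall b, B b -> g b = f b,
      forall v, span B v,
      forall w, W w -> span (fun b => B b /\ W b) w,
      [/\ total ord, transitive ord & antisymmetric ord]
    & forall b c, W b -> ord b c -> W c].
Proof.
(* The order is reversed: [le] starts with [W], while sorted monomials must end with the letters of
   [W] to be multiplied on the right by U(M). *)
exists basis, (fun x y => le y x); split.
- exact: basis_lift.
- exact: basis_span.
- exact: basis_spanW.
- split=> [x y|y x z Hxy Hyz|x y /andP[]]; last 2 first.
  + exact: le_trans Hyz Hxy.
  + by move=> *; apply: le_anti.
  by have [->|->] := le_total x y; rewrite ?orbT.
- move=> b c Wb; rewrite /le; have -> : inW b = true by apply/asboolP.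
  by case: eqP => [/asboolP //|_ /asboolP].
Qed.

End Basis.

Lemma exists_functional (F : fieldType) (V : lmodType F) (v : V) :
  v != 0 -> exists g : {linear V -> F^o}, g v = 1.
Proof.
move=> v0; pose W x := exists c, x = c *: v.
have [B [_ [lift _ spanW _ _]]] := adapted_basis W.
have [b [Bb [c Eb] bn0]] : exists b, [/\ B b, W b & b != 0].
  apply: contrapT => H; move/eqP: v0; apply.
  have Wv : W v by exists 1; rewrite scale1r.
  elim: {Wv}(spanW v Wv) => // [b [Bb Wb]|c x y _ -> _ ->]; last by rewrite scaler0 addr0.
  by apply: contrapT => /eqP bn0; apply: H; exists b.
have c0 : c != 0 by apply: contraNneq bn0 => c0; rewrite Eb c0 scale0r.
(* The line of [v] contains a basis vector b = c v. The functional worth [c] on all basis vectors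
   takes the value 1 at [v]. *)
have [g gb] := lift F^o (fun=> c); exists g.
by apply: (scalerI c0); rewrite -linearZ -Eb gb // /GRing.scale /= mulr1.
Qed.

Lemma exists_functional_sub (F : fieldType) (V : lmodType F) (W : V -> Prop) (v : V) :
  subspace W -> ~ W v ->
  exists2 g : {linear V -> F^o}, g v = 1 & forall w, W w -> g w = 0.
Proof.
move=> sW nWv; have [B [_ [lift spanV spanW _ _]]] := adapted_basis W.
(* [h] is the projection with kernel [W] onto the span of the other basis vectors; a functional
   nonzero at [h v] is composed with it. *)
have [h hB] := lift V (fun b => if `[< W b >] then 0 else b).
have hW w : W w -> h w = 0.
  move=> /spanW; elim=> [|b [Bb Wb]|c x y _ Hx _ Hy]; first exact: raddf0.
    by rewrite hB //; case: asboolP.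
  by rewrite linearP Hx Hy scaler0 addr0.
have hv : W (v - h v).
  elim: (spanV v) => [|b Bb|c x y _ Hx _ Hy].
  - by rewrite raddf0 subr0; case: sW.
  - rewrite hB //; case: asboolP => [Wb|_]; first by rewrite subr0.
    by rewrite subrr; case: sW.
  - by rewrite linearP opprD addrACA -scalerBr; case: sW => _; apply.
have hv0 : h v != 0 by apply: contra_notN nWv => /eqP hv0; rewrite hv0 subr0 in hv.
have [g gv] := exists_functional hv0.
have gl : linear (fun x => g (h x)) by move=> c x y; rewrite !linearP.
exists (mklin gl) => [|w Ww]; first exact: gv.
by rewrite -[LHS]/(g (h w)) hW // raddf0.
Qed.

(** * Finite independent families over a field *)

Section Independent.
Variables (F : fieldType) (V : lmodType F).

Inductive indep : seq V -> Prop :=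
  | indep0 : indep [::]
  | indepS s x : indep s -> ~ lspan s x -> indep (rcons s x).

Lemma indep_rcons s x : indep (rcons s x) -> indep s /\ ~ lspan s x.
Proof.
move E : (rcons s x) => t It; case: It E => [|s' x' Is nx].
  by move/(congr1 size); rewrite size_rcons.
by move=> /rcons_inj[-> ->].
Qed.

Lemma indep_free s : indep s -> forall c : 'I_(size s) -> F,
  \sum_i c i *: s`_i = 0 -> forall i, c i = 0.
Proof.
elim=> [c _ [] //|{}s x Is IH nx c].
move: c; rewrite size_rcons => c; rewrite big_ord_recr /=.
have E : \sum_(i < size s) c (widen_ord (leqnSn (size s)) i) *: (rcons s x)`_i
   = \sum_(i < size s) c (widen_ord (leqnSn (size s)) i) *: s`_i.
  by apply: eq_bigr => i _; rewrite nth_rcons ltn_ord.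
rewrite E nth_rcons ltnn eqxx => H0.
have cm : c ord_max = 0.
  apply: contrapT => /eqP cn0; apply: nx.
  have -> : x = - (c ord_max)^-1 *: \sum_(i < size s) c (widen_ord (leqnSn (size s)) i) *: s`_i.
    apply: (scalerI cn0); rewrite scaleNr scalerN scalerA mulfV // scale1r.
    by apply: subr0_eq; rewrite opprK addrC.
  apply/spanZ/span_sum => i _; apply/spanZ/spanI/mem_nth; exact: ltn_ord.
move: H0; rewrite cm scale0r addr0 => /IH H i.
have [[j ->]|->] : (exists j : 'I_(size s), i = widen_ord (leqnSn (size s)) j) \/ i = ord_max.
  have := ltn_ord i; rewrite ltnS leq_eqVlt => /orP[/eqP Ei|li].
    by right; apply: val_inj.
  by left; exists (Ordinal li); apply: val_inj.
  by apply: H.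
by [].
Qed.

(** Induction on [s]: dropping the last vector [x] replaces [W] by its intersection with a smaller
    span, and one element [w] of [W] outside that span, if any, makes up for the difference, as it
    eliminates the [x]-coordinate of the others. *)
Lemma subspace_fin (s : seq V) (W : V -> Prop) :
  subspace W -> (forall x, W x -> lspan s x) ->
  exists2 t, indep t /\ (forall x, x \in t -> W x) & forall x, W x -> lspan t x.
Proof.
elim/last_ind: s W => [|s x IH] W sW Ws.
  exists [::]; first by split=> //; apply: indep0.
  exact: Ws.
have [W0 Wl] := sW.
pose W' y := W y /\ lspan s y.
have [|y [] //|t [It tW'] Ht] := IH W'.
  by split=> [|c y z [Wy sy] [Wz sz]]; split=> //; [apply: span0|apply: Wl|apply: spanL].
case: (pselect (exists2 w, W w & ~ lspan s w)) => [[w Ww nw]|H]; last first.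
  exists t => [|y Wy]; first by split=> // y /tW'[].
  by apply: Ht; split=> //; apply: contrapT => nsy; apply: H; exists y.
exists (rcons t w).
  split; last by move=> y; rewrite mem_rcons inE => /orP[/eqP->|/tW'[]].
  apply: indepS => // tw; apply: nw.
  by apply: lspan_sub tw => y /tW'[].
move=> y Wy; apply/lspan_rcons.
have /lspan_rcons[c Hc] := Ws w Ww; have /lspan_rcons[d Hd] := Ws y Wy.
have cn0 : c != 0.
  by apply: contra_notN nw => /eqP c0; move: Hc; rewrite c0 scale0r subr0.
exists (d / c); apply: Ht; split; first by apply: subspaceB => //; apply: subspaceZ.
have -> : y - (d / c) *: w = (y - d *: x) - (d / c) *: (w - c *: x).
  by rewrite scalerBr scalerA divfK // opprB addrA subrK.
by apply: spanB => //; apply: spanZ.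
Qed.

Lemma indep_extend (s u : seq V) : indep u ->
  exists d, [/\ indep (u ++ d), {subset d <= s} & forall x, x \in s -> lspan (u ++ d) x].
Proof.
elim: s u => [|x s IH] u Iu; first by exists [::]; rewrite cats0.
have [d [Id ds Hd]] := IH u Iu.
case: (pselect (lspan (u ++ d) x)) => [H|H].
  exists d; split=> // [y /ds|y]; first by rewrite inE orbC => ->.
  by rewrite inE => /orP[/eqP->|/Hd].
exists (rcons d x); rewrite -rcons_cat; split.
- exact: indepS.
- by move=> y; rewrite mem_rcons !inE => /orP[->//|/ds->]; rewrite orbT.
- move=> y; rewrite inE => /orP[/eqP->|/Hd H1]; apply/lspan_rcons.
    by exists 1; rewrite scale1r subrr; apply: span0.
  by exists 0; rewrite scale0r subr0.
Qed.

Lemma indep_cat_disjoint (u w : seq V) : indep u -> indep w ->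
  (forall x, lspan u x -> lspan w x -> x = 0) -> indep (u ++ w).
Proof.
move=> Iu Iw; elim: Iw => [|{}w x Iw IH nx] H; first by rewrite cats0.
rewrite -rcons_cat; apply: indepS.
  apply: IH => y uy wy; apply: H => //; apply/lspan_rcons.
  by exists 0; rewrite scale0r subr0.
move=> uwx.
have [a [b [ua wb E]]] : exists a b, [/\ lspan u a, lspan w b & x = a + b].
  elim: uwx => [|y|c y z _ [a [b [ua wb ->]]] _ [a' [b' [ua' wb' ->]]]].
  - by exists 0, 0; rewrite addr0; split=> //; apply: span0.
  - rewrite mem_cat => /orP[uy|wy]; [exists y, 0|exists 0, y];
      by rewrite ?addr0 ?add0r; split=> //; (exact: span0 || exact: spanI).
  - exists (c *: a + a'), (c *: b + b'); rewrite scalerDr addrACA.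
    by split=> //; apply: spanL.
have a0 : a = 0.
  apply: H => //; apply/lspan_rcons; exists 1; rewrite scale1r E opprD addrA subrr add0r.
  by rewrite -scaleN1r; apply: spanZ.
by apply: nx; rewrite E a0 add0r.
Qed.

Lemma indep_cat (s1 s2 : seq V) : indep (s1 ++ s2) ->
  [/\ indep s1, indep s2 & forall x, lspan s1 x -> lspan s2 x -> x = 0].
Proof.
elim/last_ind: s2 => [|s2 x IH].
  by rewrite cats0 => I1; split=> // [|x _ /lspan_nil]; first exact: indep0.
rewrite -rcons_cat => /indep_rcons[/IH[I1 I2 H] nx]; split=> //.
  apply: indepS => // sx; apply: nx.
  by apply: span_mono sx => z; rewrite mem_cat orbC => ->.
move=> y y1 /lspan_rcons[c Hc]; apply: H => //.
have [c0|c0] := eqVneq c 0; first by rewrite c0 scale0r subr0 in Hc.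
case: nx; have -> : x = c^-1 *: (y - (y - c *: x)) by rewrite opprB addrC subrK scalerA mulVf // scale1r.
apply/spanZ/spanB; first by apply: span_mono y1 => z; rewrite mem_cat => ->.
by apply: span_mono Hc => z; rewrite mem_cat orbC => ->.
Qed.

End Independent.

(** * Gluing additive maps along a grading *)

Section Grading.
Variables (I : eqType) (V : zmodType) (D : I -> V -> Prop).
Hypothesis gD : is_grading D.

Let rep v (s : seq I) (f : I -> V) :=
  [/\ uniq s, forall i, D i (f i), forall i, i \notin s -> f i = 0 & v = \sum_(i <- s) f i].

Let DB i x y : D i x -> D i y -> D i (x - y).
Proof. by case: gD => H _ _; apply: (H i).2. Qed.
Let D0 i : D i 0. Proof. by case: gD => H _ _; apply: (H i).1. Qed.
Let DN i x : D i x -> D i (- x).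
Proof. by move=> Dx; rewrite -sub0r; apply: DB. Qed.
Lemma gradingD i x y : D i x -> D i y -> D i (x + y).
Proof. by move=> Dx Dy; rewrite -[y]opprK; apply: DB => //; apply: DN. Qed.

Let big_supp (N : zmodType) (s t : seq I) (h : I -> N) : uniq s -> uniq t -> {subset s <= t} ->
  (forall i, i \notin s -> h i = 0) -> \sum_(i <- t) h i = \sum_(i <- s) h i.
Proof.
move=> us ut st h0; rewrite (bigID [in s]) /= [X in _ + X]big1 ?addr0; last by move=> i /h0.
rewrite -big_filter; apply: perm_big; apply: uniq_perm => //; first exact: filter_uniq.
move=> i; rewrite mem_filter; case: (boolP (i \in s)) => //= /st.
by [].
Qed.

Let rep_uniq v s f s' f' : rep v s f -> rep v s' f' -> f =1 f'.
Proof.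
move=> [us Df f0 Ev] [us' Df' f0' Ev'] i.
pose t := undup (i :: s ++ s'); have ut : uniq t := undup_uniq _.
case: gD => _ _ Dind; apply: subr0_eq.
apply: (Dind t (fun i => f i - f' i) ut) => [j||].
- exact: DB.
- rewrite sumrB (big_supp us ut) ?(big_supp us' ut) -?Ev -?Ev' ?subrr //.
    by move=> j sj; rewrite mem_undup inE mem_cat sj !orbT.
  by move=> j sj; rewrite mem_undup inE mem_cat sj !orbT.
- by rewrite mem_undup inE eqxx.
Qed.

Let rep_lin v s f w t g : rep v s f -> rep w t g ->
  rep (v - w) (undup (s ++ t)) (fun i => f i - g i).
Proof.
move=> [us Df f0 Ev] [ut Dg g0 Ew]; split.
- exact: undup_uniq.
- by move=> i; apply: DB.
- move=> i; rewrite mem_undup mem_cat negb_or => /andP[si ti].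
  by rewrite f0 ?g0 // subr0.
- rewrite sumrB (big_supp us (undup_uniq _)) ?(big_supp ut (undup_uniq _)) -?Ev -?Ew ?undup_uniq //.
    by move=> j sj; rewrite mem_undup mem_cat sj !orbT.
  by move=> j sj; rewrite mem_undup mem_cat sj.
Qed.

Let rep1 i x : D i x -> rep x [:: i] (fun j => if j == i then x else 0).
Proof.
move=> Dx; split=> // [j|j|].
- by case: eqP => [->|].
- by rewrite inE => /negbTE->.
- by rewrite big_seq1 eqxx.
Qed.

Let rep_ex v : exists s f, rep v s f.
Proof.
case: gD => _ H _; have [s Hs ->] := H v; elim: s Hs => [|x s IH] Hs.
  by exists [::], (fun=> 0); split=> //; rewrite !big_nil.
rewrite big_cons -[_ + _]opprK opprD.
have [|s1 [f1 H1]] := IH; first by move=> y sy; apply: Hs; rewrite inE sy orbT.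
have [i Dx] : exists i, D i x by apply: Hs; rewrite inE eqxx.
have rN u s0 f : rep u s0 f -> rep (- u) s0 (fun i => - f i).
  move=> [us Df f0 ->]; split=> // [j|j /f0->|]; first exact: DN.
    by rewrite oppr0.
  by rewrite sumrN.
have /rN H2 := rep_lin (rN _ _ _ (rep1 Dx)) H1.
by do 2!eexists; apply: H2.
Qed.

Lemma grading_decomp v : exists (s : seq I) (f : I -> V),
  [/\ uniq s, forall i, D i (f i) & v = \sum_(i <- s) f i].
Proof. by have [s [f [us Df _ E]]] := rep_ex v; exists s, f. Qed.

(** The homogeneous decomposition is unique up to zero terms, so the sum of the [phi i] over any
    chosen decomposition is well defined and additive. *)
Lemma grading_lift (N : zmodType) (phi : I -> V -> N) :
  (forall i x y, D i x -> D i y -> phi i (x - y) = phi i x - phi i y) ->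
  exists2 g : V -> N, (forall x y, g (x - y) = g x - g y) & forall i x, D i x -> g x = phi i x.
Proof.
move=> phiB.
have phi0 i : phi i 0 = 0 by rewrite -(subrr 0) phiB // subrr.
pose s v := sval (cid (rep_ex v)).
have [f fP] : {f | forall v, rep v (s v) (f v)}.
  exists (fun v => sval (cid (svalP (cid (rep_ex v))))) => v.
  exact: svalP (cid (svalP (cid (rep_ex v)))).
pose g v := \sum_(i <- s v) phi i (f v i).
have gE v t h : rep v t h -> g v = \sum_(i <- t) phi i (h i).
  move=> rt; have fh := rep_uniq (fP v) rt.
  rewrite /g; have [us _ f0 _] := fP v; case: (rt) => ut _ h0 _.
  transitivity (\sum_(i <- undup (s v ++ t)) phi i (h i)).
    rewrite (big_supp us (undup_uniq _)) ?undup_uniq //.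
    - by apply: eq_bigr => i _; rewrite fh.
    - by move=> j sj; rewrite mem_undup mem_cat sj.
    - by move=> j sj; rewrite -fh f0 ?phi0.
  rewrite (big_supp ut (undup_uniq _)) ?undup_uniq //.
  - by move=> j sj; rewrite mem_undup mem_cat sj orbT.
  - by move=> j sj; rewrite h0 ?phi0.
exists g => [x y|i x Dx]; last by rewrite (gE _ _ _ (rep1 Dx)) big_seq1 eqxx.
rewrite (gE _ _ _ (rep_lin (fP x) (fP y))).
have [us Df f0 _] := fP x; have [ut Dg g0 _] := fP y.
under eq_bigr => i _ do rewrite phiB //.
rewrite sumrB (big_supp us (undup_uniq _)) ?undup_uniq //; first last.
- by move=> j sj; rewrite f0 ?phi0.
- by move=> j sj; rewrite mem_undup mem_cat sj.
rewrite (big_supp ut (undup_uniq _)) ?undup_uniq //.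
- by move=> j sj; rewrite mem_undup mem_cat sj orbT.
- by move=> j sj; rewrite g0 ?phi0.
Qed.

Lemma grading_ext (N : zmodType) (g h : V -> N) :
  (forall x y, g (x - y) = g x - g y) -> (forall x y, h (x - y) = h x - h y) ->
  (forall i x, D i x -> g x = h x) -> g =1 h.
Proof.
move=> gB hB gh v.
have z (k : V -> N) : (forall x y, k (x - y) = k x - k y) -> k 0 = 0.
  by move=> kB; rewrite -(subrr 0) kB subrr.
have d (k : V -> N) : (forall x y, k (x - y) = k x - k y) -> forall x y, k (x + y) = k x + k y.
  by move=> kB x y; rewrite -{1}[y]opprK kB -[- y]sub0r kB z // sub0r opprK.
case: gD => _ H _; have [s Hs ->] := H v; elim: s Hs => [|x s IH] Hs.
  by rewrite big_nil !z.
rewrite big_cons !d // IH; last by move=> y sy; apply: Hs; rewrite inE sy orbT.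
by have [|i /gh->//] := Hs x; rewrite inE eqxx.
Qed.

End Grading.

(** * Enveloping algebras *)

Section LieBasics.
Variables (F : fieldType) (L : lieAlgType F).

Lemma bracketDl (x y z : L) : bracket (x + y) z = bracket x z + bracket y z.
Proof. by rewrite -[x]scale1r bracket_linearl !scale1r. Qed.
Lemma bracketDr (x y z : L) : bracket z (x + y) = bracket z x + bracket z y.
Proof. by rewrite -[x]scale1r bracket_linearr !scale1r. Qed.
Lemma bracket0l (x : L) : bracket 0 x = 0.
Proof. by apply: (addrI (bracket 0 x)); rewrite -bracketDl !addr0. Qed.
Lemma bracket0r (x : L) : bracket x 0 = 0.
Proof. by apply: (addrI (bracket x 0)); rewrite -bracketDr !addr0. Qed.
Lemma bracketC (x y : L) : bracket x y = - bracket y x.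
Proof.
apply: subr0_eq; rewrite opprK -[RHS](bracketxx (x + y)).
by rewrite bracketDl !bracketDr !bracketxx add0r addr0.
Qed.

Lemma bracketNr (x y : L) : bracket x (- y) = - bracket x y.
Proof. by apply: subr0_eq; rewrite opprK -bracketDr addNr bracket0r. Qed.
(** The Jacobi identity in the form in which it resolves two overlapping descents of a word. *)
Lemma bracket_swap (x y z : L) :
  bracket (bracket x y) z + bracket (bracket y z) x = bracket (bracket x z) y.
Proof.
rewrite [bracket (bracket x y) z]bracketC [bracket (bracket y z) x]bracketC.
rewrite [bracket (bracket x z) y]bracketC [bracket x z]bracketC bracketNr opprK.
by apply: subr0_eq; rewrite -oppr0 -(bracket_jacobi x y z) !opprD -addrA addrC.
Qed.

End LieBasics.

Section Enveloping.
Variables (F : fieldType) (L : lieAlgType F).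
Implicit Types (u v w : uenv L).

Lemma uiota_linear : linear (@uiota F L).
Proof. by case: (uiota_lie_rep L). Qed.
HB.instance Definition _ := GRing.isLinear.Build F L (uenv L) *:%R (@uiota F L) uiota_linear.

Lemma uiota_bracket (x y : L) :
  uiota (bracket x y) = uiota x * uiota y - uiota y * uiota x.
Proof. by case: (uiota_lie_rep L). Qed.

(** Words in [L] span U(L). The induction on an expression [t] is carried out for all products
    [upi t * v] with [P v], which makes it stable under multiplication. *)
Lemma uenv_ind (P : uenv L -> Prop) : P 1 -> (forall x u, P u -> P (uiota x * u)) ->
  (forall c u v, P u -> P v -> P (c *: u + v)) -> forall u, P u.
Proof.
move=> P1 PM Pl u.
suff H t v : P v -> P (upi t * v) by rewrite -[u]mulr1 -(ureprK u); apply: H.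
have P0 : P 0 by rewrite -(addNr 1) -scaleN1r; apply: Pl.
elim: t v => [||x|s IHs t IHt|s IHs t IHt|c t IHt] v Pv.
- by rewrite (_ : upi _ = 0) // mul0r.
- by rewrite (_ : upi _ = 1) // mul1r.
- exact: PM.
- have -> : upi (Uadd s t) = upi s + upi t.
    by apply: uenv_ext => A f Hf; rewrite (liftE Hf) !uenv_lift_pi.
  by rewrite mulrDl -[upi s * v]scale1r; apply: Pl; [apply: IHs|apply: IHt].
- have -> : upi (Umul s t) = upi s * upi t.
    by apply: uenv_ext => A f Hf; rewrite (liftE Hf) !uenv_lift_pi.
  by rewrite -mulrA; apply/IHs/IHt.
- have -> : upi (Uscale c t) = c *: upi t.
    by apply: uenv_ext => A f Hf; rewrite (liftE Hf) !uenv_lift_pi.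
  by rewrite -scalerAl -[_ *: _]addr0; apply: Pl => //; apply: IHt.
Qed.

Section LiftLin.
Variables (A : algType F) (f : L -> A) (Hf : is_lie_rep f).
Lemma uenv_lift_linear : linear (uenv_lift f).
Proof. by have [] := uenv_lift_mor Hf. Qed.
Lemma uenv_liftM u v : uenv_lift f (u * v) = uenv_lift f u * uenv_lift f v.
Proof. by have [] := uenv_lift_mor Hf. Qed.
Lemma uenv_lift1 : uenv_lift f 1 = 1.
Proof. by have [] := uenv_lift_mor Hf. Qed.
End LiftLin.

Lemma uaug_linear : linear (@uaug F L : uenv L -> F^o).
Proof. exact: uenv_lift_linear (@lie_rep0 F L). Qed.
HB.instance Definition _ := GRing.isLinear.Build F (uenv L) F^o *:%R (@uaug F L : uenv L -> F^o)
  uaug_linear.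
Lemma uaugM u v : uaug (u * v) = uaug u * uaug v.
Proof. exact: (uenv_liftM (@lie_rep0 F L)). Qed.
Lemma uaug1 : uaug (1 : uenv L) = 1.
Proof. exact: (uenv_lift1 (@lie_rep0 F L)). Qed.
Lemma uaug_iota x : uaug (uiota x : uenv L) = 0.
Proof. exact: (uenv_lift_iota x (@lie_rep0 F L)). Qed.
Lemma uaugD u v : uaug (u + v) = uaug u + uaug v.
Proof. exact: raddfD. Qed.
Lemma uaugZ c u : uaug (c *: u) = c * uaug u.
Proof. exact: linearZ. Qed.

Lemma trivmod_scaleE u (a : trivmod L) : u *: a = uaug u * a.
Proof. by []. Qed.

End Enveloping.

(** * Modules over the enveloping algebra from Lie actions *)

Section EndAlgebra.
Variables (F : fieldType) (V : lmodType F).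

(* The extra summand F^o makes the ring of endomorphisms nonzero even when V is. *)
Notation V1 := (V * F^o)%type.

Record lend := Lend { lend_fun :> V1 -> V1; lend_lin : linear lend_fun }.

Lemma lend_ext (f g : lend) : (forall x, f x = g x) -> f = g.
Proof.
case: f g => f Hf [g Hg] /= E; have {}E : f = g by apply/funext.
by rewrite {}E in Hf *; congr Lend; apply: Prop_irrelevance.
Qed.

HB.instance Definition _ := gen_eqMixin lend.
HB.instance Definition _ := gen_choiceMixin lend.

Let lendD (f : lend) x y : f (x + y) = f x + f y.
Proof. by have := lend_lin f 1 x y; rewrite !scale1r. Qed.
Let lend0 (f : lend) : f 0 = 0.
Proof. by apply: (addrI (f 0)); rewrite -lendD !addr0. Qed.
Let lendZ (f : lend) c x : f (c *: x) = c *: f x.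
Proof. by have := lend_lin f c x 0; rewrite !addr0 lend0 addr0. Qed.

Lemma lend_zero_lin : linear (fun _ : V1 => 0 : V1).
Proof. by move=> c x y; rewrite scaler0 addr0. Qed.
Lemma lend_add_lin (f g : lend) : linear (fun x => f x + g x).
Proof. by move=> c x y; rewrite !lendD !lendZ scalerDr addrACA. Qed.
Lemma lend_scale_lin d (f : lend) : linear (fun x => d *: f x).
Proof. by move=> c x y; rewrite lendD lendZ scalerDr !scalerA mulrC. Qed.
Lemma lend_id_lin : linear (fun x : V1 => x).
Proof. by []. Qed.
Lemma lend_mul_lin (f g : lend) : linear (fun x => f (g x)).
Proof. by move=> c x y; rewrite !lendD !lendZ. Qed.

Definition lend_zero := Lend lend_zero_lin.
Definition lend_add f g := Lend (lend_add_lin f g).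
Definition lend_scale c f := Lend (lend_scale_lin c f).
Definition lend_opp := lend_scale (-1).
Definition lend_one := Lend lend_id_lin.
Definition lend_mul f g := Lend (lend_mul_lin f g).

Let addA : associative lend_add.
Proof. by move=> f g h; apply: lend_ext => x; apply: addrA. Qed.
Let addC : commutative lend_add.
Proof. by move=> f g; apply: lend_ext => x; apply: addrC. Qed.
Let add0 : left_id lend_zero lend_add.
Proof. by move=> f; apply: lend_ext => x; apply: add0r. Qed.
Let addN : left_inverse lend_zero lend_opp lend_add.
Proof. by move=> f; apply: lend_ext => x /=; rewrite scaleN1r addNr. Qed.
HB.instance Definition _ := GRing.isZmodule.Build lend addA addC add0 addN.

Let mulA : associative lend_mul.
Proof. by move=> f g h; apply: lend_ext. Qed.
Let mul1 : left_id lend_one lend_mul.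
Proof. by move=> f; apply: lend_ext. Qed.
Let mul1r' : right_id lend_one lend_mul.
Proof. by move=> f; apply: lend_ext. Qed.
Let mulDl : left_distributive lend_mul lend_add.
Proof. by move=> f g h; apply: lend_ext. Qed.
Let mulDr : right_distributive lend_mul lend_add.
Proof. by move=> f g h; apply: lend_ext => x /=; rewrite lendD. Qed.
Let one_neq0 : lend_one != lend_zero.
Proof.
apply/eqP => /(congr1 (fun f : lend => (f (0, 1)).2)) /= /eqP.
by rewrite oner_eq0.
Qed.
HB.instance Definition _ := GRing.Zmodule_isNzRing.Build lend mulA mul1 mul1r' mulDl mulDr one_neq0.

Let scA c d f : lend_scale c (lend_scale d f) = lend_scale (c * d) f.
Proof. by apply: lend_ext => x /=; rewrite scalerA. Qed.
Let sc1 : left_id 1 lend_scale.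
Proof. by move=> f; apply: lend_ext => x /=; rewrite scale1r. Qed.
Let scDr : right_distributive lend_scale +%R.
Proof. by move=> c f g; apply: lend_ext => x /=; rewrite scalerDr. Qed.
Let scDl f : {morph lend_scale^~ f : c d / c + d}.
Proof. by move=> c d; apply: lend_ext => x /=; rewrite scalerDl. Qed.
HB.instance Definition _ := GRing.Zmodule_isLmodule.Build F lend scA sc1 scDr scDl.

Let scAl (c : F) (f g : lend) : c *: (f * g) = (c *: f) * g.
Proof. exact: lend_ext. Qed.
Let scAr (c : F) (f g : lend) : c *: (f * g) = f * (c *: g).
Proof. by apply: lend_ext => x /=; rewrite lendZ. Qed.
HB.instance Definition _ := GRing.Lmodule_isLalgebra.Build F lend scAl.
HB.instance Definition _ := GRing.Lalgebra_isAlgebra.Build F lend scAr.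

End EndAlgebra.

Section Rho.
Variables (F : fieldType) (V : lmodType F) (L : lmodType F) (rho : L -> V -> V).
Hypotheses (rl : forall v, linear (rho^~ v)) (rr : forall x, linear (rho x)).

Lemma lend_of_lin x : linear (fun p : (V * F^o)%type => (rho x p.1, 0 : F^o)).
Proof.
move=> c p q; rewrite (rr x); apply: injective_projections => //=.
by rewrite scaler0 addr0.
Qed.

Definition lend_of x : lend V := Lend (lend_of_lin x).

Lemma lend_of_linear : linear lend_of.
Proof.
move=> c x y; apply: lend_ext => p; rewrite /= (rl p.1).
by apply: injective_projections => //=; rewrite scaler0 addr0.
Qed.
End Rho.

Section Action.
Variables (F : fieldType) (V : lmodType F).

Variable L : lieAlgType F.

(** The universal property of U(L) is applied to the endomorphisms of V + F, the added summand F
    being acted on by 0; [act] is read on the vectors (v, 0). *)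
Lemma uenv_act (rho : L -> V -> V) :
  (forall v, linear (rho^~ v)) -> (forall x, linear (rho x)) ->
  (forall x y v, rho (bracket x y) v = rho x (rho y v) - rho y (rho x v)) ->
  exists act : uenv L -> V -> V,
  [/\ forall v, linear (act^~ v), forall v, act 1 v = v &
      forall x u v, act (uiota x * u) v = rho x (act u v)].
Proof.
move=> rl rr rb.
have Hf : is_lie_rep (lend_of rr).
  split; first exact: (lend_of_linear rl rr).
  move=> x y; apply: lend_ext => p /=; rewrite rb; apply: injective_projections => //=.
    by rewrite scaleN1r.
  by rewrite scaler0 addr0.
exists (fun u v => (uenv_lift (lend_of rr) u (v, 0)).1); split.
- by move=> v c u w; rewrite (uenv_lift_linear Hf).
- by move=> v; rewrite (uenv_lift1 Hf).
- by move=> x u v; rewrite (uenv_liftM Hf) uenv_lift_iota.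
Qed.

End Action.

(** * Polynomials over an algebra, and the grading of the enveloping algebra *)

Section PolyAlgebra.
Variables (F : fieldType) (E : algType F).

(** A copy of E[t], on which the scalars are taken in [F] and not in [E]: it is an [F]-algebra, to
    which representations can be lifted. *)
Definition palg : Type := {poly E}.
HB.instance Definition _ := GRing.NzRing.on palg.

Definition palg_scale (c : F) (p : palg) : palg := (c%:A : E) *: (p : {poly E}).

Lemma coef_palg_scale c (p : palg) i : (palg_scale c p)`_i = c *: (p : {poly E})`_i.
Proof. by rewrite /palg_scale coefZ mulr_algl. Qed.

Let scA c d p : palg_scale c (palg_scale d p) = palg_scale (c * d) p.
Proof. by apply/polyP => i; rewrite !coef_palg_scale scalerA. Qed.
Let sc1 : left_id 1 palg_scale.
Proof. by move=> p; apply/polyP => i; rewrite !coef_palg_scale scale1r. Qed.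
Let scDr : right_distributive palg_scale +%R.
Proof. by move=> c p q; apply/polyP => i; rewrite coefD !coef_palg_scale coefD scalerDr. Qed.
Let scDl p : {morph palg_scale^~ p : c d / c + d}.
Proof. by move=> c d; apply/polyP => i; rewrite coefD !coef_palg_scale scalerDl. Qed.
HB.instance Definition _ := GRing.Zmodule_isLmodule.Build F palg scA sc1 scDr scDl.

Lemma coef_palgZ c (p : palg) i : (c *: p : {poly E})`_i = c *: (p : {poly E})`_i.
Proof. exact: coef_palg_scale. Qed.

Let scAl (c : F) (p q : palg) : c *: (p * q) = (c *: p) * q.
Proof.
apply/polyP => i; rewrite coef_palgZ !coefM scaler_sumr.
by apply: eq_bigr => j _; rewrite coef_palgZ scalerAl.
Qed.
Let scAr (c : F) (p q : palg) : c *: (p * q) = p * (c *: q).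
Proof.
apply/polyP => i; rewrite coef_palgZ !coefM scaler_sumr.
by apply: eq_bigr => j _; rewrite coef_palgZ scalerAr.
Qed.
HB.instance Definition _ := GRing.Lmodule_isLalgebra.Build F palg scAl.
HB.instance Definition _ := GRing.Lalgebra_isAlgebra.Build F palg scAr.

Definition pmono (x : E) (n : nat) : palg := x%:P * 'X^n.

Lemma coef_pmono x n i : (pmono x n : {poly E})`_i = if i == n then x else 0.
Proof. by rewrite coefCM coefXn; case: eqP; rewrite ?mulr1 ?mulr0. Qed.

Lemma pmonoM x y n m : pmono x n * pmono y m = pmono (x * y) (n + m).
Proof.
rewrite /pmono; change ((x%:P * 'X^n : {poly E}) * (y%:P * 'X^m) = (x * y)%:P * 'X^(n + m)).
rewrite -mulrA (mulrA 'X^n) -(commr_polyXn y%:P n) -mulrA -exprD mulrA.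
by rewrite polyCM.
Qed.

Lemma pmono_linear n : linear (pmono^~ n).
Proof.
move=> c x y; apply/polyP => i; rewrite coefD coef_palgZ !coef_pmono.
by case: eqP; rewrite ?scaler0 ?addr0.
Qed.
Definition pmonoL n : {linear E -> palg} := mklin (pmono_linear n).
Lemma pmonoLE n x : pmonoL n x = pmono x n. Proof. by []. Qed.

End PolyAlgebra.

Section GradedLie.
Variables (F : fieldType) (L : gradedLieType F).

Lemma ldegD n (x y : L) : ldeg n x -> ldeg n y -> ldeg n (x + y).
Proof. exact: (gradingD ldeg_grading). Qed.
Lemma ldeg0 n : ldeg n (0 : L).
Proof. by have [H _ _] := @ldeg_grading F L; case: (H n). Qed.

Lemma ldeg_subspace n : subspace (fun x : L => ldeg n x).
Proof. by split=> [|c x y Dx Dy]; [apply: ldeg0 | apply: ldegD => //; apply: ldegZ]. Qed.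

Lemma graded_linear_lift (N : lmodType F) (phi : nat -> {linear L -> N}) :
  exists g : {linear L -> N}, forall n x, ldeg n x -> g x = phi n x.
Proof.
have [|g gB gE] := grading_lift (@ldeg_grading F L) (N := N) (phi := phi).
  by move=> i x y _ _; rewrite raddfB.
have g0 : g 0 = 0 by rewrite -(subrr 0) gB subrr.
have gD x y : g (x + y) = g x + g y.
  by rewrite -{1}[y]opprK gB -[- y]sub0r gB g0 sub0r opprK.
have gZ c x : g (c *: x) = c *: g x.
  apply: (grading_ext (@ldeg_grading F L) (g := fun x => g (c *: x)) (h := fun x => c *: g x)).
  - by move=> y z; rewrite scalerBr gB.
  - by move=> y z; rewrite gB scalerBr.
  - by move=> n y Dy; rewrite !(gE n) ?linearZ //; apply: ldegZ.
have gl : linear g by move=> c x y; rewrite gD gZ.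
by exists (mklin gl) => n x Dx; rewrite mklinE; apply: gE.
Qed.

Lemma graded_linear_eq (N : lmodType F) (g h : L -> N) : linear g -> linear h ->
  (forall n x, ldeg n x -> g x = h x) -> g =1 h.
Proof.
move=> gl hl; apply: (grading_ext (@ldeg_grading F L)) => x y.
  exact: (raddfB (mklin gl)).
exact: (raddfB (mklin hl)).
Qed.

Lemma graded_lie_rep (A : algType F) (f : L -> A) : linear f ->
  (forall n m x y, ldeg n x -> ldeg m y -> f (bracket x y) = f x * f y - f y * f x) ->
  is_lie_rep f.
Proof.
move=> fl H; split=> // x y.
move: x; apply: graded_linear_eq => [c u v|c u v|n x Dx].
- by rewrite bracket_linearl fl.
- by rewrite fl mulrDl mulrDr -scalerAl -scalerAr opprD addrACA -scalerBr.
move: y; apply: graded_linear_eq => [c u v|c u v|m y Dy]; last exact: H Dx Dy.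
- by rewrite bracket_linearr fl.
- by rewrite fl mulrDl mulrDr -scalerAl -scalerAr opprD addrACA -scalerBr.
Qed.

(** [Phi] is the coaction attached to the grading, the algebra map that sends x of degree n to x
    t^n. Homogeneous elements become monomials in t, which are independent for distinct degrees. *)
Lemma uenv_deg_poly : exists Phi : {linear uenv L -> palg (uenv L)},
  forall n u, uenv_deg n u -> Phi u = pmono u n.
Proof.
have [f fE] := graded_linear_lift (fun n => (pmonoL (uenv L) n \o @uiota F L : {linear _ -> _})).
have Hf : is_lie_rep f.
  apply: graded_lie_rep => [|n m x y Dx Dy]; first exact: linearP.
  rewrite (fE _ _ (ldeg_bracket _ _ _ _ Dx Dy)) (fE _ _ Dx) (fE _ _ Dy) /= !pmonoLE.
  rewrite uiota_bracket !pmonoM [(m + n)%N]addnC.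
  exact: (raddfB (pmonoL _ (n + m))).
pose h := mklin (uenv_lift_linear Hf); exists h => n u; rewrite -pmonoLE.
elim=> {n u} [n|n u v _ Hu _ Hv|n c u _ Hu||n m x u Dx _ Hu].
- by rewrite !raddf0.
- by rewrite (raddfD h) (raddfD (pmonoL _ n)); congr (_ + _).
- by rewrite (linearZ_LR h) (linearZ_LR (pmonoL _ n)); congr (_ *: _).
- by rewrite pmonoLE /pmono expr0 mulr1; apply: (uenv_lift1 Hf).
- rewrite -[LHS]/(uenv_lift f _) (uenv_liftM Hf) -/(h u) -[uenv_lift f u]/(h u) Hu.
  by rewrite uenv_lift_iota // (fE _ _ Dx) /= !pmonoLE pmonoM.
Qed.

Lemma ldeg_sum (x : L) : exists2 s : seq L,
  (forall y, y \in s -> exists n, ldeg n y) & x = \sum_(y <- s) y.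
Proof. by have [_ H _] := @ldeg_grading F L; apply: H. Qed.

Lemma uenv_deg_grading : is_grading (@uenv_deg F L).
Proof.
split=> [n|u|s f us Df f0 i si].
- split=> [|u v Du Dv]; first exact: uenv_deg0.
  by rewrite -scaleN1r; apply: uenv_degD => //; apply: uenv_degZ.
- elim/uenv_ind: u => [|x u [s Hs ->]|c u v [s Hs ->] [t Ht ->]].
  + exists [:: 1]; last by rewrite big_seq1.
    by move=> y; rewrite inE => /eqP->; exists 0%N; apply: uenv_deg1.
  + have [r Hr ->] := ldeg_sum x.
    exists [seq uiota y * v | y <- r, v <- s].
      move=> _ /allpairsP[[y v] /= [/Hr[n Dy] /Hs[m Dv] ->]].
      by exists (n + m)%N; apply: uenv_degM.
    rewrite raddf_sum big_allpairs_dep /= big_distrl /=.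
    by apply: eq_bigr => y _; rewrite big_distrr.
  + exists ([seq c *: w | w <- s] ++ t) => [w|].
      rewrite mem_cat => /orP[/mapP[w' /Hs[n Dw] ->]|/Ht //].
      by exists n; apply: uenv_degZ.
    by rewrite big_cat big_map scaler_sumr.
- have [Phi PhiE] := uenv_deg_poly.
  have : (Phi (\sum_(j <- s) f j) : {poly uenv L})`_i = 0 by rewrite f0 raddf0 coef0.
  rewrite raddf_sum coef_sum (bigD1_seq i) //= (PhiE i) // coef_pmono eqxx big1 ?addr0 //.
  by move=> j ji; rewrite (PhiE j) // coef_pmono eq_sym (negbTE ji).
Qed.

End GradedLie.

Section Submodule.
Variables (R : nzRingType) (V : lmodType R).

Record submodule := Submodule { submod_pred :> V -> Prop; submodP : subspace submod_pred }.

Variable S : submodule.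
Definition submod_mem : {pred V} := fun x => `[< S x >].

Lemma submod_mem_closed : submod_closed submod_mem.
Proof.
have [S0 Sl] := submodP S; split; first exact/asboolP.
by move=> c x y /asboolP Sx /asboolP Sy; apply/asboolP/Sl.
Qed.
HB.instance Definition _ := GRing.isSubmodClosed.Build R V submod_mem submod_mem_closed.

Record subm : Type := Subm { subm_val : V; _ : subm_val \in submod_mem }.
HB.instance Definition _ := [isSub for subm_val].
HB.instance Definition _ := [Choice of subm by <:].
HB.instance Definition _ := [SubChoice_isSubLmodule of subm by <:].

Lemma subm_valP (x : subm) : S (subm_val x).
Proof. exact/asboolP/(valP x). Qed.

Definition mksubm x (Sx : S x) : subm := Subm (introT (asboolP _) Sx).

Lemma subm_val_linear : linear subm_val.
Proof. by []. Qed.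
HB.instance Definition _ := GRing.isLinear.Build R subm V *:%R subm_val subm_val_linear.

Lemma subm_inj : injective subm_val.
Proof. exact: val_inj. Qed.

End Submodule.

(** * The Poincare-Birkhoff-Witt theorem *)

Section Words.
Variables (X : eqType) (ord : rel X).
Hypotheses (ordT : total ord) (ord_tr : transitive ord) (ord_anti : antisymmetric ord).

Fixpoint inv (w : seq X) : nat :=
  if w is x :: s then (count (fun y => ~~ ord x y) s + inv s)%N else 0.

Lemma inv_swap u x y v : ~~ ord x y -> inv (u ++ x :: y :: v) = (inv (u ++ y :: x :: v)).+1.
Proof.
move=> nxy; elim: u => [|z u IH] /=.
  have -> : ord y x by have := ordT x y; rewrite (negbTE nxy).
  by rewrite nxy /= add0n add1n !addSn addnCA.
rewrite IH addnS; congr (_ + _).+1.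
by apply/permP; rewrite perm_cat2l -[x :: y :: v]/([:: x] ++ [:: y] ++ v) perm_catCA.
Qed.

Fixpoint split_desc (w : seq X) : option (seq X * X * X * seq X) :=
  match w with
  | x :: ((y :: v) as s) =>
      if ord x y then
        if split_desc s is Some (u, a, b, t) then Some (x :: u, a, b, t) else None
      else Some ([::], x, y, v)
  | _ => None
  end.

Lemma split_descN w : (split_desc w = None) <-> sorted ord w.
Proof.
elim: w => // x [|y v] //= IH; case: (ord x y) => //=.
by rewrite -IH; case: (match v with [::] => _ | _ => _ end) => [[[[? ?] ?] ?]|].
Qed.

Lemma split_descE w u x y v : split_desc w = Some (u, x, y, v) ->
  w = u ++ x :: y :: v /\ ~~ ord x y.
Proof.
elim: w u x y v => // a [|b s] //= IH u x y v; case: ifP => [ab|/negbT nab]; last by case=> <- <- <- <-.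
case E: (match s with [::] => _ | _ => _ end) => [[[[u' c] d] t]|] //.
by case=> <- <- <- <-; have [-> H] := IH _ _ _ _ E.
Qed.

(** The critical pairs of the straightening: a descent is the first one, or starts with its second
    letter, or lies beyond it. *)
Lemma split_desc_first w u x y v u0 x0 y0 v0 : w = u ++ x :: y :: v -> ~~ ord x y ->
  split_desc w = Some (u0, x0, y0, v0) ->
  [\/ [/\ u = u0, x = x0, y = y0 & v = v0],
      [/\ u = rcons u0 x0, x = y0 & v0 = y :: v] |
      exists m, u = u0 ++ x0 :: y0 :: m /\ v0 = m ++ x :: y :: v].
Proof.
elim: w u u0 x0 y0 v0 => [|a [|b s] IH] [|c u] u0 x0 y0 v0 //= [] //.
- move=> <- <- <- nxy; rewrite (negbTE nxy) => -[<- <- <- <-].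
  by constructor 1.
- move=> <- Es nxy; case: ifP => [ab|nab].
    case E: (match s with [::] => _ | _ => _ end) => [[[[u' e] d] t]|] // [<- <- <- <-].
    have [[-> -> -> ->]|[-> -> ->]|[m [-> ->]]] := IH _ _ _ _ _ Es nxy E.
    + by constructor 1.
    + by constructor 2.
    + by constructor 3; exists m.
  case=> <- <- <- <-; case: u Es => [|d u] [-> ->]; first by constructor 2.
  by constructor 3; exists u.
Qed.

(** Induction on the length and then on the number of inversions: in the rewriting of x y as y x +
    [x, y], the first term loses one inversion and the second one letter. *)
Lemma word_ind (Q : seq X -> Prop) : (forall w, sorted ord w -> Q w) ->
  (forall u x y v, ~~ ord x y -> Q (u ++ y :: x :: v) -> (forall z, Q (u ++ z :: v)) ->
    Q (u ++ x :: y :: v)) -> forall w, Q w.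
Proof.
move=> Qs Qd w; move En : (size w) => n; elim: n w En => [|n IHn] w En.
  by case: w En => // _; apply: Qs.
move Ek : (inv w) => k; elim: k w En Ek => [|k IHk] w En Ek.
all: case E : (split_desc w) => [[[[u x] y] v]|]; last by apply/Qs/split_descN.
all: have [Ew nxy] := split_descE E; move: Ek; rewrite Ew inv_swap // => -[] // Ek.
apply: Qd => //; last first.
  by move=> z; apply: IHn; move: En; rewrite Ew !size_cat /= !addnS => -[].
by apply: IHk => //; move: En; rewrite Ew !size_cat.
Qed.

End Words.

(** * Straightening of words and its confluence *)

Section Straightening.
Variables (F : fieldType) (L : lieAlgType F) (X : eqType) (ord : rel X) (e : X -> L).
Variables (N : lmodType F) (lin : (X -> N) -> {linear L -> N}).
Hypotheses (ordT : total ord) (ord_tr : transitive ord) (ord_anti : antisymmetric ord).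
Hypotheses (linE : forall f x, lin f (e x) = f x).
Hypothesis spanX : forall S : L -> Prop, subspace S -> (forall x, S (e x)) -> forall l, S l.

Lemma lin_uniq (f g : L -> N) : linear f -> linear g -> (forall x, f (e x) = g (e x)) -> f =1 g.
Proof.
move=> fl gl E; apply: spanX => //; split.
  by rewrite -[LHS]/(mklin fl 0) -[RHS]/(mklin gl 0) !raddf0.
by move=> c x y Ex Ey; rewrite fl gl Ex Ey.
Qed.

Lemma lin_ext f g l : (forall x, f x = g x) -> lin f l = lin g l.
Proof. by move=> /funext->. Qed.

Lemma lin_comb c f g l : lin (fun z => c *: f z + g z) l = c *: lin f l + lin g l.
Proof.
apply: (lin_uniq (g := fun l => c *: lin f l + lin g l)) => [||x]; last by rewrite !linE.
  exact: linearP.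
by move=> d x y /=; rewrite (linearP (lin f)) (linearP (lin g)) !scalerDr !scalerA mulrC addrACA.
Qed.

Lemma linD f g l : lin (fun z => f z + g z) l = lin f l + lin g l.
Proof.
rewrite -[in RHS](scale1r (lin f l)) -lin_comb; apply: lin_ext => z.
by rewrite scale1r.
Qed.

Lemma lin_swap f l l' :
  lin (fun z => lin (fun z' => f z z') l') l = lin (fun z' => lin (fun z => f z z') l) l'.
Proof.
move: l; apply: lin_uniq => [|c x y|x]; first exact: linearP.
  rewrite -lin_comb; apply: lin_ext => z; exact: linearP.
by rewrite linE; apply: lin_ext => z; rewrite linE.
Qed.

Section Construct.
Variable g : seq X -> N.

Definition insert (phi : seq X -> N) u l v : N := lin (fun z => phi (u ++ z :: v)) l.

(* The first descent x y of a word is rewritten as y x + [x, y]; nform recurses *)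
(* on the length and, for a given length, on the number of inversions.         *)
Fixpoint straighten phi k w : N :=
  if k is k'.+1 then
    if split_desc ord w is Some (u, x, y, v) then
      straighten phi k' (u ++ y :: x :: v) + insert phi u (bracket (e x) (e y)) v
    else g w
  else g w.

Fixpoint nform n w : N := if n is n'.+1 then straighten (nform n') (inv ord w) w else g w.

Definition pbw w := nform (size w) w.

Lemma pbw_sorted w : sorted ord w -> pbw w = g w.
Proof.
move=> /split_descN sw; rewrite /pbw; case: (size w) => //= n.
by case: (inv ord w) => //= k; rewrite sw.
Qed.

Lemma pbw_split w u x y v : split_desc ord w = Some (u, x, y, v) ->
  pbw w = pbw (u ++ y :: x :: v) + insert pbw u (bracket (e x) (e y)) v.
Proof.
move=> E; have [Ew nxy] := split_descE E; rewrite /pbw.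
have -> : size w = (size (u ++ x :: v)).+1 by rewrite Ew !size_cat /= !addnS.
have -> : size (u ++ y :: x :: v) = (size (u ++ x :: v)).+1 by rewrite !size_cat /= !addnS.
rewrite /= [in inv ord w]Ew inv_swap //= E; congr (_ + _).
apply: lin_ext => z; congr (nform _ _); by rewrite !size_cat.
Qed.

Definition rel_at w := forall u x y v, w = u ++ x :: y :: v ->
  pbw w = pbw (u ++ y :: x :: v) + insert pbw u (bracket (e x) (e y)) v.

Definition rel_desc w := forall u x y v, w = u ++ x :: y :: v -> ~~ ord x y ->
  pbw w = pbw (u ++ y :: x :: v) + insert pbw u (bracket (e x) (e y)) v.

(** At a strict ascent, the relation is the one at the descent of the exchanged word, with the
    bracket negated; for two equal letters the bracket is 0. *)
Lemma rel_descW n : (forall w, size w = n -> rel_desc w) -> forall w, size w = n -> rel_at w.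
Proof.
move=> H w En u x y v Ew; case: (boolP (ord x y)) => xy; last exact: H En _ _ _ _ Ew xy.
case: (boolP (ord y x)) => yx.
  have <- : x = y by apply: ord_anti; rewrite xy yx.
  have -> : pbw w = pbw (u ++ x :: x :: v).
    by rewrite Ew; congr (pbw (_ ++ _ :: _ :: _)); apply/esym/ord_anti; rewrite xy yx.
  by rewrite /insert bracketxx raddf0 addr0.
rewrite Ew (H (u ++ y :: x :: v) _ u y x v) //; last by rewrite -En Ew !size_cat.
by rewrite -addrA -raddfD [bracket (e y) _]bracketC addNr raddf0 addr0.
Qed.

Definition insert2 phi u l1 l2 v : N := lin (fun a => lin (fun b => phi (u ++ a :: b :: v)) l2) l1.

Lemma insert2_el phi u x l v : insert2 phi u (e x) l v = insert phi (rcons u x) l v.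
Proof. by rewrite /insert2 linE; apply: lin_ext => b; rewrite -cats1 -catA. Qed.

Lemma insert2_er phi u x l v : insert2 phi u l (e x) v = insert phi u l (x :: v).
Proof. by apply: lin_ext => a; rewrite linE. Qed.

Lemma insert2_comm phi u v :
  (forall x y, phi (u ++ x :: y :: v) = phi (u ++ y :: x :: v) + insert phi u (bracket (e x) (e y)) v) ->
  forall l1 l2, insert2 phi u l1 l2 v = insert2 phi u l2 l1 v + insert phi u (bracket l1 l2) v.
Proof.
move=> H l1 l2; move: l1; apply: lin_uniq => [|c x y|x]; first exact: linearP.
  rewrite {1}/insert2.
  have -> : lin (fun a => lin (fun b => phi (u ++ a :: b :: v)) (c *: x + y)) l2 =
            c *: insert2 phi u l2 x v + insert2 phi u l2 y v.
    by rewrite -lin_comb; apply: lin_ext => z; exact: linearP.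
  by rewrite bracket_linearl /insert linearP scalerDr addrACA.
move: l2; apply: lin_uniq => [c y z|c y z|y].
- by rewrite !insert2_el /insert linearP.
- rewrite bracket_linearr /insert linearP scalerDr addrACA; congr (_ + _).
  exact: linearP.
by rewrite /insert2 !linE H.
Qed.

(** The diamond lemma: [pbw] is defined by rewriting the first descent, and rewriting any other one
    gives the same value. Both results are reduced further, by induction on the inversions at equal
    length and by [IHn] for shorter words, until they meet. *)
Lemma pbw_rel_desc n : (forall w, size w = n -> rel_at w) -> forall w, size w = n.+1 -> rel_desc w.
Proof.
move=> IHn w En; move Ek : (inv ord w) => k; elim/ltn_ind: k w En Ek => k IHk w En Ek u x y v Ew nxy.
have small w' : size w' = n.+1 -> (inv ord w' < inv ord w)%N -> rel_desc w'.
  by move=> Ew' lt; apply: IHk Ew' erefl; rewrite -Ek.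
case E : (split_desc ord w) => [[[[u0 x0] y0] v0]|]; last first.
  move/split_descN: E; rewrite Ew => /cat_sorted2[_] /= /andP[].
  by rewrite (negbTE nxy).
have [_ nxy0] := split_descE E; rewrite (pbw_split E).
have [[-> -> -> ->] //|[Eu Ex Ev]|[m [Eu Ev]]] := split_desc_first Ew nxy E.
(* Overlapping descents: x0, x, y are in strictly decreasing order, and both reductions lead to y x
   x0, with correction terms containing a bracket. *)
- subst u v0 y0; rewrite -cats1 -catA /= in Ew *.
  have nx0y : ~~ ord x0 y.
    apply/negP => x0y; move: nxy0; have := ordT x0 x; case/orP => [->//|xx0] _.
    by move: nxy; rewrite (ord_tr xx0 x0y).
  have I1 := inv_swap ordT u0 (y :: v) nxy0.
  have I2 := inv_swap ordT (u0 ++ [:: x0]) v nxy.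
  have I3 := inv_swap ordT (u0 ++ [:: x]) v nx0y.
  have I4 := inv_swap ordT u0 (x0 :: v) nxy.
  have I5 := inv_swap ordT u0 (x :: v) nx0y.
  rewrite -!catA /= in I2 I3.
  have S s1 s2 s3 : size (u0 ++ s1 :: s2 :: s3 :: v) = n.+1 by move: En; rewrite Ew !size_cat.
  rewrite (small (u0 ++ x :: x0 :: y :: v) _ _ (u0 ++ [:: x]) x0 y v) -?catA //; last by rewrite Ew I1.
  rewrite (small (u0 ++ x :: y :: x0 :: v) _ _ u0 x y (x0 :: v)) //; last by rewrite Ew I1 I3.
  rewrite (small (u0 ++ x0 :: y :: x :: v) _ _ u0 x0 y (x :: v)) //; last by rewrite Ew I2.
  rewrite (small (u0 ++ y :: x0 :: x :: v) _ _ (u0 ++ [:: y]) x0 x v) -?catA //; last by rewrite Ew I2 I5.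
  have C := @insert2_comm pbw u0 v.
  have {}C l1 l2 : insert2 pbw u0 l1 l2 v = insert2 pbw u0 l2 l1 v + insert pbw u0 (bracket l1 l2) v.
    apply: C => a b; apply: IHn => //.
    by move: En; rewrite Ew !size_cat /= !addnS => -[].
  rewrite !cats1 -!insert2_el -!insert2_er.
  rewrite (C (bracket (e x0) (e x)) (e y)) (C (bracket (e x0) (e y)) (e x)) (C (bracket (e x) (e y)) (e x0)).
  (* Once the brackets are moved past the remaining letter, the corrections differ by three double
     brackets, which cancel by the Jacobi identity. *)
  have J : insert pbw u0 (bracket (bracket (e x0) (e x)) (e y)) v
      + insert pbw u0 (bracket (bracket (e x) (e y)) (e x0)) v
      = insert pbw u0 (bracket (bracket (e x0) (e y)) (e x)) v.
    by rewrite /insert -raddfD bracket_swap.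
  by rewrite -J (AC (1*2*1*2) ((1*5)*(4*(6*3))*2)).
(* Disjoint descents: the two rewritings commute, and so do the linear extensions of their bracket
   terms, by [lin_swap]. *)
- subst u v0; rewrite -catA /= in Ew *.
  have S s1 s2 s3 s4 : size (u0 ++ s1 :: s2 :: m ++ s3 :: s4 :: v) = n.+1.
    by move: En; rewrite Ew !size_cat /= !size_cat.
  have I1 := inv_swap ordT u0 (m ++ x :: y :: v) nxy0.
  have I2 := inv_swap ordT (u0 ++ x0 :: y0 :: m) v nxy; rewrite -!catA /= in I2.
  rewrite (small (u0 ++ y0 :: x0 :: m ++ x :: y :: v) _ _ (u0 ++ y0 :: x0 :: m) x y v) -?catA //;
    last by rewrite Ew I1.
  rewrite (small (u0 ++ x0 :: y0 :: m ++ y :: x :: v) _ _ u0 x0 y0 (m ++ y :: x :: v)) //;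
    last by rewrite Ew I2.
  rewrite -!addrA; congr (_ + _).
  have S' s1 s3 s4 : size (u0 ++ s1 :: m ++ s3 :: s4 :: v) = n.
    by move: En; rewrite Ew !size_cat /= !size_cat /= !addnS => -[].
  have E1 : insert pbw u0 (bracket (e x0) (e y0)) (m ++ x :: y :: v) =
      insert pbw u0 (bracket (e x0) (e y0)) (m ++ y :: x :: v) +
      lin (fun z => insert pbw (u0 ++ z :: m) (bracket (e x) (e y)) v) (bracket (e x0) (e y0)).
    rewrite -linD; apply: lin_ext => z.
    by rewrite (IHn _ (S' z x y) (u0 ++ z :: m) x y v) -?catA.
  have S'' z s1 s2 : size (u0 ++ s1 :: s2 :: m ++ z :: v) = n.
    by move: En; rewrite Ew !size_cat /= !size_cat /= !addnS => -[].
  have -> : insert pbw (u0 ++ x0 :: y0 :: m) (bracket (e x) (e y)) v =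
      insert pbw (u0 ++ y0 :: x0 :: m) (bracket (e x) (e y)) v +
      lin (fun z => insert pbw u0 (bracket (e x0) (e y0)) (m ++ z :: v)) (bracket (e x) (e y)).
    rewrite -linD; apply: lin_ext => z.
    by rewrite -!catA /= (IHn _ (S'' z x0 y0) u0 x0 y0 (m ++ z :: v)).
  rewrite E1 addrCA; congr (_ + (_ + _)); rewrite /insert lin_swap.
  by apply: lin_ext => z; apply: lin_ext => z'; rewrite -catA.
Qed.

Lemma pbw_rel u x y v : pbw (u ++ x :: y :: v) =
  pbw (u ++ y :: x :: v) + insert pbw u (bracket (e x) (e y)) v.
Proof.
suff H n w : size w = n -> rel_at w by apply: (H _ _ erefl).
elim: n w => [|n IHn]; first by move=> [] // _ [].
by apply: rel_descW; apply: pbw_rel_desc.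
Qed.
End Construct.

(** Such a function of words is a linear map on U(L), read on the products of basis elements. *)
Definition straight (phi : seq X -> N) := forall u x y v, phi (u ++ x :: y :: v) =
  phi (u ++ y :: x :: v) + insert phi u (bracket (e x) (e y)) v.

Lemma straight_subspace : subspace (straight : (seq X -> N) -> Prop).
Proof.
split=> [u x y v|c f g Hf Hg u x y v].
  have -> : insert 0 u (bracket (e x) (e y)) v = 0 by apply: (lin_uniq (g := fun=> 0));
    [exact: linearP | by move=> c a b; rewrite scaler0 addr0 | move=> z; rewrite linE].
  by rewrite addr0.
have -> : insert (c *: f + g) u (bracket (e x) (e y)) v =
   c *: insert f u (bracket (e x) (e y)) v + insert g u (bracket (e x) (e y)) v.
  by rewrite -lin_comb.
by rewrite -[LHS]/(c *: f _ + g _) Hf Hg scalerDr addrACA.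
Qed.

Definition straights := Submodule straight_subspace.

Lemma shift_straight l phi : straight phi -> straight (fun w => lin (fun z => phi (rcons w z)) l).
Proof.
move=> H u x y v; rewrite /insert lin_swap -linD; apply: lin_ext => z.
rewrite !rcons_cat /= H; congr (_ + _); apply: lin_ext => t.
by rewrite rcons_cat.
Qed.

(** Straight functions are stable under appending an element of [L], which makes them an [L]-module,
    hence a U(L)-module by [uenv_act]. [Lam r] is the translate of [phi] by [r]: its value at [w]
    stands for that of [phi] on the product of [w] and [r]. *)
Lemma straight_rep phi : straight phi -> exists Lam : {linear uenv L -> (seq X -> N)},
  Lam 1 = phi /\ forall l r w, Lam (uiota l * r) w = lin (fun z => Lam r (rcons w z)) l.
Proof.
move=> Hphi.
pose rho l (p : subm straights) : subm straights :=
  mksubm (S := straights) (shift_straight l (subm_valP p)).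
have [||x y p|act [al a1 aM]] := @uenv_act F (subm straights) L rho.
- move=> p c x y; apply: subm_inj; apply/funext => w /=.
  by rewrite linearP.
- move=> l c p q; apply: subm_inj; apply/funext => w /=.
  rewrite -[RHS]/(c *: lin _ l + lin _ l) -lin_comb; exact: lin_ext.
- apply: subm_inj; apply/funext => w /=.
  have H := @insert2_comm (subm_val p) w [::] (fun a b => subm_valP p w a b [::]) x y.
  rewrite -[RHS]/(lin _ x - lin _ y); apply: (addIr (insert2 (subm_val p) w y x [::])).
  rewrite addrC; have -> : lin (fun z => subm_val p (rcons w z)) (bracket x y) =
    insert (subm_val p) w (bracket x y) [::] by apply: lin_ext => z; rewrite cats1.
  rewrite -H addrC; apply/eqP; rewrite addrC -subr_eq -[X in _ == X]/(lin _ x - lin _ y) /insert2.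
  by apply/eqP; congr (_ - _); apply: lin_ext => a; apply: lin_ext => b; rewrite -!cats1 -catA.
pose f := mksubm (S := straights) Hphi.
have fl : linear (fun r => subm_val (act r f)) by move=> c u v; rewrite al.
exists (mklin fl); split; first by rewrite mklinE a1.
by move=> l r w; rewrite mklinE aM.
Qed.

(** The independence half of Poincare-Birkhoff-Witt, in dual form: a linear map on U(L) can be
    prescribed arbitrarily on sorted monomials. *)
Theorem pbw_functional (g : seq X -> N) :
  exists phi : seq X -> N, exists Lam : {linear uenv L -> (seq X -> N)},
  [/\ forall w, sorted ord w -> phi w = g w, straight phi, Lam 1 = phi &
      forall l r w, Lam (uiota l * r) w = lin (fun z => Lam r (rcons w z)) l].
Proof.
have [Lam [L1 LM]] := straight_rep (fun u x y v => pbw_rel g u x y v).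
by exists (pbw g), Lam; split=> //; [apply: pbw_sorted | apply: pbw_rel].
Qed.
End Straightening.

Section Umap.
Variables (F : fieldType) (M L : lieAlgType F) (j : {linear M -> L}).
Hypothesis jb : forall x y, j (bracket x y) = bracket (j x) (j y).

Definition umap : uenv M -> uenv L := uenv_lift (fun m => uiota (j m)).

Lemma umap_rep : is_lie_rep (fun m => uiota (j m)).
Proof.
split=> [c x y|x y]; first by rewrite !linearP.
by rewrite jb uiota_bracket.
Qed.

Lemma umap_linear : linear umap.
Proof. exact: uenv_lift_linear umap_rep. Qed.
Lemma umapM u v : umap (u * v) = umap u * umap v.
Proof. exact: (uenv_liftM umap_rep). Qed.
Lemma umap1 : umap 1 = 1.
Proof. exact: (uenv_lift1 umap_rep). Qed.
Lemma umap_iota m : umap (uiota m) = uiota (j m).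
Proof. exact: (uenv_lift_iota _ umap_rep). Qed.
Definition umapL : {linear uenv M -> uenv L} := mklin umap_linear.
Lemma umapD u v : umap (u + v) = umap u + umap v.
Proof. exact: (raddfD umapL). Qed.
Lemma umap0 : umap 0 = 0.
Proof. exact: (raddf0 umapL). Qed.
Lemma umapZ c u : umap (c *: u) = c *: umap u.
Proof. exact: (linearZ_LR umapL). Qed.
Lemma umap_sum (I : Type) (r : seq I) (P : pred I) (f : I -> uenv M) :
  umap (\sum_(i <- r | P i) f i) = \sum_(i <- r | P i) umap (f i).
Proof. exact: (raddf_sum umapL). Qed.

End Umap.

(** * Freeness of U(L) as a right module over U(M) *)

Section Free.
Variables (F : fieldType) (M L : lieAlgType F) (j : {linear M -> L}).
Hypothesis jb : forall x y, j (bracket x y) = bracket (j x) (j y).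
Hypothesis jI : injective j.

Let W l := exists m, l = j m.
Let B : L -> Prop := sval (cid (adapted_basis W)).
Let Bord := cid (svalP (cid (adapted_basis W))).
Let ord0 : rel L := sval Bord.
Let BP := svalP Bord.

Let X := {b : L | `[< B b >]}.
Let e (x : X) : L := sval x.
Let ord : rel X := fun x y => ord0 (e x) (e y).
Let inW : pred X := fun x => `[< W (e x) >].

Let ordT : total ord.
Proof. by case: BP => _ _ _ [H _ _] _ x y; apply: H. Qed.
Let ord_tr : transitive ord.
Proof. by case: BP => _ _ _ [_ H _] _ x y z; apply: H. Qed.
Let ord_anti : antisymmetric ord.
Proof. by case: BP => _ _ _ [_ _ H] _ x y /H /val_inj. Qed.
Let ordW x y : inW x -> ord x y -> inW y.
Proof.
by case: BP => _ _ _ _ H /asboolP Wx xy; apply/asboolP; apply: H Wx xy.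
Qed.

Let exists_lin (N : lmodType F) (f : X -> N) : exists g : {linear L -> N}, forall x, g (e x) = f x.
Proof.
case: BP => H _ _ _ _.
have [g Hg] := H N (fun l => if pselect (B l) is left Bl then f (exist _ l (introT (asboolP _) Bl)) else 0).
exists g => -[b Bb]; rewrite Hg /=; last exact/asboolP.
case: pselect => [Bl|nB]; last by case: nB; apply/asboolP.
by congr f; apply: val_inj.
Qed.

Let spanX (S : L -> Prop) : subspace S -> (forall x, S (e x)) -> forall l, S l.
Proof.
move=> sS SX l; case: BP => _ H _ _ _.
apply: (span_sub sS) (H l) => b Bb.
exact: (SX (exist _ b (introT (asboolP _) Bb))).
Qed.

Let mm (x : X) : M := if pselect (W (e x)) is left H then sval (cid H) else 0.

Let mmP x : inW x -> j (mm x) = e x.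
Proof.
by move=> /asboolP Wx; rewrite /mm; case: pselect => // H; case: (cid H).
Qed.

Let spanM (S : M -> Prop) : subspace S -> (forall x, inW x -> S (mm x)) -> forall m, S m.
Proof.
move=> sS SX m; case: BP => _ _ H _ _.
suff [_ Hm] : W (j m) /\ forall m', j m = j m' -> S m' by apply: Hm.
apply: (span_sub (W := fun l => W l /\ forall m', l = j m' -> S m')) (H _ _); last by exists m.
  split=> [|c x y [[a ->] Ha] [[b ->] Hb]].
    split=> [|m']; first by exists 0; rewrite raddf0.
    by rewrite -(raddf0 j) => /jI <-; case: sS.
  split=> [|m']; first by exists (c *: a + b); rewrite linearP.
  by rewrite -linearP => /jI <-; case: sS => _ Sl; apply: Sl; [apply: Ha|apply: Hb].
move=> b [Bb Wb]; split=> // m'; pose x : X := exist _ b (introT (asboolP _) Bb).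
have Wx : inW x by apply/asboolP.
by rewrite -[b]/(e x) -mmP // => /jI <-; apply: SX.
Qed.

Let lin (N : lmodType F) (f : X -> N) : {linear L -> N} := sval (cid (exists_lin f)).
Let linE (N : lmodType F) (f : X -> N) x : lin f (e x) = f x.
Proof. exact: (svalP (cid (exists_lin f))). Qed.

Let wordL (w : seq X) : uenv L := \prod_(x <- w) uiota (e x).
Let wordM (w : seq X) : uenv M := \prod_(x <- w) uiota (mm x).
(** The coordinate of index [k], on sorted words: the letters outside [W] come first and must spell
    [k]; the others are multiplied in U(M). *)
Let g k (w : seq X) : uenv M := if filter (predC inW) w == k then wordM (filter inW w) else 0.

Let data k := cid (pbw_functional (N := uenv M) ordT ord_tr ord_anti (@linE (uenv M)) spanX (g k)).
Let phi k := sval (data k).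
Let data2 k := cid (svalP (data k)).
Let Lam k : {linear uenv L -> (seq X -> uenv M)} := sval (data2 k).
Let LamP k : [/\ forall w, sorted ord w -> phi k w = g k w,
  straight e (@lin (uenv M)) (phi k), Lam k 1 = phi k &
  forall l r w, Lam k (uiota l * r) w = lin (fun z => Lam k r (rcons w z)) l].
Proof. exact: (svalP (data2 k)). Qed.

Let wordM_swap u x y v : wordM (u ++ x :: y :: v) = wordM (u ++ y :: x :: v)
  + wordM u * uiota (bracket (mm x) (mm y)) * wordM v.
Proof.
rewrite /wordM !big_cat !big_cons /= uiota_bracket -mulrA mulrBl -!mulrA -mulrDr.
by congr (_ * _); rewrite addrC subrK.
Qed.

Let sorted_cat s t : sorted ord s -> all (predC inW) s -> sorted ord t -> all inW t ->
  sorted ord (s ++ t).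
Proof.
move=> ss as_ st at_; rewrite (sorted_pairwise ord_tr) pairwise_cat -!(sorted_pairwise ord_tr).
rewrite ss st !andbT; apply/allrelP => x y sx ty.
have := ordT x y; case/orP => // yx.
have := ordW (allP at_ y ty) yx; by rewrite (negbTE (allP as_ x sx)).
Qed.

Let filter_all (p : pred X) s : all p s -> filter p s = s.
Proof. by move=> /all_filterP. Qed.
Let filter_none (p : pred X) s : all (predC p) s -> filter p s = [::].
Proof. by move=> H; apply/eqP; rewrite -(negbK (_ == _)) -has_filter -all_predC. Qed.

(** The part [t] may be unsorted, because [wordM] satisfies in U(M) the relations by which [phi k]
    is straightened. The right U(M)-linearity of the coordinates rests on this. *)
Let phi_cat k s t : sorted ord s -> all (predC inW) s -> all inW t ->
  phi k (s ++ t) = if s == k then wordM t else 0.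
Proof.
have [phiS phiR _ _] := LamP k => ss as_.
elim/(word_ind ordT): t => [t st at_|u x y v nxy IH IHz].
  rewrite phiS; last exact: sorted_cat.
  rewrite /g !filter_cat (filter_all as_) (filter_all at_) (filter_none as_).
  have -> : filter (predC inW) t = [::].
    by apply: filter_none; apply/allP => z tz /=; rewrite negbK; apply: (allP at_).
  by rewrite cats0 cat0s.
rewrite !all_cat /= => /and4P[au Wx Wy av].
rewrite catA phiR -catA IH ?all_cat /= ?au ?Wx ?Wy ?av //.
rewrite -!mmP // -jb (wordM_swap u x y v).
have H m : insert (@lin (uenv M)) (phi k) (s ++ u) (j m) v =
    if s == k then wordM u * uiota m * wordM v else 0.
  have fl : linear (fun m => insert (@lin (uenv M)) (phi k) (s ++ u) (j m) v).
    by move=> c a b; rewrite /insert !linearP.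
  have gl : linear (fun m => if s == k then wordM u * uiota m * wordM v else 0).
    move=> c a b; case: ifP => _; last by rewrite scaler0 addr0.
    by rewrite linearP mulrDr mulrDl -!scalerAr -scalerAl.
  move: m; apply: spanM => [|z Wz].
    split; first exact: (etrans (raddf0 (mklin fl)) (esym (raddf0 (mklin gl)))).
    by move=> c a b Ha Hb; rewrite fl gl Ha Hb.
  rewrite mmP // /insert linE -catA IHz ?all_cat /= ?au ?Wz ?av //.
  by rewrite /wordM big_cat big_cons -!mulrA.
by rewrite H; case: ifP => _; rewrite ?addr0.
Qed.

Let sorted_split w : sorted ord w -> exists s t,
  [/\ w = s ++ t, sorted ord s, all (predC inW) s & all inW t].
Proof.
elim: w => [|x w IH] sw; first by exists [::], [::].
case: (boolP (inW x)) => Wx.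
  exists [::], (x :: w); split=> //=; rewrite Wx /=; apply/allP => y wy.
  by apply: (ordW Wx); apply: (allP (order_path_min ord_tr sw)).
have [s [t [Ew ss as_ at_]]] := IH (path_sorted sw).
exists (x :: s), t; rewrite Ew /= Wx as_; split=> //.
by move: sw; rewrite Ew -cat_cons => /cat_sorted2[].
Qed.

Let phi_rcons k w x : inW x -> phi k (rcons w x) = phi k w * uiota (mm x).
Proof.
have [phiS phiR _ _] := LamP k => Wx.
elim/(word_ind ordT): w => [w sw|u a b v nab IH IHz].
  have [s [t [Ew ss as_ at_]]] := sorted_split sw.
  rewrite Ew rcons_cat !phi_cat //; last by rewrite all_rcons Wx.
  by case: ifP => _; rewrite ?mul0r // /wordM big_rcons.
rewrite rcons_cat /= (phiR u a b (rcons v x)) (phiR u a b v) -rcons_cons -rcons_cons -rcons_cat IH mulrDl; congr (_ + _).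
have fl : linear (fun l => insert (@lin (uenv M)) (phi k) u l v * uiota (mm x)).
  by move=> c l l'; rewrite /insert linearP mulrDl scalerAl.
apply: (lin_uniq spanX (f := fun l => insert (@lin (uenv M)) (phi k) u l (rcons v x)) _ fl).
  by move=> c l l'; rewrite /insert linearP.
by move=> z; rewrite /insert !linE -IHz -rcons_cons -rcons_cat.
Qed.

Let Lam_rcons k r x w : inW x -> Lam k (r * uiota (e x)) w = Lam k r w * uiota (mm x).
Proof.
have [_ _ L1 LM] := LamP k => Wx; elim/uenv_ind: r w => [|y r IH|c u v Hu Hv] w.
- by rewrite mul1r -[uiota _]mulr1 LM linE L1 phi_rcons.
- rewrite -mulrA !LM.
  have fl : linear (fun l => lin (fun z => Lam k r (rcons w z)) l * uiota (mm x)).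
    by move=> c l l'; rewrite linearP mulrDl scalerAl.
  apply: (lin_uniq spanX _ fl); first by move=> c l l'; rewrite linearP.
  by move=> z; rewrite !linE IH.
- rewrite mulrDl -scalerAl !(linearP (Lam k)).
  rewrite -[LHS]/(c *: Lam k (u * uiota (e x)) w + Lam k (v * uiota (e x)) w) Hu Hv.
  by rewrite -[X in _ = X * _]/(c *: Lam k u w + Lam k v w) scalerAl -mulrDl.
Qed.

Let lam k r : uenv M := Lam k r [::].

Let lam_linear k : linear (lam k).
Proof. by move=> c u v; rewrite /lam (linearP (Lam k)). Qed.

Let lamM k r n : lam k (r * umap j n) = lam k r * n.
Proof.
elim/uenv_ind: n r => [|m n IH|c u v Hu Hv] r.
- by rewrite umap1 // !mulr1.
- rewrite umapM // umap_iota // mulrA IH [RHS]mulrA; congr (_ * _).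
  have fl : linear (fun m => lam k (r * uiota (j m))).
    by move=> c a b; rewrite !linearP mulrDr -scalerAr lam_linear.
  have gl : linear (fun m => lam k r * uiota m).
    by move=> c a b; rewrite linearP mulrDr -scalerAr.
  move: m; apply: spanM => [|z Wz].
    split; first exact: (etrans (raddf0 (mklin fl)) (esym (raddf0 (mklin gl)))).
    by move=> c a b Ha Hb; rewrite fl gl Ha Hb.
  by rewrite mmP // /lam Lam_rcons.
- by rewrite umapD // umapZ // mulrDr mulrDr -!scalerAr lam_linear Hu Hv.
Qed.

Let Lam_word k s r w : Lam k (wordL s * r) w = Lam k r (w ++ s).
Proof.
have [_ _ _ LM] := LamP k.
elim: s w => [|x s IH] w; first by rewrite /wordL big_nil mul1r cats0.
by rewrite /wordL big_cons -mulrA LM linE -/(wordL s) IH cat_rcons.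
Qed.

Let admissible s := sorted ord s && all (predC inW) s.

Let lam_word k s : admissible s -> lam k (wordL s) = if s == k then 1 else 0.
Proof.
move=> /andP[ss as_]; have [_ _ L1 _] := LamP k.
rewrite /lam -[wordL s]mulr1 Lam_word L1 cat0s -[s in phi k s]cats0 phi_cat //.
by rewrite /wordM big_nil.
Qed.

Let wordL_swap u x y v : wordL (u ++ x :: y :: v) = wordL (u ++ y :: x :: v)
  + wordL u * uiota (bracket (e x) (e y)) * wordL v.
Proof.
rewrite /wordL !big_cat !big_cons /= uiota_bracket -mulrA mulrBl -!mulrA -mulrDr.
by congr (_ * _); rewrite addrC subrK.
Qed.

Let wordL_mm t : all inW t -> wordL t = umap j (wordM t).
Proof.
elim: t => [|x t IH] /=; first by rewrite /wordL /wordM !big_nil umap1.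
move=> /andP[Wx Wt]; rewrite /wordL /wordM !big_cons umapM // umap_iota // mmP //.
by rewrite -/(wordL t) IH.
Qed.

(** The spanning half of Poincare-Birkhoff-Witt: words are sorted by [word_ind], and the letters of
    [W], which come last, are absorbed in U(M). *)
Let spanU : forall r, span (fun r => exists s n, admissible s /\ r = wordL s * umap j n) r.
Proof.
set T := span _; have sT : subspace T by apply: span_subspace.
have Tword w n : T (wordL w * umap j n).
  elim/(word_ind ordT): w n => [w sw|u x y v nxy IH IHz] n.
    have [s [t [Ew ss as_ at_]]] := sorted_split sw.
    apply: spanI; exists s, (wordM t * n); rewrite /admissible ss as_; split=> //.
    by rewrite umapM // -wordL_mm // Ew /wordL big_cat mulrA.
  rewrite wordL_swap mulrDl; apply: spanD; first exact: IH.
  apply: (spanX (S := fun l => T (wordL u * uiota l * wordL v * umap j n))).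
    split=> [|c a b Ta Tb]; first by rewrite raddf0 mulr0 !mul0r; apply: span0.
    by rewrite linearP mulrDr !mulrDl -scalerAr -!scalerAl; apply: spanL.
  by move=> z; have := IHz z n; rewrite /wordL big_cat big_cons /= !mulrA.
have H r : span (fun r => exists w, r = wordL w) r.
  elim/uenv_ind: r => [|l r IH|c u v Hu Hv]; last exact: spanL.
    by apply: spanI; exists [::]; rewrite /wordL big_nil.
  elim: IH => [|_ [w ->]|c u v _ Hu _ Hv].
  - by rewrite mulr0; apply: span0.
  - apply: (spanX (S := fun l => span _ (uiota l * wordL w))).
      split=> [|c a b Ta Tb]; first by rewrite raddf0 mul0r; apply: span0.
      by rewrite linearP mulrDl -scalerAl; apply: spanL.
    by move=> z; apply: spanI; exists (z :: w); rewrite /wordL big_cons.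
  - by rewrite mulrDr -scalerAr; apply: spanL.
move=> r; apply: (span_sub sT) (H r) => _ [w ->].
by have := Tword w 1; rewrite umap1 // mulr1.
Qed.

Let big_supp (I : eqType) (V : zmodType) (s t : seq I) (h : I -> V) : uniq s -> uniq t ->
  {subset s <= t} -> (forall i, i \notin s -> h i = 0) -> \sum_(i <- t) h i = \sum_(i <- s) h i.
Proof.
move=> us ut st h0; rewrite (bigID [in s]) /= [X in _ + X]big1 ?addr0; last by move=> i /h0.
rewrite -big_filter; apply: perm_big; apply: uniq_perm => //; first exact: filter_uniq.
by move=> i; rewrite mem_filter; case: (boolP (i \in s)) => //= /st.
Qed.

Let expand r : exists ks, [/\ uniq ks, forall k, k \notin ks -> lam k r = 0 &
  r = \sum_(k <- ks) wordL k * umap j (lam k r)].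
Proof.
have lam0 k : lam k 0 = 0 := raddf0 (mklin (lam_linear k)).
elim: (spanU r) => [|_ [s [n [As ->]]]|c u v _ [ku [uu u0 Eu]] _ [kv [uv v0 Ev]]].
- by exists [::]; split=> //; rewrite big_nil.
- exists [:: s]; split=> //= [k|].
    by rewrite inE lamM lam_word // eq_sym => /negbTE->; rewrite mul0r.
  by rewrite big_seq1 lamM lam_word // eqxx mul1r.
- have u1 k : k \notin ku -> wordL k * umap j (lam k u) = 0.
    by move=> /u0->; rewrite umap0 // mulr0.
  have v1 k : k \notin kv -> wordL k * umap j (lam k v) = 0.
    by move=> /v0->; rewrite umap0 // mulr0.
  exists (undup (ku ++ kv)); split; first exact: undup_uniq.
    move=> k; rewrite mem_undup mem_cat negb_or => /andP[ku' kv'].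
    by rewrite lam_linear u0 // v0 // scaler0 addr0.
  rewrite [LHS](congr2 (fun a b => c *: a + b) Eu Ev).
  rewrite -(big_supp uu (undup_uniq (ku ++ kv)) _ u1); last by move=> k kk; rewrite mem_undup mem_cat kk.
  rewrite -(big_supp uv (undup_uniq (ku ++ kv)) _ v1); last by move=> k kk; rewrite mem_undup mem_cat kk orbT.
  rewrite scaler_sumr -big_split; apply: eq_bigr => k _ /=.
  by rewrite lam_linear umapD // umapZ // mulrDr scalerAr.
Qed.

Let lam_iota k l : lam k (uiota l) = lin (fun z => phi k [:: z]) l.
Proof. by have [_ _ L1 LM] := LamP k; rewrite /lam -[uiota l]mulr1 LM L1. Qed.

Let phi1 k z : phi k [:: z] = if inW z then (if k == [::] then uiota (mm z) else 0)
  else if k == [:: z] then 1 else 0.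
Proof.
case: ifP => Wz.
  have -> : [:: z] = [::] ++ [:: z] by []; rewrite phi_cat //= ?Wz // eq_sym.
  by rewrite /wordM big_seq1.
have -> : [:: z] = [:: z] ++ [::] by []; rewrite phi_cat //= ?Wz // eq_sym.
by rewrite /wordM big_nil.
Qed.

(** The functional worth [e x] on the one-letter word x and 0 on the other sorted words recovers [l]
    from its image in U(L). *)
Lemma uiota_inj_aux : injective (@uiota F L).
Proof.
have [psi [Lm [psiS _ L1 LM]]] := pbw_functional (N := L) ordT ord_tr ord_anti (@linE L) spanX
  (fun w => if w is [:: x] then e x else 0).
have H l : Lm (uiota l) [::] = l.
  rewrite -[uiota l]mulr1 LM L1; apply: (lin_uniq spanX (f := lin _) (g := id)) => //.
    by move=> c a b; rewrite linearP.
  by move=> x; rewrite linE psiS.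
by move=> x y E; rewrite -(H x) E H.
Qed.

(* Poincare-Birkhoff-Witt: U(L) is a free right U(M)-module on the sorted     *)
(* monomials in a basis of a complement of j(M), lambda being the dual basis. *)
Theorem uenv_free : exists (K : eqType) (b : K -> uenv L) (lambda : K -> uenv L -> uenv M) (k0 : K),
  [/\ forall k, linear (lambda k), forall k r n, lambda k (r * umap j n) = lambda k r * n,
      lambda k0 1 = 1,
      forall r, exists ks, [/\ uniq ks, forall k, k \notin ks -> lambda k r = 0 &
         r = \sum_(k <- ks) b k * umap j (lambda k r)]
    & forall l, (forall m, l <> j m) -> exists k a, a != 0 /\ lambda k (uiota l) = a *: 1].
Proof.
exists (seq X), wordL, lam, [::]; split=> //.
- by have := lam_word [::] (isT : admissible [::]); rewrite /wordL big_nil.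
- move=> l nl; apply: contrapT => H.
  have lam1 z : ~~ inW z -> exists a, lam [:: z] (uiota l) = a *: 1.
    move=> nWz; rewrite lam_iota; apply: (spanX (S := fun l => exists a, lin _ l = a *: 1)).
      split=> [|c x y [a Ea] [a' Ea']]; first by exists 0; rewrite raddf0 scale0r.
      by exists (c * a + a'); rewrite linearP Ea Ea' scalerDl scalerA.
    move=> x; rewrite linE phi1; case: ifP => _; first by exists 0; rewrite scale0r.
    by case: ifP => _; [exists 1; rewrite scale1r | exists 0; rewrite scale0r].
  have lamz k : k != [::] -> lam k (uiota l) = 0.
    move=> kn; case: (pselect (exists2 z, ~~ inW z & k = [:: z])) => [[z nWz Ek]|nk].
      have [a Ea] := lam1 z nWz; have [a0|a0] := eqVneq a 0; first by rewrite Ek Ea a0 scale0r.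
      by case: H; exists [:: z], a.
    rewrite lam_iota; apply: (lin_uniq spanX (g := fun=> 0)); first by move=> c x y; rewrite linearP.
      by move=> c x y; rewrite scaler0 addr0.
    move=> z; rewrite linE phi1 (negbTE kn); case: ifP => // /negbT nWz.
    by case: eqP => // Ek; case: nk; exists z.
  have [m Em] : exists m, lam [::] (uiota l) = uiota m.
    rewrite lam_iota; apply: (spanX (S := fun l => exists m, lin _ l = uiota m)).
      split=> [|c x y [a Ea] [a' Ea']]; first by exists 0; rewrite !raddf0.
      by exists (c *: a + a'); rewrite !linearP Ea Ea'.
    move=> x; rewrite linE phi1; case: ifP => _; first by exists (mm x).
    by exists 0; rewrite raddf0.
  have [ks [uks k0 Ek]] := expand (uiota l).
  apply: (nl m); apply: uiota_inj_aux; rewrite Ek.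
  transitivity (\sum_(k <- ks | k == [::]) wordL k * umap j (lam k (uiota l))).
    rewrite [LHS](bigID (pred1 [::])) /= [X in _ + X]big1 ?addr0 // => k kn.
    by rewrite lamz // umap0 // mulr0.
  case: (boolP ([::] \in ks)) => k0s.
    by rewrite -big_filter filter_pred1_uniq // big_seq1 Em umap_iota // /wordL big_nil mul1r.
  have m0 := k0 _ k0s; rewrite Em in m0; rewrite -umap_iota // m0 umap0 //.
  by rewrite big_seq_cond big1 // => k /andP[kk /eqP Ekk]; move: k0s; rewrite -Ekk kk.
Qed.

End Free.

Lemma uiota_inj (F : fieldType) (L : lieAlgType F) : injective (@uiota F L).
Proof. exact: (@uiota_inj_aux F L L idfun). Qed.

(** * Free products and the Fox derivative *)

Section PolyLie.
Variables (F : fieldType) (E : algType F).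

(* Lie algebra t E[t], graded by the powers of t; p stands for t p. *)
Definition plie : Type := palg E.
HB.instance Definition _ := GRing.Lmodule.on plie.

Let XE : palg E := ('X : {poly E}).
Let XC (p : palg E) : XE * p = p * XE.
Proof. exact/esym/(commr_polyX (p : {poly E})). Qed.

Definition comm_palg (p q : palg E) : palg E := p * q - q * p.
(** The commutator of t p and t q is t times t [p, q], whence the factor [XE]. For the same reason
    the monomial c t^n' has degree n' + 1 in [plie_deg]. *)
Definition plie_bracket (p q : plie) : plie := comm_palg p q * XE.

Let cl c (x y q : palg E) : comm_palg (c *: x + y) q = c *: comm_palg x q + comm_palg y q.
Proof. by rewrite /comm_palg mulrDl mulrDr -scalerAl -scalerAr opprD addrACA -scalerBr. Qed.
Let cr c (x y p : palg E) : comm_palg p (c *: x + y) = c *: comm_palg p x + comm_palg p y.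
Proof. by rewrite /comm_palg mulrDl mulrDr -scalerAl -scalerAr opprD addrACA -scalerBr. Qed.
Let bl (q : plie) : linear (plie_bracket^~ q).
Proof. by move=> c x y; rewrite /plie_bracket cl mulrDl scalerAl. Qed.
Let br (p : plie) : linear (plie_bracket p).
Proof. by move=> c x y; rewrite /plie_bracket cr mulrDl scalerAl. Qed.
Let bxx (p : plie) : plie_bracket p p = 0.
Proof. by rewrite /plie_bracket /comm_palg subrr mul0r. Qed.
Let bb p q r : plie_bracket p (plie_bracket q r) = comm_palg p (comm_palg q r) * XE * XE.
Proof.
rewrite /plie_bracket {1}/comm_palg mulrA -[_ * XE * p]mulrA XC mulrA -mulrBl.
by [].
Qed.
Let bj (p q r : plie) : plie_bracket p (plie_bracket q r) +
  plie_bracket q (plie_bracket r p) + plie_bracket r (plie_bracket p q) = 0.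
Proof.
rewrite !bb -!mulrDl (_ : _ + _ + _ = 0 :> palg E) ?mul0r //.
rewrite /comm_palg !mulrBr !mulrBl !opprB !mulrA.
rewrite (AC (2*2*(2*2)*(2*2)) ((1*12)*(2*7)*(3*10)*(4*5)*(6*11)*(8*9))) /=.
by rewrite !subrr !addNr !addr0.
Qed.
HB.instance Definition _ := isLieAlgebra.Build F plie bl br bxx bj.

Definition plie_deg (n : nat) (p : plie) : Prop :=
  if n is n'.+1 then exists c, p = pmono c n' else p = 0.

Let pm0 n : pmono (0 : E) n = 0. Proof. exact: (raddf0 (pmonoL E n)). Qed.
Let pmB n (x y : E) : pmono (x - y) n = pmono x n - pmono y n.
Proof. exact: (raddfB (pmonoL E n)). Qed.
Let pmZ n k (x : E) : pmono (k *: x) n = k *: pmono x n.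
Proof. exact: (linearZ_LR (pmonoL E n)). Qed.

Let dg : is_grading plie_deg.
Proof.
split=> [[|n]|p|s f us Df f0 i si].
- by split=> // x y -> ->; rewrite subr0.
- split=> [|x y [a ->] [b ->]]; first by exists 0; rewrite pm0.
  by exists (a - b); rewrite pmB.
- exists [seq pmono (p : {poly E})`_i i | i <- iota 0 (size (p : {poly E}))].
    by move=> _ /mapP[i _ ->]; exists i.+1; exists (p : {poly E})`_i.
  rewrite big_map; apply/polyP => i; rewrite [RHS]coef_sum.
  have [li|li] := ltnP i (size (p : {poly E})).
    rewrite (bigD1_seq i) ?mem_iota ?iota_uniq //= coef_pmono eqxx big1 ?addr0 // => k ki.
    by rewrite coef_pmono eq_sym (negbTE ki).
  rewrite nth_default // big_seq big1 // => k; rewrite mem_iota add0n => /= lk.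
  by rewrite coef_pmono; case: eqP => // Ei; move: lk; rewrite -Ei ltnNge li.
- case: i si => [|i] si; first exact: (Df 0%N).
  have [c Ec] := Df i.+1.
  have : \sum_(j <- s) (f j : {poly E})`_i = 0.
    rewrite -[LHS](coef_sum s xpredT (f : nat -> {poly E})) -[RHS](coef0 E i).
    exact: (congr1 (fun p : {poly E} => p`_i) f0).
  rewrite (bigD1_seq i.+1) //= Ec coef_pmono eqxx big1 ?addr0 => [->|k ki].
    by rewrite pm0.
  case: k ki (Df k) => [_ ->|k ki [d ->]]; first exact: coef0.
  by rewrite coef_pmono eq_sym -eqSS (negbTE ki).
Qed.

Let dZ n c x : plie_deg n x -> plie_deg n (c *: x).
Proof.
case: n => [->|n [d ->]]; first by rewrite scaler0.
by exists (c *: d); rewrite pmZ.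
Qed.
Let d0 x : plie_deg 0 x -> x = 0. Proof. by []. Qed.

Lemma plie_bracket_pmono (a b : E) n m :
  bracket (pmono a n : plie) (pmono b m : plie) = pmono (a * b - b * a) (n + m).+1.
Proof.
rewrite -[LHS]/(plie_bracket _ _) /plie_bracket /comm_palg !pmonoM [(m + n)%N]addnC -pmB.
by rewrite (_ : XE = pmono 1 1) ?pmonoM ?mulr1 ?addn1 // /pmono expr1 mul1r.
Qed.

Let db n m x y : plie_deg n x -> plie_deg m y -> plie_deg (n + m) (bracket x y).
Proof.
case: n m => [|n] [|m] /=.
- by move=> -> _; rewrite bracket0l.
- by move=> -> _; rewrite bracket0l; exists 0; rewrite pm0.
- by move=> _ ->; rewrite bracket0r; exists 0; rewrite pm0.
- by move=> [a ->] [b ->]; rewrite plie_bracket_pmono addnS; exists (a * b - b * a).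
Qed.
HB.instance Definition _ := LieAlgebra_isNGraded.Build F plie dg dZ d0 db.

Definition plie_eval (p : plie) : E := (p : {poly E}).[1].

Lemma plie_eval_linear : linear plie_eval.
Proof.
move=> c p q; rewrite /plie_eval hornerD; congr (_ + _).
by rewrite -[X in X.[1]]/(palg_scale c p) /palg_scale hornerZ mulr_algl.
Qed.

Lemma plie_eval_bracket p q :
  plie_eval (bracket p q) = plie_eval p * plie_eval q - plie_eval q * plie_eval p.
Proof.
have c1 (p' : {poly E}) : comm_poly p' 1 by rewrite /comm_poly mul1r mulr1.
rewrite /plie_eval -[bracket p q]/(plie_bracket p q).
rewrite -[X in X.[1]]/(((p : {poly E}) * q - (q : {poly E}) * p) * 'X).
by rewrite hornerMX mulr1 hornerD hornerN !hornerM_comm.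
Qed.

Lemma plie_eval_pmono a n : plie_eval (pmono a n) = a.
Proof.
rewrite /plie_eval -[X in X.[1]]/(a%:P * 'X^n) hornerCM hornerXn expr1n mulr1 //.
Qed.
End PolyLie.

(** * Generation in degree 1 *)

Section LieGeneration.
Variables (F : fieldType) (L : lieAlgType F).

Inductive lgen (X : L -> Prop) : L -> Prop :=
  | lgen0 : lgen X 0
  | lgenI x : X x -> lgen X x
  | lgenL c x y : lgen X x -> lgen X y -> lgen X (c *: x + y)
  | lgenB x y : lgen X x -> lgen X y -> lgen X (bracket x y).

Lemma lgen_subalgebra X : is_lie_subalgebra (lgen X).
Proof. by split; [exact: lgen0 | exact: lgenL | exact: lgenB]. Qed.

Lemma lgen_sub X S : is_lie_subalgebra S -> (forall x, X x -> S x) -> forall x, lgen X x -> S x.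
Proof. by move=> [S0 Sl Sb] XS x; elim=> //; auto. Qed.

End LieGeneration.

Section GradedGeneration.
Variables (F : fieldType) (L : gradedLieType F).

Lemma lgen_homogeneous (X : L -> Prop) : (forall x, X x -> ldeg 1 x) -> homogeneous (lgen X).
Proof.
move=> X1; apply: one_generated_homogeneous; first exact: lgen_subalgebra.
move=> T sT XT; apply: lgen_sub => // x Xx; apply: XT; first exact: X1.
exact: lgenI.
Qed.

(** Degrees are at least 1, so a bracket only has components of degree at least 2. *)
Lemma degree1_projection : exists pr : {linear L -> L},
  (forall x, ldeg 1 x -> pr x = x) /\ forall x y, pr (bracket x y) = 0.
Proof.
have [pr prE] := graded_linear_lift
  (fun k => if k == 1 then (idfun : {linear L -> L}) else (\0 : {linear L -> L})).
exists pr; split=> [x Dx|a b]; first by rewrite (prE _ _ Dx).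
move: a; apply: (graded_linear_eq (h := fun=> 0)) => [c u v|c u v|n a Da].
- by rewrite bracket_linearl linearP.
- by rewrite scaler0 addr0.
move: b; apply: (graded_linear_eq (h := fun=> 0)) => [c u v|c u v|m b Db].
- by rewrite bracket_linearr linearP.
- by rewrite scaler0 addr0.
case: n Da => [/ldeg0_eq0->|n Da]; first by rewrite bracket0l linear0.
case: m Db => [/ldeg0_eq0->|m Db]; first by rewrite bracket0r linear0.
by rewrite (prE _ _ (ldeg_bracket _ _ _ _ Da Db)) addnS.
Qed.

Lemma lgen_degree1 (X : L -> Prop) : (forall x, X x -> ldeg 1 x) ->
  forall x, lgen X x -> ldeg 1 x -> span X x.
Proof.
move=> X1 x Hx Dx; have [f [fE fb]] := degree1_projection.
rewrite -(fE x Dx).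
elim: Hx => [|y Xy|c y z _ Hy _ Hz|y z _ _ _ _].
- by rewrite raddf0; apply: span0.
- by rewrite (fE _ (X1 _ Xy)); apply: spanI.
- by rewrite linearP; apply: spanL.
- by rewrite fb; apply: span0.
Qed.

End GradedGeneration.

Section LieSub.
Variables (F : fieldType) (L : gradedLieType F) (S : gradedSubalgebra L).
Lemma gsub_val_linear : linear (@gsub_val F L S).
Proof. by []. Qed.
Definition gsub_incl : {linear gsub S -> L} := mklin gsub_val_linear.
Lemma gsub_incl_hom : graded_lie_hom gsub_incl.
Proof. by []. Qed.
Lemma gsub_incl_inj : injective gsub_incl.
Proof. exact: val_inj. Qed.
Lemma gsub_inclP x : S (gsub_incl x).
Proof. exact/asboolP/(valP x). Qed.
Lemma gsub_lift x : S x -> exists y, gsub_incl y = x.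
Proof. by move=> Sx; exists (Gsub (introT (gsub_memP _ _) Sx)). Qed.

Lemma gsub_corestrict (A : gradedLieType F) (f : {linear A -> L}) : graded_lie_hom f ->
  (forall x, S (f x)) ->
  exists2 g : {linear A -> gsub S}, graded_lie_hom g & forall x, gsub_incl (g x) = f x.
Proof.
move=> [fb fd] Sf; pose g x := Gsub (introT (gsub_memP _ _) (Sf x)).
have gl : linear g by move=> c x y; apply: val_inj; rewrite /= linearP.
exists (mklin gl) => //; split=> [x y|n x Dx]; last exact: fd.
by apply: val_inj; rewrite /= fb.
Qed.
End LieSub.

(** * Structure of the free product *)

Section FreeProduct.
Variables (F : fieldType) (A B P : gradedLieType F).
Variables (iA : {linear A -> P}) (iB : {linear B -> P}).
Hypothesis hP : is_free_product iA iB.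

Lemma free_product_sym : is_free_product iB iA.
Proof.
case: hP => hA hB H; split=> // C f g hf hg; have [h [hh hf' hg' U]] := H C g f hg hf.
by exists h; split=> // h' hh' E1 E2; apply: U.
Qed.

Let iAb x y : iA (bracket x y) = bracket (iA x) (iA y).
Proof. by case: hP => -[]. Qed.
Let iAd n x : ldeg n x -> ldeg n (iA x).
Proof. by case: hP => -[_ H] _ _; apply: H. Qed.
Let iBb x y : iB (bracket x y) = bracket (iB x) (iB y).
Proof. by case: hP => _ -[]. Qed.
Let iBd n x : ldeg n x -> ldeg n (iB x).
Proof. by case: hP => _ -[_ H] _; apply: H. Qed.

(** The universal property is applied to the identity of [A] and to the zero map of [B]. *)
Lemma free_product_proj : exists p : {linear P -> A},
  (forall a, p (iA a) = a) /\ (forall b, p (iB b) = 0).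
Proof.
case: hP => _ _ H; have [||h [_ h1 h2 _]] := H A idfun \0; first by [].
  split=> [x y|n x _]; first by rewrite bracket0l.
  exact: ldeg0.
by exists h; split=> [a|b]; [apply: h1 | apply: h2].
Qed.

Lemma free_product_injl : injective iA.
Proof. by have [p [p1 _]] := free_product_proj; apply: can_inj p1. Qed.

Lemma free_product_disjoint a b : iA a = iB b -> a = 0.
Proof. by have [p [p1 p2]] := free_product_proj => E; rewrite -(p1 a) E p2. Qed.

Hypotheses (A1 : one_generated A) (B1 : one_generated B).

Let X1 x := (exists2 a, ldeg 1 a & x = iA a) \/ (exists2 b, ldeg 1 b & x = iB b).

Let X1d x : X1 x -> ldeg 1 x.
Proof. by case=> [] [y Dy ->]; [apply: iAd|apply: iBd]. Qed.

(** The subalgebra generated by A_1 and B_1 contains the images of [A] and [B], so [P] maps to it.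
    Composed with the inclusion, this map is the identity, by uniqueness in the universal
    property. *)
Lemma free_product_gen x : lgen X1 x.
Proof.
pose S0 := GradedSubalgebra (lgen_subalgebra X1) (lgen_homogeneous X1d).
have SA a : S0 (iA a).
  apply: (A1 (S := fun a => lgen X1 (iA a))); last by move=> y Dy; apply: lgenI; left; exists y.
  split; first by rewrite raddf0; apply: lgen0.
    by move=> c y z Hy Hz; rewrite linearP; apply: lgenL.
  by move=> y z Hy Hz; rewrite iAb; apply: lgenB.
have SB b : S0 (iB b).
  apply: (B1 (S := fun b => lgen X1 (iB b))); last by move=> y Dy; apply: lgenI; right; exists y.
  split; first by rewrite raddf0; apply: lgen0.
    by move=> c y z Hy Hz; rewrite linearP; apply: lgenL.
  by move=> y z Hy Hz; rewrite iBb; apply: lgenB.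
case: hP => hA hB H.
have [f fh fE] := gsub_corestrict hA SA; have [g gh gE] := gsub_corestrict hB SB.
have [h [[hb hd] h1 h2 _]] := H _ f g fh gh.
have [k [_ _ _ U]] := H P iA iB hA hB.
have E1 : gsub_incl S0 \o h =1 k.
  apply: U.
  - by split=> [y z|n y Dy]; [rewrite /= hb | apply: hd].
  - by move=> a /=; rewrite -[RHS]fE; congr (gsub_incl S0 _); apply: h1.
  - by move=> b /=; rewrite -[RHS]gE; congr (gsub_incl S0 _); apply: h2.
have E2 : idfun =1 k by apply: U.
have -> : x = gsub_incl S0 (h x) by rewrite -[RHS]/((gsub_incl S0 \o h) x) E1 -E2.
exact: (gsub_inclP (S := S0)).
Qed.

Lemma free_product_one_generated : one_generated P.
Proof.
move=> S sS S1 x; apply: (lgen_sub sS) (free_product_gen x) => y /X1d; exact: S1.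
Qed.

Lemma free_product_ind (S : P -> Prop) : is_lie_subalgebra S ->
  (forall a, S (iA a)) -> (forall b, S (iB b)) -> forall x, S x.
Proof.
move=> sS SA SB x; apply: (lgen_sub sS) (free_product_gen x) => y [] [z _ ->].
  exact: SA.
exact: SB.
Qed.

Lemma free_product_degree1 x : ldeg 1 x ->
  exists a b, [/\ ldeg 1 a, ldeg 1 b & x = iA a + iB b].
Proof.
move=> Dx; elim: {Dx}(lgen_degree1 X1d (free_product_gen x) Dx).
- exists 0, 0; rewrite !raddf0 addr0; split=> //; exact: ldeg0.
- move=> y [] [z Dz ->]; [exists z, 0 | exists 0, z]; rewrite raddf0 ?addr0 ?add0r.
    by split=> //; apply: ldeg0.
  by split=> //; apply: ldeg0.
- move=> c y z _ [a [b [Da Db ->]]] _ [a' [b' [Da' Db' ->]]].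
  exists (c *: a + a'), (c *: b + b'); rewrite !linearP scalerDr addrACA.
  by split=> //; apply: ldegD => //; apply: ldegZ.
Qed.

(* The universal property only speaks of graded Lie algebras; we apply it to   *)
(* t E[t] and then evaluate at t = 1.                                          *)
Lemma free_product_rep (E : algType F) (f : A -> E) (g : B -> E) :
  is_lie_rep f -> is_lie_rep g ->
  exists h : P -> E, [/\ is_lie_rep h, h \o iA =1 f & h \o iB =1 g].
Proof.
have lift (C : gradedLieType F) (k : C -> E) : is_lie_rep k -> exists2 k' : {linear C -> plie E},
    graded_lie_hom k' & forall x, plie_eval (k' x) = k x.
  move=> [kl kb].
  have [k' kE] := graded_linear_lift (fun n => (pmonoL E n.-1 \o mklin kl : {linear C -> plie E})).
  have kP n x : ldeg n x -> k' x = pmono (k x) n.-1 by move=> /kE->.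
  exists k'; last first.
    apply: graded_linear_eq => [c x y|//|n x Dx]; last by rewrite (kP _ _ Dx) plie_eval_pmono.
    by rewrite linearP plie_eval_linear.
  split=> [x y|n x Dx]; last first.
    case: n Dx => [/ldeg0_eq0->|n Dx]; first by rewrite raddf0.
    by rewrite (kP _ _ Dx); exists (k x).
  move: x; apply: graded_linear_eq => [c u v|c u v|n x Dx].
  - by rewrite bracket_linearl linearP.
  - by rewrite linearP bracket_linearl.
  move: y; apply: graded_linear_eq => [c u v|c u v|m y Dy].
  - by rewrite bracket_linearr linearP.
  - by rewrite linearP bracket_linearr.
  case: n Dx => [/ldeg0_eq0->|n Dx]; first by rewrite bracket0l raddf0 bracket0l.
  case: m Dy => [/ldeg0_eq0->|m Dy]; first by rewrite bracket0r raddf0 bracket0r.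
  rewrite (kP _ _ (ldeg_bracket _ _ _ _ Dx Dy)) (kP _ _ Dx) (kP _ _ Dy).
  by rewrite plie_bracket_pmono kb addnS.
move=> /lift[f' hf fE] /lift[g' hg gE].
case: hP => _ _ H; have [h [[hb _] h1 h2 _]] := H (plie E) f' g' hf hg.
exists (fun x => plie_eval (h x)); split.
- split=> [c x y|x y]; first by rewrite linearP plie_eval_linear.
  by rewrite hb plie_eval_bracket.
- by move=> a /=; rewrite -fE; congr plie_eval; apply: h1.
- by move=> b /=; rewrite -gE; congr plie_eval; apply: h2.
Qed.

(* The first Fox derivative, relative to the augmentation: U(P)_+ is the direct *)
(* sum of the left ideals generated by A and by B.                             *)
Lemma fox_derivative : exists D : {linear uenv P -> uenv P},
  (forall r a, D (r * uiota (iA a)) = r * uiota (iA a)) /\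
  (forall r b, D (r * uiota (iB b)) = 0).
Proof.
(* [P] is made to act on U(P) + F: both factors act on U(P) by left multiplication, while the
   generator (0, 1) is sent by a in [A] to (a, 0) and by [B] to 0. *)
pose V := (uenv P * F^o)%type.
pose rA (a : A) (v : V) : V := (uiota (iA a) * v.1 + (v.2 : F) *: uiota (iA a), 0).
pose rB (b : B) (v : V) : V := (uiota (iB b) * v.1, 0).
have rAl v : linear (rA^~ v).
  move=> c x y; apply: injective_projections; rewrite /= ?scaler0 ?addr0 //.
  have -> : uiota (iA (c *: x + y)) = c *: uiota (iA x) + uiota (iA y) by rewrite !linearP.
  rewrite mulrDl -scalerAl [in LHS]scalerDr addrACA; congr (_ + _).
  by rewrite [RHS]scalerDr !scalerA; congr (_ + _ *: _); apply: mulrC.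
have rAr a : linear (rA a).
  move=> c x y; apply: injective_projections; rewrite /= ?scaler0 ?addr0 //.
  rewrite mulrDr scalerDl -scalerAr scalerDr scalerA; exact: addrACA.
have rBl v : linear (rB^~ v).
  move=> c x y; apply: injective_projections; rewrite /= ?scaler0 ?addr0 //.
  by rewrite !linearP mulrDl -scalerAl.
have rBr b : linear (rB b).
  move=> c x y; apply: injective_projections; rewrite /= ?scaler0 ?addr0 //.
  by rewrite mulrDr -scalerAr.
have repA : is_lie_rep (lend_of rAr).
  split=> [|x y]; first exact: (lend_of_linear rAl rAr).
  apply: lend_ext => p /=; apply: injective_projections => /=; last by rewrite scaler0 addr0.
  apply: injective_projections => /=; last by rewrite scaler0 addr0.
  rewrite !scale0r !addr0 iAb uiota_bracket !mulrDr mulrBl -!scalerAr scaleN1r !opprD.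
  by rewrite scalerBr !mulrA addrACA.
have repB : is_lie_rep (lend_of rBr).
  split=> [|x y]; first exact: (lend_of_linear rBl rBr).
  apply: lend_ext => p /=; apply: injective_projections => /=; last by rewrite scaler0 addr0.
  apply: injective_projections => /=; last by rewrite scaler0 addr0.
  by rewrite iBb uiota_bracket mulrBl scaleN1r !mulrA.
have [h [hrep hA hB]] := free_product_rep repA repB.
have [hl hb] := hrep.
have pairE (p q : (V * F^o)%type) : p.1.1 = q.1.1 -> p.1.2 = q.1.2 -> p.2 = q.2 -> p = q.
  by case: p q => [[p1 p2] p3] [[q1 q2] q3] /= -> -> ->.
have hx x : forall s, h x ((s, 0), 0) = ((uiota x * s, 0), 0).
  move: x; apply: (free_product_ind (S := fun x => forall s, h x ((s, 0), 0) = ((uiota x * s, 0), 0))).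
  - split=> [s|c x y Hx Hy s|x y Hx Hy s].
    + have -> : h 0 = 0 := raddf0 (mklin hl).
      by apply: pairE; rewrite /= ?raddf0 ?mul0r.
    + rewrite hl; apply: pairE; rewrite /= Hx Hy /= ?scaler0 ?addr0 //.
      by rewrite linearP mulrDl -scalerAl.
    + rewrite hb; apply: pairE; rewrite /= Hx Hy Hx Hy /= ?scaler0 ?addr0 //.
      by rewrite uiota_bracket mulrBl scaleN1r !mulrA.
  - by move=> a s; rewrite -[h _]/((h \o iA) a) hA /= /rA /= scale0r addr0.
  - by move=> b s; rewrite -[h _]/((h \o iB) b) hB.
pose Phi := uenv_lift h.
have PhiE u s : Phi u ((s, 0), 0) = ((u * s, 0), 0).
  elim/uenv_ind: u => [|x u IH|c u v Hu Hv].
  - by rewrite /Phi (uenv_lift1 hrep) mul1r.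
  - by rewrite /Phi (uenv_liftM hrep) uenv_lift_iota //= IH hx mulrA.
  - rewrite /Phi (uenv_lift_linear hrep) /= Hu Hv mulrDl -scalerAl.
    by apply: injective_projections => /=; rewrite ?scaler0 ?addr0 //;
       apply: injective_projections => /=; rewrite ?scaler0 ?addr0.
(* The derivative of [u] is the U(P)-component of [u] acting on (0, 1). The last 0 is the coordinate
   in the extra summand of [lend]. *)
have Dl : linear (fun u => (Phi u ((0, 1), 0)).1.1).
  by move=> c u v; rewrite /Phi (uenv_lift_linear hrep).
exists (mklin Dl); split=> [r a|r b]; rewrite mklinE /Phi (uenv_liftM hrep) uenv_lift_iota //=.
  rewrite -[h _]/((h \o iA) a) hA /= /rA /= mulr0 add0r scale1r.
  by rewrite -/(Phi r) PhiE.
rewrite -[h _]/((h \o iB) b) hB /= /rB /= mulr0.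
by rewrite -/(Phi r) PhiE mulr0.
Qed.

End FreeProduct.

(** * Graded modules and resolutions *)

Section GradingComponent.
Variables (I : eqType) (V : zmodType) (D : I -> V -> Prop).
Hypothesis gD : is_grading D.

Lemma grading_comp (k : I) : exists c : V -> V,
  [/\ forall x y, c (x - y) = c x - c y, forall x, D k x -> c x = x,
      forall i x, i != k -> D i x -> c x = 0 & forall x, D k (c x)].
Proof.
have [|c cB cE] := grading_lift gD (N := V) (phi := fun i x => if i == k then x else 0).
  by move=> i x y _ _; case: eqP => _; rewrite ?subr0.
have c0 : c 0 = 0 by rewrite -{1}(subrr 0) cB subrr.
have cD x y : c (x + y) = c x + c y.
  by rewrite -{1}[y]opprK cB -[- y]sub0r cB c0 sub0r opprK.
have Dk0 : D k 0 by case: gD => H _ _; case: (H k).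
exists c; split=> // [x Dx|i x ik Dx|x].
- by rewrite (cE _ _ Dx) eqxx.
- by rewrite (cE _ _ Dx) (negbTE ik).
- have [_ H _] := gD; have [s Hs ->] := H x.
  elim: s Hs => [|y s IH] Hs; first by rewrite big_nil c0.
  rewrite big_cons cD; apply: (gradingD gD).
    have [|i Dy] := Hs y; first by rewrite inE eqxx.
    by rewrite (cE _ _ Dy); case: eqP Dy => [->|].
  by apply: IH => z sz; apply: Hs; rewrite inE sz orbT.
Qed.

End GradingComponent.

Section GradedModuleTheory.
Variables (U : nzRingType) (G : nat -> U -> Prop).
Hypothesis HG : is_grading G.
Hypothesis G1 : G 0 1.
Hypothesis GM : forall n m u v, G n u -> G m v -> G (n + m) (u * v).

Notation gmod := (gradedModule G).

Let G0 n : G n 0. Proof. by case: HG => H _ _; case: (H n). Qed.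

(** The grading of the ring, extended by 0 to negative degrees: a coefficient of a homogeneous
    element of a free module has the degree [k - delta x], which can be negative. *)
Definition Gz (k : int) (u : U) : Prop := if k is Posz n then G n u else u = 0.

Lemma Gz0 k : Gz k 0. Proof. by case: k => //= n; apply: G0. Qed.

Lemma GzB k u v : Gz k u -> Gz k v -> Gz k (u - v).
Proof.
case: k => [n|n] /=; last by move=> -> ->; rewrite subr0.
by case: HG => H _ _; apply: (H n).2.
Qed.

Lemma GzM n k u v : G n u -> Gz k v -> Gz (n%:Z + k) (u * v).
Proof.
case: k => [m|m] /= Du; first by move=> Dv; apply: GM.
by move=> ->; rewrite mulr0; apply: Gz0.
Qed.

Lemma Gz_proj (k : int) : exists q : U -> U, [/\ forall x y, q (x - y) = q x - q y,
  forall x, Gz k x -> q x = x & forall i x, i != k -> Gz i x -> q x = 0].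
Proof.
case: k => [n|n].
  have [c [cB c1 c2 _]] := grading_comp HG n; exists c; split=> // -[m|m] x /=.
    by move=> mn; apply: c2.
  by move=> _ ->; rewrite -{1}(subrr 0) cB subrr.
exists (fun=> 0); split=> // x y; by rewrite subr0.
Qed.

Section FreeModule.
Variables (K : choiceType) (delta : K -> int).
Notation E := {malg U[K]}.

Definition free_deg (k : int) (f : E) : Prop := forall x, Gz (k - delta x) (f@_x).

Lemma free_deg0 k : free_deg k 0.
Proof. by move=> x; rewrite mcoeff0; apply: Gz0. Qed.

Lemma free_degU k x u : Gz (k - delta x) u -> free_deg k << u *g x >>.
Proof.
move=> Du y; rewrite mcoeffU; case: eqP => [<-|_] //.
by rewrite mulr0n; apply: Gz0.
Qed.

Lemma free_grading : is_grading free_deg.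
Proof.
split=> [k|f|s f us Df f0 i si].
- split=> [|f g Df Dg x]; first exact: free_deg0.
  by rewrite mcoeffB; apply: GzB.
- have HD (g h : E) : (exists2 s : seq E, (forall x, x \in s -> exists i, free_deg i x) & g = \sum_(x <- s) x) ->
     (exists2 s : seq E, (forall x, x \in s -> exists i, free_deg i x) & h = \sum_(x <- s) x) ->
     exists2 s : seq E, (forall x, x \in s -> exists i, free_deg i x) & g + h = \sum_(x <- s) x.
    move=> [s Hs ->] [t Ht ->]; exists (s ++ t); last by rewrite big_cat.
    by move=> x; rewrite mem_cat => /orP[/Hs|/Ht].
  rewrite [f]monalgE; elim/big_rec: _ => [|x g _ IH].
    by exists [::] => //; rewrite big_nil.
  apply: HD => //; have [_ H _] := HG; have [t Ht ->] := H (f@_x).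
  exists [seq << u *g x >> | u <- t]; last by rewrite raddf_sum big_map.
  move=> _ /mapP[u /Ht[n Du] ->]; exists (n%:Z + delta x); apply: free_degU.
  by rewrite addrK.
- apply/malgP => x; rewrite mcoeff0.
  have [q [qB q1 q2]] := Gz_proj (i - delta x).
  have q0 : q 0 = 0 by rewrite -{1}(subrr 0) qB subrr.
  have qD u v : q (u + v) = q u + q v.
    by rewrite -{1}[v]opprK qB -[- v]sub0r qB q0 sub0r opprK.
  have : q ((\sum_(j <- s) f j)@_x) = 0 by rewrite f0 mcoeff0.
  rewrite raddf_sum (big_morph q qD q0) (bigD1_seq i) //= (q1 _ (Df i x)).
  rewrite big1 ?addr0 // => j ji; apply: (q2 (j - delta x)); last exact: Df.
  by apply: contra ji => /eqP/addIr->.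
Qed.

Lemma free_scale n k u f : G n u -> free_deg k f -> free_deg (n%:Z + k) (u *: f).
Proof.
move=> Du Df x; rewrite mcoeffZ -addrA; exact: GzM.
Qed.

Definition free_module : gmod := GradedModule free_grading free_scale.

Lemma free_basis_deg x : mdeg (delta x) (<< x >> : free_module).
Proof. by apply: free_degU; rewrite subrr. Qed.

Lemma free_span (f : E) : span (fun g => exists x, g = << x >>) f.
Proof.
rewrite [f]monalgE; apply: span_sum => x _.
have -> : << f@_x *g x >> = f@_x *: << x >>.
  by apply/malgP => y; rewrite mcoeffZ !mcoeffU; case: eqP; rewrite ?mulr1 ?mulr0.
by apply/spanZ/spanI; exists x.
Qed.

Lemma free_lift (N : lmodType U) (h : K -> N) : exists f : {linear E -> N}, forall x, f << x >> = h x.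
Proof.
pose f (g : E) := \sum_(x <- msupp g) g@_x *: h x.
have fE (s : {fset K}) g : {subset msupp g <= s} -> f g = \sum_(x <- s) g@_x *: h x.
  move=> gs; rewrite (bigID [in msupp g]) /= [X in _ + X]big1 ?addr0; last first.
    by move=> x /mcoeff_outdom->; rewrite scale0r.
  rewrite -big_filter; apply: perm_big; apply: uniq_perm; rewrite ?filter_uniq ?fset_uniq //.
  by move=> x; rewrite mem_filter; case: (boolP (x \in msupp g)) => //= /gs ->.
have fl : linear f.
  move=> c g1 g2; pose s := (msupp g1 `|` msupp g2 `|` msupp (c *: g1 + g2))%fset.
  rewrite !(fE s) => [|x|x|x]; rewrite /s ?inE.
  - rewrite scaler_sumr -big_split; apply: eq_bigr => x _ /=.
    by rewrite mcoeffD mcoeffZ scalerDl scalerA.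
  - by move=> ->; rewrite ?orbT.
  - by move=> ->; rewrite ?orbT.
  - by move=> ->; rewrite ?orbT.
exists (mklin fl) => x; rewrite mklinE (fE [fset x]%fset).
  by rewrite big_seq_fset1 mcoeffUU scale1r.
by move=> y; rewrite inE -mcoeff_neq0 mcoeffU; case: (x =P y) => [->//|_]; rewrite mulr0n eqxx.
Qed.
End FreeModule.

Lemma mdeg_is_grading (M : gmod) : is_grading (@mdeg U G M).
Proof. exact: mdeg_grading. Qed.

Lemma mdeg0 (M : gmod) k : mdeg k (0 : M).
Proof. by have [H _ _] := mdeg_is_grading M; case: (H k). Qed.
Lemma mdegB (M : gmod) k (x y : M) : mdeg k x -> mdeg k y -> mdeg k (x - y).
Proof. by have [H _ _] := mdeg_is_grading M; apply: (H k).2. Qed.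
Lemma mdegD (M : gmod) k (x y : M) : mdeg k x -> mdeg k y -> mdeg k (x + y).
Proof. exact: (gradingD (mdeg_is_grading M)). Qed.
Lemma mdegN (M : gmod) k (x : M) : mdeg k x -> mdeg k (- x).
Proof. by move=> Dx; rewrite -sub0r; apply: mdegB => //; apply: mdeg0. Qed.
Lemma mdeg_sum (M : gmod) k (I : Type) (r : seq I) (P : pred I) (f : I -> M) :
  (forall i, P i -> mdeg k (f i)) -> mdeg k (\sum_(i <- r | P i) f i).
Proof. by move=> H; elim/big_rec: _ => [|i x /H]; [apply: mdeg0 | apply: mdegD]. Qed.
Lemma mdeg_scaleZ (M : gmod) l k u (x : M) : Gz l u -> mdeg k x -> mdeg (l + k) (u *: x).
Proof. by case: l => [n|n] /=; [apply: mdeg_scale | move=> -> _; rewrite scale0r; apply: mdeg0]. Qed.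

Definition hom0 (M N : gmod) (f : M -> N) := forall k x, mdeg k x -> mdeg k (f x).

Lemma in_hom0P (M N : gmod) (f : {linear M -> N}) : in_hom 0 f <-> hom0 f.
Proof. by split=> H k x /H; rewrite subr0. Qed.

(** A map of degree 0 commutes with the projections on the components of degree [k]; the witness is
    the component of [p]. *)
Lemma hom0_lift (M N : gmod) (g : {linear M -> N}) k p : hom0 g -> mdeg k (g p) ->
  exists2 p', mdeg k p' & g p' = g p.
Proof.
move=> hg Dg; have [c [cB c1 c2 cD]] := grading_comp (mdeg_is_grading M) k.
have [d [dB d1 d2 _]] := grading_comp (mdeg_is_grading N) k.
exists (c p); first exact: cD.
rewrite -[RHS]d1 //; apply: (grading_ext (mdeg_is_grading M) (g := g \o c) (h := d \o g)).
- by move=> x y /=; rewrite cB raddfB.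
- by move=> x y /=; rewrite raddfB dB.
- move=> i x Dx /=; have [Ei|ik] := eqVneq i k.
    by rewrite Ei in Dx; rewrite c1 // d1 //; apply: hg.
  by rewrite (c2 i) // (d2 i) ?raddf0 //; apply: hg.
Qed.

Lemma factor_surj (P X T : lmodType U) (g : {linear P -> X}) (f : {linear P -> T}) :
  (forall x, exists p, g p = x) -> (forall p, g p = 0 -> f p = 0) ->
  exists f' : {linear X -> T}, forall p, f' (g p) = f p.
Proof.
move=> gs gf; have [s sE] : {s : X -> P | forall x, g (s x) = x}.
  by exists (fun x => sval (cid (gs x))) => x; apply: (svalP (cid (gs x))).
have H p q : g p = g q -> f p = f q.
  by move=> E; apply: subr0_eq; rewrite -linearB; apply: gf; rewrite linearB E subrr.
have fl : linear (fun x => f (s x)).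
  by move=> c x y; rewrite -(linearP f); apply: H; rewrite (linearP g) !sE.
by exists (mklin fl) => p; rewrite mklinE; apply: H; rewrite sE.
Qed.

Lemma factor_inj (N Q X : lmodType U) (i : {linear N -> Q}) (f : {linear X -> Q}) :
  injective i -> (forall x, exists n, i n = f x) ->
  exists f' : {linear X -> N}, forall x, i (f' x) = f x.
Proof.
move=> ii fi; pose s x := sval (cid (fi x)).
have sE x : i (s x) = f x by apply: (svalP (cid (fi x))).
have sl : linear s by move=> c x y; apply: ii; rewrite (linearP i) !sE (linearP f).
by exists (mklin sl) => x; rewrite mklinE sE.
Qed.

Lemma hom0_factor_inj (N Q X : gmod) (i : {linear N -> Q}) (f' : {linear X -> N}) (f : X -> Q) :
  injective i -> hom0 i -> hom0 f -> (forall x, i (f' x) = f x) -> hom0 f'.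
Proof.
move=> ii hi hf E k x Dx; have [|n Dn /ii<- //] := @hom0_lift N Q i k (f' x) hi.
by rewrite E; apply: hf.
Qed.

Section GradedSubmodule.
Variables (M : gmod) (W : submodule M).
Hypothesis hW : forall x : M, W x -> exists2 s : seq M,
    (forall y, y \in s -> W y /\ exists k, mdeg k y) & x = \sum_(y <- s) y.

Definition sub_deg (k : int) (x : subm W) : Prop := mdeg k (subm_val x).

Lemma sub_grading : is_grading sub_deg.
Proof.
have [D0 _ Dind] := mdeg_is_grading M.
split=> [i | v | s f us Df f0 i si].
- by have [Di0 DiB] := D0 i; split=> [//|x y]; apply: DiB.
- have [s Hs Ev] := hW (subm_valP v).
  have vK x : x \in s -> subm_val (insubd (0 : subm W) x) = x.
    by move=> /Hs[Wx _]; rewrite insubdK //; apply/asboolP.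
  exists (map (insubd 0) s) => [_ /mapP[x sx ->]|].
    by have [_ [n Dx]] := Hs x sx; exists n; rewrite /sub_deg vK.
  apply: subm_inj; rewrite Ev raddf_sum big_map big_seq [RHS]big_seq.
  by apply: eq_bigr => x /vK.
- apply: subm_inj; apply: (Dind s (fun i => subm_val (f i))) => //.
  by rewrite -raddf_sum f0 raddf0.
Qed.

Lemma sub_scale n k u (x : subm W) : G n u -> sub_deg k x -> sub_deg (n%:Z + k) (u *: x).
Proof. by move=> Du Dx; rewrite /sub_deg linearZ_LR; apply: mdeg_scale. Qed.

Definition graded_sub : gmod := GradedModule sub_grading sub_scale.
Definition sub_incl : {linear graded_sub -> M} := @subm_val U M W.
Lemma sub_incl_inj : injective sub_incl. Proof. exact: subm_inj. Qed.
Lemma sub_incl_hom0 : hom0 sub_incl. Proof. by []. Qed.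
Lemma sub_inclP x : W (sub_incl x). Proof. exact: subm_valP. Qed.
Lemma sub_lift x : W x -> exists y, sub_incl y = x.
Proof. by move=> Wx; exists (mksubm Wx). Qed.
End GradedSubmodule.

Section KerIm.
Variables (M N : gmod) (g : {linear M -> N}).
Hypothesis hg : hom0 g.

Lemma ker_subspace : subspace (fun x => g x = 0).
Proof. by split=> [|c x y Hx Hy]; rewrite ?raddf0 // linearP Hx Hy scaler0 addr0. Qed.
Definition ker_sub := Submodule ker_subspace.

Lemma ker_hom x : ker_sub x -> exists2 s : seq M,
    (forall y, y \in s -> ker_sub y /\ exists k, mdeg k y) & x = \sum_(y <- s) y.
Proof.
move=> /= gx; have [s [f [us Df Ex]]] := grading_decomp (mdeg_is_grading M) x.
exists [seq f i | i <- s]; last by rewrite big_map.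
move=> _ /mapP[i si ->]; split; last by exists i; apply: Df.
have [_ _ H] := mdeg_is_grading N; apply: (H s (fun i => g (f i)) us) => //.
  by move=> j; apply: hg.
by rewrite -raddf_sum -Ex.
Qed.

Definition kernel := graded_sub ker_hom.
Definition ker_incl : {linear kernel -> M} := sub_incl ker_hom.

Lemma im_subspace : subspace (fun y => exists x, g x = y).
Proof.
split=> [|c _ _ [x <-] [y <-]]; first by exists 0; rewrite raddf0.
by exists (c *: x + y); rewrite linearP.
Qed.
Definition im_sub := Submodule im_subspace.

Lemma im_hom y : im_sub y -> exists2 s : seq N,
    (forall y, y \in s -> im_sub y /\ exists k, mdeg k y) & y = \sum_(y <- s) y.
Proof.
move=> [x <-]; have [s [f [us Df ->]]] := grading_decomp (mdeg_is_grading M) x.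
exists [seq g (f i) | i <- s]; last by rewrite big_map raddf_sum.
move=> _ /mapP[i si ->]; split; first by exists (f i).
by exists i; apply: hg.
Qed.

Definition image := graded_sub im_hom.
Definition im_incl : {linear image -> N} := sub_incl im_hom.

Lemma im_corestrict : exists2 g' : {linear M -> image}, hom0 g' &
  (forall x, im_incl (g' x) = g x) /\ (forall y, exists x, g' x = y).
Proof.
have [|g' E] := factor_inj (i := im_incl) (f := g) (@sub_incl_inj _ _ im_hom).
  by move=> x; apply: (sub_lift im_hom); exists x.
exists g'; first exact: (hom0_factor_inj (@sub_incl_inj _ _ im_hom) (@sub_incl_hom0 _ _ im_hom) hg E).
split=> // y; have [x Ex] := sub_inclP y; exists x; apply: (@sub_incl_inj _ _ im_hom).
by rewrite -Ex; apply: E.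
Qed.
End KerIm.

(** Projectivity is used over the image of [g], in which [f] takes its values. *)
Lemma projective_lift (P X Y : gmod) (f : {linear P -> Y}) (g : {linear X -> Y}) :
  graded_projective P -> hom0 f -> hom0 g -> (forall p, exists x, g x = f p) ->
  exists2 h : {linear P -> X}, hom0 h & forall p, g (h p) = f p.
Proof.
move=> pP hf hg H; have [g' hg' [gE gs]] := im_corestrict hg.
have [f' fE] := factor_inj (i := im_incl hg) (f := f) (@sub_incl_inj _ _ (im_hom hg))
  (fun p => sub_lift (im_hom hg) (H p)).
have hf' := hom0_factor_inj (@sub_incl_inj _ _ (im_hom hg)) (@sub_incl_hom0 _ _ (im_hom hg)) hf fE.
have [h /in_hom0P hh hE] := pP X (image hg) g' f' ((in_hom0P _).2 hg') ((in_hom0P _).2 hf') gs.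
by exists h => // p; rewrite -gE -fE; congr (im_incl hg _); apply: hE.
Qed.

Lemma in_hom_comp0 (M N T : gmod) j (f : {linear N -> T}) (g : {linear M -> N}) :
  in_hom j f -> hom0 g -> in_hom j (f \o g : {linear M -> T}).
Proof. by move=> hf hg k x /hg /hf. Qed.

Lemma hom0_comp (M N T : gmod) (f : {linear N -> T}) (g : {linear M -> N}) :
  hom0 f -> hom0 g -> hom0 (f \o g).
Proof. by move=> hf hg k x /hg /hf. Qed.

Lemma free_hom (K : choiceType) (delta : K -> int) (N : gmod) d (f : {linear free_module delta -> N}) :
  (forall x, mdeg (delta x - d) (f << x >>)) -> in_hom d f.
Proof.
move=> H k g Dg; rewrite [g](monalgE g) linear_sum; apply: mdeg_sum => x _.
have -> : << g@_x *g x >> = g@_x *: << x >> :> {malg U[K]}.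
  by apply/malgP => y; rewrite mcoeffZ !mcoeffU; case: eqP; rewrite ?mulr1 ?mulr0.
rewrite linearZ_LR; have -> : k - d = (k - delta x) + (delta x - d) by rewrite addrA subrK.
by apply: mdeg_scaleZ => //; apply: Dg.
Qed.

Lemma free_projective (K : choiceType) (delta : K -> int) : graded_projective (free_module delta).
Proof.
move=> M N g f /in_hom0P hg /in_hom0P hf gs.
have yex (x : K) : exists y : M, mdeg (delta x) y /\ g y = f << x >>.
  have [z gz] := gs (f << x >>).
  have Dz : mdeg (delta x) (g z) by rewrite gz; apply/hf/free_basis_deg.
  by have [z' Dz' gz'] := hom0_lift hg Dz; exists z'; rewrite gz'.
have [y yP] := boolp.choice yex.
have [h hE] := free_lift y.
exists (h : {linear free_module delta -> M}).
  by apply: free_hom => x; rewrite subr0 hE; apply: (yP x).1.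
move=> p /=; apply: (linear_eq_span (g := (g \o h : {linear _ -> _})) (h := f) _ (free_span p)).
by move=> _ [x ->] /=; rewrite hE; case: (yP x).
Qed.

Section DirectSum.
Variables (M N : gmod).
Definition dsum_deg (k : int) (p : (M * N)%type) := mdeg k p.1 /\ mdeg k p.2.

Lemma dsum_grading : is_grading dsum_deg.
Proof.
split=> [k|[x y]|s f us Df f0 i si].
- split=> [|x y [Dx Dx'] [Dy Dy']]; split; (exact: mdeg0 || exact: mdegB).
- have [_ HM _] := mdeg_is_grading M; have [_ HN _] := mdeg_is_grading N.
  have [s Hs ->] := HM x; have [t Ht ->] := HN y.
  exists ([seq (x, 0) | x <- s] ++ [seq (0, y) | y <- t]).
    move=> z; rewrite mem_cat => /orP[/mapP[x' /Hs[k Dk] ->]|/mapP[y' /Ht[k Dk] ->]];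
      by exists k; split=> //; apply: mdeg0.
  rewrite big_cat !big_map /=; apply: injective_projections; rewrite /= !raddf_sum /=.
    by rewrite [X in _ + X]big1 ?addr0.
  by rewrite [X in X + _]big1 ?add0r.
- have [_ _ HM] := mdeg_is_grading M; have [_ _ HN] := mdeg_is_grading N.
  apply: injective_projections.
    apply: (HM s (fun i => (f i).1)) => // [j|]; first by case: (Df j).
    by rewrite -(raddf_sum fst) f0.
  apply: (HN s (fun i => (f i).2)) => // [j|]; first by case: (Df j).
  by rewrite -(raddf_sum snd) f0.
Qed.

Lemma dsum_scale n k u p : G n u -> dsum_deg k p -> dsum_deg (n%:Z + k) (u *: p).
Proof. by move=> Du [D1 D2]; split; apply: mdeg_scale. Qed.

Definition dsum : gmod := GradedModule dsum_grading dsum_scale.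

Definition inl_fun (x : M) : dsum := (x, 0).
Definition inr_fun (x : N) : dsum := (0, x).
Lemma inl_linear : linear inl_fun.
Proof. by move=> c x y; apply: injective_projections; rewrite /= ?scaler0 ?addr0. Qed.
Lemma inr_linear : linear inr_fun.
Proof. by move=> c x y; apply: injective_projections; rewrite /= ?scaler0 ?addr0. Qed.
Definition dinl : {linear M -> dsum} := mklin inl_linear.
Definition dinr : {linear N -> dsum} := mklin inr_linear.
Lemma dinl_hom0 : hom0 dinl. Proof. by move=> k x Dx; split=> //; apply: mdeg0. Qed.
Lemma dinr_hom0 : hom0 dinr. Proof. by move=> k x Dx; split=> //; apply: mdeg0. Qed.

Section Copair.
Variables (T : gmod) (f : {linear M -> T}) (g : {linear N -> T}).
Lemma copair_linear : linear (fun p : dsum => f p.1 + g p.2).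
Proof. by move=> c x y; rewrite !linearP scalerDr addrACA. Qed.
Definition copair : {linear dsum -> T} := mklin copair_linear.
Lemma copair_hom0 : hom0 f -> hom0 g -> hom0 copair.
Proof. by move=> hf hg k x [D1 D2]; apply: mdegD; [apply: hf|apply: hg]. Qed.
End Copair.

Lemma dsum_projective : graded_projective M -> graded_projective N -> graded_projective dsum.
Proof.
move=> pM pN X Y g f hg /in_hom0P hf gs.
have [h1 /in_hom0P hh1 E1] := pM X Y g (f \o dinl : {linear M -> Y}) hg
  ((in_hom0P _).2 (hom0_comp hf dinl_hom0)) gs.
have [h2 /in_hom0P hh2 E2] := pN X Y g (f \o dinr : {linear N -> Y}) hg
  ((in_hom0P _).2 (hom0_comp hf dinr_hom0)) gs.
exists (copair h1 h2); first exact/in_hom0P/copair_hom0.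
move=> [x y] /=; rewrite -[copair _ _ _]/(h1 x + h2 y) linearD.
have -> : g (h1 x) = f (dinl x) := E1 x; have -> : g (h2 y) = f (dinr y) := E2 y.
rewrite -linearD; congr (f _).
by apply: injective_projections; rewrite /= ?addr0 ?add0r.
Qed.

End DirectSum.

(** The cover is the free module with one generator for each homogeneous element and each of its
    degrees. *)
Lemma exists_cover (N : gmod) : exists P : gmod, graded_projective P /\
  exists2 g : {linear P -> N}, hom0 g & forall y, exists x, g x = y.
Proof.
pose K := {x : int * N | `[< mdeg x.1 x.2 >]}.
pose delta (x : K) := (sval x).1.
exists (free_module delta); split; first exact: free_projective.
have [f fE] := free_lift (fun x : K => (sval x).2).
exists (f : {linear free_module delta -> N}).
  apply/in_hom0P/free_hom => x; rewrite subr0 fE; exact/asboolP/(svalP x).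
move=> y; have [_ H _] := mdeg_is_grading N; have [s Hs ->] := H y.
elim: s Hs => [|x s IH] Hs; first by exists 0; rewrite big_nil linear0.
have [|z Ez] := IH; first by move=> w sw; apply: Hs; rewrite inE sw orbT.
have [|k Dk] := Hs x; first by rewrite inE eqxx.
pose kx : K := exist _ (k, x) (introT (asboolP _) Dk).
by exists (<< kx >> + z); rewrite linearD Ez big_cons fE.
Qed.

(** * Projective resolutions: splicing, existence, truncation *)

Section Splice.
Variables (N P0 K : gmod) (g : {linear P0 -> N}) (i : {linear K -> P0}).
Hypotheses (pP0 : graded_projective P0) (hg : hom0 g) (gs : forall y, exists x, g x = y).
Hypotheses (hi : hom0 i) (ii : injective i) (ik : forall x, g x = 0 <-> exists y, i y = x).
Variable R : projResolution K.

Definition splice_mod n : gmod := if n is n'.+1 then R n' else P0.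
Definition splice_d n : {linear splice_mod n.+1 -> splice_mod n} :=
  if n is n'.+1 then res_d R n' else (i \o res_aug R : {linear R 0%N -> P0}).

Lemma splice_proj n : graded_projective (splice_mod n).
Proof. by case: n => //= n; apply: res_proj. Qed.
Lemma splice_d_hom n : in_hom 0 (splice_d n).
Proof.
case: n => [|n] /=; last exact: res_d_hom.
by apply/in_hom0P; apply: hom0_comp => //; apply/in_hom0P/res_aug_hom.
Qed.
Lemma splice_exact0 x : g x = 0 <-> exists y, splice_d 0 y = x.
Proof.
rewrite ik; split=> [[z <-]|[y <-]]; last by exists (res_aug R y).
by have [y <-] := res_aug_surj R z; exists y.
Qed.
Lemma splice_exact n x : splice_d n x = 0 <-> exists y, splice_d n.+1 y = x.
Proof.
case: n x => [|n] x /=; last exact: res_exact.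
rewrite -res_exact0; split=> [H|->]; last exact: linear0.
by apply: ii; rewrite linear0.
Qed.

Definition splice : projResolution N :=
  ProjResolution splice_proj splice_d_hom ((in_hom0P _).2 hg) gs splice_exact0 splice_exact.
End Splice.

Lemma resolution_exists (N : gmod) : exists R : projResolution N, True.
Proof.
have [P PP] := boolp.choice exists_cover.
pose g M := sval (cid2 (PP M).2).
have hg M : hom0 (g M) by rewrite /g; case: cid2.
have gs M y : exists x, g M x = y by rewrite /g; case: cid2.
pose Nk := fix Nk k := if k is k'.+1 then kernel (hg (Nk k')) else N.
have pr k : graded_projective (P (Nk k)) by case: (PP (Nk k)).
pose d k : {linear P (Nk k.+1) -> P (Nk k)} := (ker_incl (hg (Nk k)) \o g (Nk k.+1)).
have hd k : in_hom 0 (d k).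
  by apply/in_hom0P; apply: hom0_comp; [apply: sub_incl_hom0 | apply: hg].
have ex k (x : P (Nk k)) : g (Nk k) x = 0 <-> exists y, d k y = x.
  split=> [gx|[y <-]]; last exact: (sub_inclP (hW := ker_hom (hg (Nk k)))).
  have [z Ez] := sub_lift (ker_hom (hg (Nk k))) (gx : ker_sub (g (Nk k)) x).
  by have [y Ey] := gs _ z; exists y; rewrite /d /= Ey.
have ex' k x : d k x = 0 <-> exists y, d k.+1 y = x.
  rewrite -ex /d /=; split=> [H|->]; last exact: linear0.
  by apply: (@sub_incl_inj _ _ (ker_hom (hg (Nk k)))); rewrite linear0.
by exists (ProjResolution pr hd ((in_hom0P _).2 (hg N)) (gs N) (ex 0%N) ex').
Qed.

Section Shift.
Variables (N : gmod) (R : projResolution N).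
Let ha : hom0 (res_aug R) := (in_hom0P _).1 (@res_aug_hom _ _ _ R).
Definition syzygy := kernel ha.
Definition syz_incl : {linear syzygy -> R 0%N} := ker_incl ha.

Lemma shift_aug_ker x : ker_sub (res_aug R) (res_d R 0 x).
Proof. by apply/(res_exact0 (p := R)); exists x. Qed.
Definition shift_aug_fun (x : R 1%N) : syzygy := mksubm (shift_aug_ker x).
Lemma shift_aug_linear : linear shift_aug_fun.
Proof. by move=> c x y; apply: subm_inj; rewrite /= linearP. Qed.
Definition shift_aug : {linear R 1%N -> syzygy} := mklin shift_aug_linear.
Lemma shift_augE x : syz_incl (shift_aug x) = res_d R 0 x. Proof. by []. Qed.

Lemma shift_aug_hom : in_hom 0 shift_aug.
Proof. by move=> k x Dx; apply: (@res_d_hom _ _ _ R 0%N). Qed.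
Lemma shift_aug_surj y : exists x, shift_aug x = y.
Proof.
have /(res_exact0 (p := R))[x Ex] : res_aug R (syz_incl y) = 0 by apply: (sub_inclP (hW := ker_hom ha)).
by exists x; apply: (@sub_incl_inj _ _ (ker_hom ha)).
Qed.
Lemma shift_exact0 x : shift_aug x = 0 <-> exists y, res_d R 1 y = x.
Proof.
rewrite -res_exact -shift_augE; split=> [->|H]; first exact: linear0.
by apply: (@sub_incl_inj _ _ (ker_hom ha)); rewrite linear0.
Qed.
Definition shift : projResolution syzygy :=
  ProjResolution (fun n => @res_proj _ _ _ R n.+1) (fun n => @res_d_hom _ _ _ R n.+1) shift_aug_hom
    shift_aug_surj shift_exact0 (fun n => @res_exact _ _ _ R n.+1).
End Shift.

(** * Vanishing of Ext from the first syzygies *)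

Section Comparison.
Variable T : gmod.

Definition pure_top (b : int) (N : gmod) : Prop :=
  forall j, j <> b -> forall f : {linear N -> T}, in_hom j f -> forall x, f x = 0.

(** Some n-th syzygy of [N] has maps to [T] in degree b + n only. Just the first n steps of one
    resolution are recorded, whereas [Ext_eq0] ranges over all resolutions; [comparison] bridges the
    two. *)
Fixpoint pure_syzygy (n : nat) (b : int) (N : gmod) : Prop :=
  if n is n'.+1 then
    exists (Q N' : gmod) (q : {linear Q -> N}) (i : {linear N' -> Q}),
    [/\ graded_projective Q, hom0 q /\ hom0 i, forall y, exists x, q x = y,
        injective i /\ forall x, q x = 0 <-> exists y, i y = x
      & pure_syzygy n' (b + 1) N']
  else pure_top b N.

(* With Y -> X in place of the term of degree -1 of the resolution. *)
Definition extends (X Y : gmod) (i : {linear X -> Y}) (R : projResolution X) (n : nat) (j : int) :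
    {linear R n -> T} -> Prop :=
  match n with
  | 0 => fun f => exists2 g : {linear Y -> T}, in_hom j g & forall x, f x = g (i (res_aug R x))
  | n'.+1 => fun f => exists2 g : {linear R n' -> T}, in_hom j g & forall x, f x = g (res_d R n' x)
  end.

Lemma hom_factor_aug (X : gmod) (P : gmod) (a : {linear P -> X}) j (f : {linear P -> T}) :
  hom0 a -> (forall y, exists x, a x = y) -> in_hom j f -> (forall x, a x = 0 -> f x = 0) ->
  exists2 f' : {linear X -> T}, in_hom j f' & forall x, f' (a x) = f x.
Proof.
move=> ha sa hf fa; have [f' fE] := factor_surj sa fa.
exists f' => // k y; have [x <-] := sa y => Dy.
by have [x' Dx' <-] := hom0_lift ha Dy; rewrite fE; apply: hf.
Qed.

(* The self-map beta alpha of X is homotopic to the identity, the homotopy     *)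
(* being s; this property is inherited by the successive syzygies.             *)
Lemma comparison n : forall (b : int) (N X Y : gmod) (alpha : {linear X -> N}) (beta : {linear N -> X})
    (i : {linear X -> Y}) (s : {linear Y -> X}) (R : projResolution X) j (f : {linear R n -> T}),
  pure_syzygy n b N -> hom0 alpha -> hom0 beta -> hom0 i -> hom0 s -> graded_projective Y ->
  (forall x, beta (alpha x) = x + s (i x)) -> j <> b + n%:Z ->
  in_hom j f -> (forall x, f (res_d R n x) = 0) -> extends i j f.
Proof.
elim: n => [|n IH] b N X Y alpha beta i s R j f.
  move=> pN ha hb hi hs pY E jb hf fd.
  have fa x : res_aug R x = 0 -> f x = 0 by move=> /(res_exact0 (p := R))[y <-].
  have [f' hf' fE] := hom_factor_aug ((in_hom0P _).1 (@res_aug_hom _ _ _ R)) (@res_aug_surj _ _ _ R) hf fa.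
  (* Purity of [N] kills f' beta, since j <> b. Applied to the homotopy formula, f' then gives f' =
     - f' s i, so that - f' s is the required map on [Y]. *)
  have fb x : f' (beta x) = 0.
    by apply: (pN j _ (f' \o beta : {linear N -> T})); [rewrite addr0 in jb | apply: in_hom_comp0].
  have gl : linear (fun y => - f' (s y)) by move=> c x y; rewrite (linearP s) (linearP f') opprD scalerN.
  exists (mklin gl) => [k y Dy|x]; first by apply/mdegN/hf'/hs.
  rewrite mklinE; apply/eqP; rewrite -addr_eq0 -fE -linearD -E; apply/eqP; exact: fb.
move=> [Q [N' [q [i' [pQ [hq hi'] qs [ii' ik'] pN']]]]] ha hb hi hs pY E jb hf fd.
have haug := (in_hom0P _).1 (@res_aug_hom _ _ _ R).
have raug := @res_aug_surj _ _ _ R.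
have [al hal alE] := projective_lift (f := alpha \o res_aug R : {linear R 0%N -> N}) (g := q)
  (@res_proj _ _ _ R 0) (hom0_comp ha haug) hq (fun p => qs _).
have [be hbe beE] := projective_lift (f := beta \o q : {linear Q -> X}) (g := res_aug R)
  pQ (hom0_comp hb hq) haug (fun p => raug _).
have [st hst stE] := projective_lift (f := s) (g := res_aug R) pY hs haug (fun p => raug _).
pose O := syzygy R; pose inc := syz_incl R.
have hinc : hom0 inc by apply: sub_incl_hom0.
have iinc : injective inc by apply: sub_incl_inj.
have incK y : res_aug R (inc y) = 0 by apply: (sub_inclP (hW := ker_hom _)).
have incS x : res_aug R x = 0 -> exists y, inc y = x by move=> H; apply: (sub_lift (ker_hom _) (x := x)).
have [al' alE'] : exists al' : {linear O -> N'}, forall x, i' (al' x) = al (inc x).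
  apply: (factor_inj (i := i') (f := al \o inc : {linear O -> Q}) ii') => x.
  by apply/ik'; rewrite alE /= incK linear0.
have hal' : hom0 al'.
  exact: (hom0_factor_inj (f := al \o inc) ii' hi' (hom0_comp hal hinc) alE').
have [be' beE'] : exists be' : {linear N' -> O}, forall x, inc (be' x) = be (i' x).
  apply: (factor_inj (i := inc) (f := be \o i' : {linear N' -> R 0%N}) iinc) => x.
  by apply: incS; rewrite beE /=; have -> : q (i' x) = 0; [apply/ik'; exists x | rewrite linear0].
have hbe' : hom0 be'.
  exact: (hom0_factor_inj (f := be \o i') iinc hinc (hom0_comp hbe hi') beE').
(* This map vanishes after the augmentation, so it lands in the syzygy. It is the next homotopy,
   with [R 0] in the role of [Y], as its last term is 0 on the syzygy. *)
pose sf (p : R 0%N) := be (al p) - p - st (i (res_aug R p)).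
have sfl : linear sf.
  move=> c x y; rewrite /sf (linearP al) (linearP be) (linearP (res_aug R)) (linearP i) (linearP st) !scalerBr !opprD.
  by rewrite (AC (2*2*2) ((1*3*5)*(2*4*6))).
have [s' sE'] : exists s' : {linear R 0%N -> O}, forall x, inc (s' x) = sf x.
  apply: (factor_inj (i := inc) (f := mklin sfl) iinc) => x; apply: incS.
  rewrite mklinE /sf !linearB beE /= alE /= stE E.
  by rewrite [_ + s _]addrC addrK subrr.
have hs' : hom0 s'.
  apply: (hom0_factor_inj (f := sf) iinc hinc _ sE') => k x Dx; rewrite /sf.
  apply: mdegB; last by apply/hst/hi/haug.
  by apply: mdegB => //; apply/hbe/hal.
have E' x : be' (al' x) = x + s' (inc x).
  apply: iinc; rewrite beE' alE' linearD sE' /sf incK (linear0 i) (linear0 st) subr0.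
  by rewrite addrC subrK.
have := IH (b + 1) N' O (R 0%N) al' be' inc s' (shift R) j f pN' hal' hbe' hinc hs'
  (@res_proj _ _ _ R 0) E' _ hf fd.
case: n f hf fd IH jb pN' => [|n] f hf fd IH jb pN'; apply; move: jb;
  rewrite -addrA; by [].
Qed.

(** Comparison with the identity of [X] and Y = 0. For n > 0, [extends] is then the condition of
    being a coboundary; for n = 0 the cocycle factors through [X]. *)
Lemma pure_Ext_eq0 n b (X : gmod) j : pure_syzygy n b X -> j <> b + n%:Z -> Ext_eq0 X T n j.
Proof.
move=> pX jn R f [hf fd].
case: n f pX jn hf fd => [|n] f pX jn hf fd.
  have fa x : res_aug R x = 0 -> f x = 0 by move=> /(res_exact0 (p := R))[y <-].
  have [f' hf' fE] := hom_factor_aug ((in_hom0P _).1 (@res_aug_hom _ _ _ R)) (@res_aug_surj _ _ _ R) hf fa.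
  by move=> x; rewrite -fE; apply: (pX j); rewrite addr0 in jn.
pose Y := free_module (fun _ : void => 0 : int).
apply: (@comparison n.+1 b X X Y idfun idfun \0 \0 R j f pX) => //.
- by move=> k x _; apply: mdeg0.
- by move=> k x _; apply: mdeg0.
- exact: free_projective.
- by move=> x /=; rewrite addr0.
Qed.

End Comparison.

(** * Linear colon ideals and Koszulness *)

Section LinearColons.
Variable Good : seq U^o -> Prop.
Hypothesis GoodN : Good [::].
Hypothesis GoodS : forall y x, Good (rcons y x) -> Good y /\
  exists2 z, Good z & forall r : U^o, lspan y (r *: x) <-> lspan z r.
Hypothesis Good1 : forall y x, Good y -> x \in y -> G 1 x.

(** The colon ideal of each term by the preceding ones is generated by a list in [Good], a family of
    lists of degree 1 elements that is itself closed under colons, much as in a Koszul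
    filtration. *)
Inductive linear_colons (V : lmodType U) : seq V -> Prop :=
  | linear_colons0 : linear_colons [::]
  | linear_colonsS e x y : linear_colons e -> Good y ->
      (forall r : U^o, lspan e (r *: x) <-> lspan y r) -> linear_colons (rcons e x).

Lemma linear_colons_map (V W : lmodType U) (g : {linear V -> W}) e :
  injective g -> linear_colons e -> linear_colons (map g e).
Proof.
move=> gi; elim=> [|{}e x y _ IH Gy H]; first exact: linear_colons0.
rewrite map_rcons; apply: (linear_colonsS IH Gy) => r; rewrite -H -linearZ_LR.
split=> [|He]; last by apply: linear_span He => z ez; apply/spanI/map_f.
by move=> /lspan_map[v ev /gi <-].
Qed.

Lemma linear_colons_image (V W : lmodType U) (g : {linear V -> W}) e :
  injective g -> linear_colons (map g e) -> linear_colons e.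
Proof.
move=> gi; elim/last_ind: e => [|e x IH]; first by move=> _; apply: linear_colons0.
rewrite map_rcons; move E : (rcons _ _) => s H; case: H E => [/(congr1 size)|e' x' y Le Gy H].
  by rewrite size_rcons.
move=> /rcons_inj[Ee Ex]; rewrite -{}Ee in Le H; rewrite -{}Ex in H.
apply: (linear_colonsS (IH Le) Gy) => r; rewrite -H -linearZ_LR.
split=> [He|]; first by apply: linear_span He => z ez; apply/spanI/map_f.
by move=> /lspan_map[v ev /gi <-].
Qed.

Let U1 a : gmod := free_module (fun _ : unit => a : int).
Let co_linear a : linear (fun f : U1 a => (f : {malg U[unit]})@_tt : U^o).
Proof. by move=> c x y; rewrite mcoeffD mcoeffZ. Qed.
Let co a : {linear U1 a -> U^o} := mklin (co_linear (a := a)).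

(* Inductively, the last element x of e adds to the syzygies of the others a   *)
(* lift of each generator of its colon ideal.                                  *)
Lemma linear_syzygies (N : gmod) a (e : seq N) :
  linear_colons e -> (forall x, x \in e -> mdeg a x) ->
  exists (Q : gmod) (q : {linear Q -> N}) (t : seq Q),
  [/\ graded_projective Q, hom0 q, forall x, lspan e x <-> exists z, q z = x,
     linear_colons t /\ (forall z, z \in t -> mdeg (a + 1) z) & forall z, q z = 0 <-> lspan t z].
Proof.
elim=> [_|{}e x y Le IH Gy Hy De].
  pose Q := free_module (fun _ : void => 0 : int); exists Q, \0, [::]; split.
  - exact: free_projective.
  - by move=> k x _; apply: mdeg0.
  - by move=> x; split=> [/lspan_nil->|[z <-]]; [exists 0 | apply: span0].
  - by split=> //; apply: linear_colons0.
  - move=> z; split=> // _; have -> : z = 0 by apply/malgP => -[].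
    exact: span0.
have [|Q [q [t [pQ hq qe [Lt Dt] qt]]]] := IH.
  by move=> z ze; apply: De; rewrite mem_rcons inE ze orbT.
have Dx : mdeg a x by apply: De; rewrite mem_rcons inE eqxx.
have [k' kE] := free_lift (fun _ : unit => x).
pose k : {linear U1 a -> N} := k'.
have hk : hom0 k by apply/in_hom0P/free_hom => -[]; rewrite subr0 kE.
have kco z : k z = co a z *: x.
  have l2 : linear (fun z => co a z *: x).
    by move=> c u v; rewrite linearP scalerDl -scalerA.
  apply: (linear_eq_span (g := k) (h := mklin l2) _ (free_span z)) => _ [[] ->].
  by rewrite kE mklinE -[co _ _]/(<< tt >>@_tt) mcoeffUU scale1r.
have wex (u : U^o) : exists w, u \in y -> mdeg (a + 1) w /\ q w = - (u *: x).
  case: (boolP (u \in y)) => uy; last by exists 0.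
  have /Hy/qe[z Ez] : lspan y u by apply: spanI.
  have Du : mdeg (a + 1) (q z) by rewrite Ez addrC; apply: mdeg_scale => //; apply: Good1 uy.
  have [z' Dz' Ez'] := hom0_lift hq Du; exists (- z') => _.
  by split; [apply: mdegN | rewrite linearN Ez' Ez].
have [w wP] := boolp.choice wex.
pose Q' := dsum Q (U1 a); pose q' : {linear Q' -> N} := copair q k.
(* The syzygy attached to a generator [u] of the colon ideal of [x]: u x is a combination of the
   previous elements, and [w u] is a homogeneous lift of its opposite. *)
pose sg (u : U^o) : Q' := (w u, << u *g tt >>).
have q'E p : q' p = q p.1 + co a p.2 *: x by rewrite -kco.
have cosg u : co a (sg u).2 = u by apply: mcoeffUU.
have q'sg u : u \in y -> q' (sg u) = 0.
  by move=> /wP[_ qw]; rewrite q'E cosg qw addNr.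
have codl z : co a (dinl Q (U1 a) z).2 = 0 by apply: mcoeff0.
have q'dl z : q' (dinl Q (U1 a) z) = q z by rewrite q'E codl scale0r addr0.
have co0 f : co a f = 0 -> f = 0 by move=> H; apply/malgP => -[]; rewrite mcoeff0; exact: H.
pose T y' := map (dinl Q (U1 a)) t ++ map sg y'.
have TA y' p : lspan (T y') p -> lspan y' (co a p.2).
  have l2 : linear (fun p : Q' => co a p.2) by move=> c u v; rewrite -linearP.
  apply: (linear_span (g := mklin l2)) => z; rewrite mklinE mem_cat.
  case/orP => /mapP[u uz ->]; first by rewrite codl; apply: span0.
  by rewrite cosg; apply: spanI.
(* With [TA]: among syzygies, membership in the span of [T y'] is decided by the coefficient of [x],
   because those with coefficient 0 are spanned by [t]. *)
have TB y' p : {subset y' <= y} -> q' p = 0 -> lspan y' (co a p.2) -> lspan (T y') p.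
  move=> sy qp yp.
  have [p0 [Hp0 qp0 Ep0]] : exists p0, [/\ lspan (map sg y') p0, q' p0 = 0 & co a p0.2 = co a p.2].
    elim: yp => [|u uy|c u v _ [pu [Hu qu <-]] _ [pv [Hv qv <-]]].
    - by exists 0; rewrite linear0 linear0; split=> //; apply: span0.
    - by exists (sg u); rewrite cosg q'sg; [split=> //; apply/spanI/map_f | apply: sy].
    - exists (c *: pu + pv); split; first exact: spanL.
        by rewrite linearP qu qv scaler0 addr0.
      by rewrite -linearP.
  rewrite -[p](subrK p0); apply: spanD; last first.
    by apply: span_mono Hp0 => z zs; rewrite mem_cat zs orbT.
  have E2 : p - p0 = dinl Q (U1 a) (p - p0).1.
    apply: injective_projections => //=; apply: co0.
    by rewrite linearB Ep0 subrr.
  have : q (p - p0).1 = 0 by rewrite -q'dl -E2 linearB qp qp0 subrr.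
  rewrite E2 => /qt; apply: linear_span => z zt; apply: spanI.
  by rewrite mem_cat map_f.
exists Q', q', (T y); split.
- exact/dsum_projective/free_projective.
- exact: copair_hom0.
- move=> v; rewrite lspan_rcons; split=> [[c /qe[z Ez]]|[p <-]].
    exists (z, << c *g tt >>); rewrite q'E /= -[co a _]/(<< c *g tt >>@_tt) mcoeffUU Ez subrK //.
  by exists (co a p.2); rewrite q'E addrK; apply/qe; exists p.1.
- split; last first.
    move=> z; rewrite mem_cat => /orP[/mapP[v /Dt Dv ->]|/mapP[u uy ->]]; first exact: dinl_hom0.
    have [Dw _] := wP u uy; split=> //; apply: free_degU => //=.
    by rewrite addrAC subrr add0r; apply: Good1 uy.
  have H y' : Good y' -> {subset y' <= y} -> linear_colons (T y').
    elim/last_ind: y' => [|y' u IHy] Gy' sy; first by rewrite /T cats0; apply: linear_colons_map => // ? ? [].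
    have [Gy'' [z Gz' Hz]] := GoodS Gy'.
    have sy' : {subset y' <= y} by move=> v vy; apply: sy; rewrite mem_rcons inE vy orbT.
    have uy : u \in y by apply: sy; rewrite mem_rcons inE eqxx.
    (* The colon ideal of [sg u] by [T y'] is that of [u] by [y'], which is good by [GoodS]. *)
    rewrite /T map_rcons -rcons_cat; apply: (linear_colonsS (IHy Gy'' sy') Gz') => r.
    rewrite -Hz; split=> [/TA|Hr]; first by rewrite linearZ_LR cosg.
    by apply: TB => //; rewrite ?linearZ_LR ?cosg // q'sg // scaler0.
  exact: H.
- move=> p; split=> [qp|].
    apply: TB => //; apply/Hy/qe; exists (- p.1); rewrite linearN; apply/eqP.
    by rewrite eqr_oppLR -addr_eq0 -q'E qp.
  have k0 z : lspan (T y) z -> lspan [::] (q' z).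
    apply: linear_span => {}z; rewrite mem_cat => /orP[/mapP[v vt ->]|/mapP[u uy ->]].
      by rewrite q'dl (qt v).2; [apply: span0 | apply: spanI].
    by rewrite q'sg //; apply: span0.
  by move=> /k0 /lspan_nil.
Qed.

Section Purity.
Variable T : gmod.
Hypothesis HT : forall k (t : T), mdeg k t -> k = 0 \/ t = 0.

(** By [linear_syzygies] the next syzygy satisfies the same hypotheses with a + 1. At the end, a map
    of degree j from a module generated in degree a to [T], which sits in degree 0, vanishes unless
    j = a. *)
Lemma linear_colons_pure n a (N : gmod) (e : seq N) : linear_colons e ->
  (forall x, x \in e -> mdeg a x) -> (forall x, lspan e x) -> pure_syzygy T n a N.
Proof.
elim: n a N e => [|n IH] a N e Le De spe.
  move=> j ja f hf x.
  have : lspan [::] (f x).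
    apply: linear_span (spe x) => y ye.
    have [/eqP|->] := HT (hf _ _ (De _ ye)); last exact: span0.
    by rewrite subr_eq0 => /eqP aj; case: ja.
  by move=> /lspan_nil.
have [Q [q [t [pQ hq qe [Lt Dt] qt]]]] := linear_syzygies Le De.
pose K := kernel hq; pose i : {linear K -> Q} := ker_incl hq.
have iinj : injective i by apply: sub_incl_inj.
have ik x : q x = 0 <-> exists y, i y = x.
  split=> [H|[y <-]]; last exact: (sub_inclP (hW := ker_hom hq)).
  exact: (sub_lift (ker_hom hq) (x := x)).
have [t' Et'] : exists t', map i t' = t.
  have : forall z, z \in t -> q z = 0 by move=> z zt; apply/qt/spanI.
  elim: (t) => [|z s IHs] Hs; first by exists [::].
  have [|s' <-] := IHs; first by move=> w ws; apply: Hs; rewrite inE ws orbT.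
  have [|z' <-] := (ik z).1; first by apply: Hs; rewrite inE eqxx.
  by exists (z' :: s').
exists Q, K, q, i; split=> //.
- by split=> //; apply: sub_incl_hom0.
- by move=> y; apply/qe.
apply: (IH (a + 1) K t').
- by apply: (linear_colons_image iinj); rewrite Et'.
- by move=> z zt; apply: Dt; rewrite -Et'; apply: (map_f i).
- move=> z; have /qt : q (i z) = 0 by apply/ik; exists z.
  by rewrite -Et' => /lspan_map[v Hv /iinj<-].
Qed.

End Purity.
End LinearColons.
End GradedModuleTheory.

Section RestrictScalars.
Variables (F : fieldType) (U : algType F) (V : lmodType U).
Definition fmod : Type := V.
HB.instance Definition _ := GRing.Zmodule.on fmod.
Definition fscale (c : F) (v : fmod) : fmod := (c%:A : U) *: (v : V).
Let sA c d v : fscale c (fscale d v) = fscale (c * d) v.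
Proof. by rewrite /fscale scalerA mulr_algl scalerA. Qed.
Let s1 : left_id 1 fscale.
Proof. by move=> v; rewrite /fscale scale1r; apply: scale1r. Qed.
Let sDr : right_distributive fscale +%R.
Proof. by move=> c u v; apply: scalerDr. Qed.
Let sDl v : {morph fscale^~ v : c d / c + d}.
Proof. by move=> c d; rewrite /fscale scalerDl; apply: scalerDl. Qed.
HB.instance Definition _ := GRing.Zmodule_isLmodule.Build F fmod sA s1 sDr sDl.
Lemma fmodZE (c : F) (v : fmod) : c *: v = (c%:A : U) *: (v : V).
Proof. by []. Qed.
End RestrictScalars.

(** * Left ideals of U(L) and a criterion for Koszulness *)

Section EnvelopeDegrees.
Variables (F : fieldType) (L : gradedLieType F).
Implicit Types u v : uenv L.

Lemma uenv_degMM n m u v : uenv_deg n u -> uenv_deg m v -> uenv_deg (n + m) (u * v).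
Proof.
move=> Du Dv; elim: Du => {n u} [n|n u w _ Hu _ Hw|n c u _ Hu||n k x u Dx _ Hu].
- by rewrite mul0r; apply: uenv_deg0.
- by rewrite mulrDl; apply: uenv_degD.
- by rewrite -scalerAl; apply: uenv_degZ.
- by rewrite mul1r.
- by rewrite -mulrA -addnA; apply: uenv_degM.
Qed.

Lemma uenv_deg_iota n (x : L) : ldeg n x -> uenv_deg n (uiota x : uenv L).
Proof. by move=> Dx; rewrite -[uiota x]mulr1 -[n]addn0; apply: uenv_degM => //; apply: uenv_deg1. Qed.

Lemma uenv_deg_low n u : uenv_deg n u ->
  (n = 0%N -> exists c : F, u = c *: 1) /\ (n = 1%N -> exists2 x, ldeg 1 x & u = uiota x).
Proof.
elim=> {n u} [n|n u v _ [Hu Hu'] _ [Hv Hv']|n c u _ [Hu Hu']||n m x u Dx _ [Hu Hu']].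
- by split=> _; [exists 0; rewrite scale0r | exists 0; [apply: ldeg0 | rewrite raddf0]].
- split=> E; first by have [c ->] := Hu E; have [d ->] := Hv E; exists (c + d); rewrite scalerDl.
  have [x Dx ->] := Hu' E; have [y Dy ->] := Hv' E.
  by exists (x + y); [apply: ldegD | rewrite raddfD].
- split=> E; first by have [d ->] := Hu E; exists (c * d); rewrite scalerA.
  by have [x Dx ->] := Hu' E; exists (c *: x); [apply: ldegZ | rewrite linearZ_LR].
- by split=> // _; exists 1; rewrite scale1r.
- case: n Dx => [/ldeg0_eq0->|n Dx].
    by rewrite raddf0 mul0r; split=> _; [exists 0; rewrite scale0r | exists 0; [apply: ldeg0|rewrite raddf0]].
  split=> // -[E]; have {E} [n0 m0] : n = 0%N /\ m = 0%N by case: n E {Dx} => [|n] // <-.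
  have [c ->] := Hu m0; exists (c *: x); first by apply: ldegZ; rewrite n0 in Dx.
  by rewrite linearZ_LR -scalerAr mulr1.
Qed.

Definition lideal (s : seq (uenv L)) : uenv L -> Prop := @lspan (uenv L) (uenv L)^o s.

Lemma lideal_subspace s : @subspace (uenv L) (uenv L)^o (lideal s).
Proof. exact: span_subspace. Qed.
Lemma lidealM s u v : lideal s v -> lideal s (u * v).
Proof. exact: (subspaceZ u (lideal_subspace s)). Qed.
Lemma lidealD s u v : lideal s u -> lideal s v -> lideal s (u + v).
Proof. exact: (subspaceD (lideal_subspace s)). Qed.
Lemma lidealB s u v : lideal s u -> lideal s v -> lideal s (u - v).
Proof. exact: (subspaceB (lideal_subspace s)). Qed.
Lemma lideal0 s : lideal s 0.
Proof. by case: (lideal_subspace s). Qed.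
Lemma lideal_mem s u : u \in s -> lideal s u.
Proof. by move=> su; apply: spanI. Qed.
Lemma lidealZ s (c : F) u : lideal s u -> lideal s (c *: u).
Proof. by move=> Hu; rewrite -mulr_algl; apply: lidealM. Qed.

(** A left ideal containing x and y contains x y - y x, so Lie generators of [L] generate the
    augmentation ideal as a left ideal. *)
Lemma uaug_gen (s : seq L) : (forall x : L, lgen (fun y => y \in s) x) ->
  forall r : uenv L, uaug r = 0 <-> lideal (map (@uiota F L) s) r.
Proof.
move=> gen; set t := map _ s.
have Ji x : lideal t (uiota x).
  apply: (lgen_sub (S := fun x => lideal t (uiota x))) (gen x).
    split=> [|c y z Hy Hz|y z Hy Hz]; first by rewrite raddf0; apply: lideal0.
      by rewrite linearP; apply: lidealD => //; apply: lidealZ.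
    by rewrite uiota_bracket; apply: lidealB; apply: lidealM.
  by move=> y sy; apply: lideal_mem; apply: map_f.
have Ju u : lideal t (u - uaug u *: 1).
  elim/uenv_ind: u => [|x u Hu|c u v Hu Hv].
  - by rewrite uaug1 scale1r subrr; apply: lideal0.
  - rewrite uaugM uaug_iota mul0r scale0r subr0.
    have -> : uiota x * u = uiota x * (u - uaug u *: 1) + uaug u *: uiota x.
      by rewrite mulrBr -scalerAr mulr1 subrK.
    by apply: lidealD; [apply: lidealM | apply: lidealZ].
  - rewrite uaugD uaugZ scalerDl opprD addrACA -scalerA -scalerBr.
    by apply: lidealD => //; apply: lidealZ.
move=> r; split=> [r0|]; first by have := Ju r; rewrite r0 scale0r subr0.
elim=> [|_ /mapP[x _ ->]|c u v _ Hu _ Hv]; first exact: (raddf0 (@uaug F L : {linear uenv L -> F^o})).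
  exact: uaug_iota.
by rewrite uaugD [_ *: _](_ : _ = c * u) // uaugM Hv Hu mulr0 addr0.
Qed.

(** The trivial module is generated by 1 in degree 0, and the colon ideal of 1 by the empty list is
    the augmentation ideal; so the one-term list 1 has linear colons. *)
Lemma koszul_criterion (Good : seq (uenv L) -> Prop) :
  Good [::] ->
  (forall y x, Good (rcons y x) -> Good y /\
    exists2 z, Good z & forall r, lideal y (r * x) <-> lideal z r) ->
  (forall y x, Good y -> x \in y -> uenv_deg 1 x) ->
  (exists2 y, Good y & forall r, uaug r = 0 <-> lideal y r) ->
  koszul L.
Proof.
move=> GN GS GD [y Gy Hy] i j ij; set T := trivial_module L.
have HG := @uenv_deg_grading F L; have HM := @uenv_degMM.
apply: (pure_Ext_eq0 HG (uenv_deg1 L) HM (b := 0)); last by rewrite add0r => ji; apply: ij.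
apply: (linear_colons_pure HG (uenv_deg1 L) HM GS GD _ _ (e := [:: (1 : trivmod L) : T])).
- by move=> k t.
- rewrite -[[:: _]]/(rcons [::] (1 : T)).
  apply: (linear_colonsS _ Gy) => [|r]; first exact: linear_colons0.
  apply: (iff_trans _ (Hy r)).
  have -> : r *: (1 : T) = uaug (r : uenv L) :> F by apply: mulr1.
  by split=> [/lspan_nil //|->]; apply: span0.
- by move=> x; rewrite inE => /eqP->; left.
- move=> x; have -> : x = ((x : F) *: (1 : uenv L)) *: (1 : T).
    by rewrite trivmod_scaleE mulr1 uaugZ uaug1 mulr1.
  by apply/spanZ/spanI; rewrite inE.
Qed.

End EnvelopeDegrees.

(** * Linear relations in Bloch-Kato Lie algebras *)

Section LinearRelations.
Variables (F : fieldType) (M : gradedLieType F) (n : nat) (a : 'I_n -> M).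
Hypothesis ha : forall i, ldeg 1 (a i).
Hypothesis gen : forall x, lgen (fun y => exists i, y = a i) x.
Hypothesis free : forall c : 'I_n -> F, \sum_i c i *: a i = 0 -> forall i, c i = 0.
Hypothesis H2 : forall j : int, j <> 2 -> cohomology_eq0 M 2 j.

Notation U := (uenv M).
Notation G := (@uenv_deg F M).
Let HG : is_grading G := @uenv_deg_grading F M.
Let G1 : G 0 1 := uenv_deg1 M.
Let GM := @uenv_degMM F M.
Let T := trivial_module M.

Definition linear_relation (s : 'I_n -> U) : Prop :=
  (forall i, exists2 x, ldeg 1 x & s i = uiota x) /\ \sum_i s i * uiota (a i) = 0.

Let P0 : gradedModule G := free_module HG GM (fun _ : unit => 0 : int).
Let P1 : gradedModule G := free_module HG GM (fun _ : 'I_n => 1 : int).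

(** The relations form the second syzygy [N2] of the trivial module. A generator of [N2] needed in
    degree k > 2 would give a nonzero class in H^{2,k}; so [N2] is generated in degrees at most 2,
    and in degrees below 2 it is 0 since the a_i are independent. *)
Theorem linear_relations (r : 'I_n -> U) :
  \sum_i r i * uiota (a i) = 0 -> @span U ('I_n -> U^o) linear_relation r.
Proof.
have pP0 : graded_projective P0 by apply: free_projective.
have pP1 : graded_projective P1 by apply: free_projective.
have [g0' g0E] := free_lift (fun _ : unit => (1 : F) : T).
pose g0 : {linear P0 -> T} := g0'.
have hg0 : hom0 g0.
  by apply/in_hom0P/free_hom => -[]; rewrite subr0 -[g0 _]/(g0' _) g0E; left.
have g0c f : g0 f = uaug ((f : {malg U[unit]})@_tt).
  have l2 : linear (fun f : P0 => uaug ((f : {malg U[unit]})@_tt) : T).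
    by move=> c x y; rewrite mcoeffD mcoeffZ uaugD uaugM.
  apply: (linear_eq_span (g := g0) (h := mklin l2) _ (free_span f)) => _ [[] ->].
  by rewrite mklinE -[g0 _]/(g0' _) g0E mcoeffUU uaug1.
have sg0 y : exists x, g0 x = y.
  by exists << (y : F) *: (1 : U) *g tt >>; rewrite g0c mcoeffUU uaugZ uaug1 mulr1.
have [g1' g1E] := free_lift (fun i : 'I_n => << uiota (a i) *g tt >> : {malg U[unit]}).
pose g1 : {linear P1 -> P0} := g1'.
have hg1 : hom0 g1.
  apply/in_hom0P/free_hom => i; rewrite subr0 -[g1 _]/(g1' _) g1E; apply: (free_degU HG).
  exact: (uenv_deg_iota (ha i)).
have g1c f : (g1 f : {malg U[unit]})@_tt = \sum_i (f : {malg U['I_n]})@_i * uiota (a i).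
  have l1 : linear (fun f : P1 => (g1 f : {malg U[unit]})@_tt : U^o).
    by move=> c x y; rewrite linearP mcoeffD mcoeffZ.
  have l2 : linear (fun f : P1 => \sum_i (f : {malg U['I_n]})@_i * uiota (a i) : U^o).
    move=> c x y; rewrite -[RHS]/(c * _ + _) big_distrr -big_split; apply: eq_bigr => i _ /=.
    by rewrite mcoeffD mcoeffZ mulrDl mulrA.
  apply: (linear_eq_span (g := mklin l1) (h := mklin l2) _ (free_span f)) => _ [i ->].
  rewrite !mklinE -[g1 _]/(g1' _) g1E mcoeffUU (bigD1 i) //= mcoeffUU mul1r big1 ?addr0 // => k ki.
  by rewrite mcoeffU eq_sym (negbTE ki) mul0r.
pose N1 := kernel hg0; pose i1 : {linear N1 -> P0} := ker_incl hg0.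
have hi1 : hom0 i1 by apply: sub_incl_hom0.
have ii1 : injective i1 by apply: sub_incl_inj.
have ik1 x : g0 x = 0 <-> exists y, i1 y = x.
  split=> [H|[y <-]]; first exact: (sub_lift (ker_hom hg0) (x := x)).
  exact: (sub_inclP (hW := ker_hom hg0)).
have s1 y : exists x, g1 x = i1 y.
  have : g0 (i1 y) = 0 by apply/ik1; exists y.
  rewrite g0c; move: (i1 y) => f f0.
  have gen' x : lgen (fun z => z \in [seq a i | i <- enum 'I_n]) x.
    apply: (lgen_sub (lgen_subalgebra _)) (gen x) => z [i ->].
    by apply/lgenI/map_f; rewrite mem_enum.
  have /(uaug_gen gen') Hf := f0.
  have : exists x, (g1 x : {malg U[unit]})@_tt = (f : {malg U[unit]})@_tt.
    elim: Hf => [|_ /mapP[_ /mapP[i _ ->] ->]|c u v _ [x Ex] _ [y' Ey]].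
    - by exists 0; rewrite linear0 mcoeff0.
    - exists << i >>; rewrite -[g1 _]/(g1' _) g1E; exact: mcoeffUU.
    - by exists (c *: x + y'); rewrite linearP mcoeffD mcoeffZ Ex Ey.
  by move=> [x Ex]; exists x; apply/malgP => -[].
have g01 p : g0 (g1 p) = 0.
  rewrite g0c g1c (raddf_sum (@uaug F M : {linear U -> F^o})) big1 // => i _.
  by rewrite /= uaugM uaug_iota mulr0.
have [p1 hp1 p1E] := projective_lift pP1 hg1 hi1 (fun p => (ik1 (g1 p)).1 (g01 p)).
have sp1 y : exists x, p1 x = y.
  by have [x Ex] := s1 y; exists x; apply: ii1; rewrite p1E.
pose N2 := kernel hp1; pose i2 : {linear N2 -> P1} := ker_incl hp1.
have hi2 : hom0 i2 by apply: sub_incl_hom0.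
have ii2 : injective i2 by apply: sub_incl_inj.
have ik2 x : p1 x = 0 <-> exists y, i2 y = x.
  split=> [H|[y <-]]; first exact: (sub_lift (ker_hom hp1) (x := x)).
  exact: (sub_inclP (hW := ker_hom hp1)).
have rel2 y : \sum_i (i2 y : {malg U['I_n]})@_i * uiota (a i) = 0.
  rewrite -g1c -p1E; have -> : p1 (i2 y) = 0 by apply/ik2; exists y.
  by rewrite linear0 mcoeff0.
have [R _] := resolution_exists HG G1 GM N2.
pose R1 := splice pP1 hp1 sp1 hi2 ii2 ik2 R.
pose R0 := splice pP0 hg0 sg0 hi1 ii1 ik1 R1.
pose S2 : N2 -> Prop := span (fun z : N2 => exists2 k, (k <= 2) & mdeg k z).
have main m (k : int) z : (k <= m%:Z) -> mdeg k z -> S2 z.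
  elim: m k z => [|m IH] k z km Dz.
    by apply: spanI; exists k => //; lia.
  case: (pselect (k <= 2)) => [k2|k2]; first by apply: spanI; exists k.
  apply: contrapT => nz.
  have IH' l y : l < k -> mdeg l y -> S2 y by move=> lk; apply: IH; lia.
  have [c [cB c1 c2 cD]] := grading_comp (mdeg_is_grading N2) k.
  have c0 : c 0 = 0 by rewrite -{1}(subrr 0) cB subrr.
  have cA u v : c (u + v) = c u + c v.
    by rewrite -{1}[v]opprK cB -[- v]sub0r cB c0 sub0r opprK.
  have cZ (d : F) y : c (d%:A *: y) = d%:A *: c y.
    apply: (grading_ext (mdeg_is_grading N2) (g := fun y => c (d%:A *: y)) (h := fun y => d%:A *: c y)).
    - by move=> u v; rewrite scalerBr cB.
    - by move=> u v; rewrite cB scalerBr.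
    - move=> l y' Dy.
      have Dy' : mdeg l (d%:A *: y').
        rewrite -[l]add0r; apply: (mdeg_scale (n := 0%N)) => //.
        exact/uenv_degZ/uenv_deg1.
      have [El|lk] := eqVneq l k; first by rewrite !c1 // -El.
      by rewrite (c2 _ _ lk Dy') (c2 _ _ lk Dy) scaler0.
  (* The functional [g] will vanish outside degree k and on the part of [S2] of degree k, and be 1
     at [z]. *)
  have sW : @subspace F (fmod N2) (fun y => S2 (c y)).
    split; first by rewrite c0; apply: span0.
    by move=> d u v Hu Hv; rewrite fmodZE cA cZ; apply: spanL.
  have [|g gz gW] := exists_functional_sub (v := z : fmod N2) sW; first by rewrite c1.
  (* In degree k, a product x v has v of smaller degree, hence in [S2] by induction. So [g] kills
     the products by elements of [M] and is U-linear to the trivial module. *)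
  have giota x (v : N2) : g (uiota x *: v) = 0.
    have lx : linear (fun x => g (uiota x *: v)).
      move=> d u w; rewrite linearP scalerDl linearD; congr (_ + _).
      have -> : (d *: uiota u) *: v = d%:A *: (uiota u *: v) by rewrite scalerA mulr_algl.
      by rewrite -fmodZE linearZ_LR.
    move: x; apply: (graded_linear_eq lx (h := fun=> 0)) => [d u w|m' x Dx]; first by rewrite scaler0 addr0.
    apply: (grading_ext (mdeg_is_grading N2) (g := fun v => g (uiota x *: v)) (h := fun=> 0)) => [u w|u w|l v' Dv].
    - by rewrite scalerBr linearB.
    - by rewrite subr0.
    apply: gW.
    have Dxv : mdeg (m'%:Z + l) (uiota x *: v') by apply: mdeg_scale => //; apply: uenv_deg_iota.
    have [Ek|nk] := eqVneq (m'%:Z + l) k; last by rewrite (c2 _ _ nk Dxv); apply: span0.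
    rewrite c1 -?Ek //; case: m' Dx Ek {Dxv} => [/ldeg0_eq0-> _|m' Dx Ek].
      by rewrite raddf0 scale0r; apply: span0.
    by apply: spanZ; apply: IH' Dv; lia.
  have gU : linear (g : N2 -> T).
    move=> u; elim/uenv_ind: u => [|x u _|d u w Hu Hw] y y'.
    - by rewrite scale1r linearD scale1r.
    - have -> : (uiota x * u) *: y = uiota x *: (u *: y) by rewrite scalerA.
      rewrite linearD giota add0r.
      by rewrite [X in _ = X + _](_ : _ = 0) ?add0r // trivmod_scaleE uaugM uaug_iota !mul0r.
    - rewrite scalerDl -addrA.
      have -> : (d *: u) *: y = d%:A *: (u *: y) by rewrite scalerA mulr_algl.
      rewrite -fmodZE linearP Hw.
      have := Hu y 0; rewrite !addr0 linear0 addr0 => ->.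
      rewrite addrA; congr (_ + _); rewrite !trivmod_scaleE uaugD uaugZ mulrDl.
      by rewrite -mulrA.
  pose f0 : {linear N2 -> T} := mklin gU.
  have hf0 : in_hom k f0.
    move=> l y Dy; have [El|lk] := eqVneq l k; [left; rewrite El subrr // | right].
    by apply: gW; rewrite (c2 _ _ lk Dy); apply: span0.
  pose f : {linear R0 2%N -> T} := (f0 \o res_aug R : {linear R 0%N -> T}).
  have hf : in_hom k f by apply: in_hom_comp0 => //; apply/in_hom0P/(@res_aug_hom _ _ _ R).
  have fd x : f (res_d R0 2%N x) = 0.
    have : res_aug R (res_d R 0%N x) = 0 by apply/(res_exact0 (p := R)); exists x.
    by rewrite /f /= => ->; rewrite linear0.
  have k2' : k <> 2 by move=> k2'; apply: k2; rewrite k2'.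
  have [e he fe] := H2 k2' (P := R0) (conj hf fd).
  (* [P1] is generated in degree 1 and [T] sits in degree 0, so a map of degree k > 2 between them
     is 0. *)
  have e0 x : e x = 0.
    apply: (linear_eq_span (g := e : {linear P1 -> T}) (h := \0) _ (free_span x)) => _ [i ->] /=.
    have : mdeg (1 - k) (e (<< i >> : P1)) by apply: he; apply: free_basis_deg.
    by case=> // E; case: k2; lia.
  have [y Ey] := res_aug_surj R z.
  have : f0 z = 0 by rewrite -Ey -[LHS]/(f y) fe e0.
  by rewrite mklinE gz => /eqP; rewrite oner_eq0.
move=> r0.
have [z Ez] : exists z, i2 z = \sum_i << r i *g i >> :> {malg U['I_n]}.
  apply/ik2; apply: (ii1); rewrite p1E linear0; apply/malgP => -[]; rewrite g1c mcoeff0.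
  rewrite -[RHS]r0; apply: eq_bigr => i _; rewrite raddf_sum /= (bigD1 i) //= mcoeffUU big1 ?addr0 // => k ki.
  by rewrite mcoeffU (negbTE ki).
have lE : linear (fun z : N2 => (fun i => (i2 z : {malg U['I_n]})@_i) : 'I_n -> U^o).
  by move=> c x y; apply/funext => i; rewrite linearP mcoeffD mcoeffZ.
have -> : r = mklin lE z.
  apply/funext => i; rewrite mklinE Ez raddf_sum /= (bigD1 i) //= mcoeffUU big1 ?addr0 // => k ki.
  by rewrite mcoeffU (negbTE ki).
have : S2 z.
  have [_ HD _] := mdeg_is_grading N2; have [s Hs ->] := HD z.
  rewrite /S2 big_seq; apply: span_sum => y /Hs[k Dk].
  by apply: (main `|k|%N k) => //; lia.
move: (z) => z0; apply: linear_span => {z Ez z0} z [k k2 Dz]; rewrite mklinE.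
have Dzi i : Gz G (k - 1) ((i2 z : {malg U['I_n]})@_i) by apply: (hi2 k z Dz).
have [Ek|k2'] := eqVneq k 2.
  apply: spanI; split=> [i|]; last exact: rel2.
  by have := Dzi i; rewrite Ek => /uenv_deg_low[_]; apply.
rewrite (_ : (fun i => _) = 0); first exact: span0.
have [Ek|k1] := eqVneq k 1; last first.
  apply/funext => i; have := Dzi i.
  by have [m ->] : exists m, k - 1 = Negz m by exists `|k|%N; lia.
have cst i : exists c : F, (i2 z : {malg U['I_n]})@_i = c *: 1.
  by have := Dzi i; rewrite Ek subrr => /uenv_deg_low[H _]; apply: H.
have [c cE] := boolp.choice cst.
have c0 := free (c := c).
apply/funext => i; rewrite cE c0 ?scale0r //.
apply: (@uiota_inj F M); rewrite raddf0 raddf_sum /= -[RHS](rel2 z).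
by apply: eq_bigr => l _; rewrite cE -scalerAl mul1r linearZ_LR.
Qed.
End LinearRelations.

(** * Transfer of linear relations to a larger enveloping algebra *)

Section Transfer.
Variables (F : fieldType) (A : gradedLieType F) (P : lieAlgType F) (j : {linear A -> P}).
Hypothesis bkA : bloch_kato A.
Hypothesis jb : forall x y, j (bracket x y) = bracket (j x) (j y).
Hypothesis jI : injective j.

Definition linear_relation_in (I : finType) (a : I -> A) (s : I -> uenv P) : Prop :=
  (forall i, exists2 x, ldeg 1 x & s i = uiota (j x)) /\ \sum_i s i * uiota (j (a i)) = 0.

(** The subalgebra [S] generated by the a_i is Koszul, so [linear_relations] holds over U(S). U(P)
    being a free right U(S)-module, a relation over U(P) holds coordinate by coordinate, and is a
    left combination of relations over U(S). *)
Lemma bk_linear_relations_ord n (a : 'I_n -> A) (r : 'I_n -> uenv P) :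
  (forall i, ldeg 1 (a i)) ->
  (forall c : 'I_n -> F, \sum_i c i *: a i = 0 -> forall i, c i = 0) ->
  \sum_i r i * uiota (j (a i)) = 0 ->
  @span (uenv P) ('I_n -> (uenv P)^o) (linear_relation_in a) r.
Proof.
move=> ha fa r0; pose X y := exists i, y = a i.
have X1 x : X x -> ldeg 1 x by move=> [i ->].
pose S := GradedSubalgebra (lgen_subalgebra X) (lgen_homogeneous X1).
pose inc := gsub_incl S.
have [a' aE] : exists a' : 'I_n -> gsub S, forall i, inc (a' i) = a i.
  have H i : exists y, inc y = a i by apply: gsub_lift; apply: lgenI; exists i.
  by have [a' aE] := boolp.choice H; exists a'.
have gen x : lgen (fun y => exists i, y = a' i) x.
  suff [z /gsub_incl_inj <-] : exists2 z, inc z = inc x & lgen (fun y => exists i, y = a' i) z by [].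
  have Sx : lgen X (inc x) := gsub_inclP x.
  elim: Sx => [|_ [i ->]|c y z _ [y' <- Hy] _ [z' <- Hz]|y z _ [y' <- Hy] _ [z' <- Hz]].
  - by exists 0; [rewrite linear0 | apply: lgen0].
  - by exists (a' i) => //; apply: lgenI; exists i.
  - by exists (c *: y' + z'); [rewrite linearP | apply: lgenL].
  - by exists (bracket y' z'); [ | apply: lgenB].
have one : one_generated (gsub S).
  move=> T sT T1 x; apply: (lgen_sub sT) (gen x) => y [i ->]; apply: T1.
  by suff : ldeg 1 (inc (a' i)) by []; rewrite aE.
have kos : koszul (gsub S) by case: bkA => _; apply.
have ha' i : ldeg 1 (a' i).
  by suff : ldeg 1 (inc (a' i)) by []; rewrite aE.
have fa' (c : 'I_n -> F) : \sum_i c i *: a' i = 0 -> forall i, c i = 0.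
  move=> c0; apply: fa; transitivity (inc 0); [rewrite -c0 linear_sum | exact: linear0].
  by apply: eq_bigr => i _; rewrite linearZ_LR aE.
have H2 k : k <> 2 -> cohomology_eq0 (gsub S) 2 k by move=> k2; apply: kos => E; apply: k2.
pose f : {linear gsub S -> P} := (j \o inc).
have fb x y : f (bracket x y) = bracket (f x) (f y) by rewrite /f /= -jb.
have fI : injective f by move=> x y /jI /gsub_incl_inj.
have [K [b [la [_ [lal laM _ ex _]]]]] := uenv_free fb fI.
have la0 k : la k 0 = 0 := raddf0 (mklin (lal k)).
have Uj i : uiota (j (a i)) = umap f (uiota (a' i)) by rewrite umap_iota // /f /= aE.
have rel k : @span (uenv (gsub S)) ('I_n -> (uenv (gsub S))^o) (linear_relation a') (fun i => la k (r i)).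
  apply: (linear_relations ha' gen fa' H2); transitivity (la k 0) => //; rewrite -r0.
  have -> : la k (\sum_i r i * uiota (j (a i))) = \sum_i la k (r i * uiota (j (a i))).
    exact: (linear_sum (mklin (lal k))).
  apply: eq_bigr => i _.
  by rewrite Uj -laM.
have tr v : @span (uenv (gsub S)) ('I_n -> (uenv (gsub S))^o) (linear_relation a') v -> forall p,
    @span (uenv P) ('I_n -> (uenv P)^o) (linear_relation_in a) (fun i => p * umap f (v i)).
  elim=> [|{}v [v1 v0]|c u w _ Hu _ Hw] p.
  - rewrite (_ : (fun i => _) = 0); first exact: span0.
    by apply/funext => i; rewrite umap0 // mulr0.
  - apply: (@spanZ (uenv P) ('I_n -> (uenv P)^o) _ p (fun i => umap f (v i))); apply: spanI; split=> [i|].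
      have [x Dx ->] := v1 i; exists (inc x) => //; by rewrite umap_iota.
    transitivity (umap f 0); [rewrite -v0 umap_sum //; apply: eq_bigr => i _ | exact: umap0].
    by rewrite Uj umapM.
  - rewrite (_ : (fun i => _) = (fun i => (p * umap f c) * umap f (u i)) + (fun i => p * umap f (w i))).
      exact: (@spanD (uenv P) ('I_n -> (uenv P)^o)).
    apply/funext => i; rewrite -[RHS]/((p * umap f c) * umap f (u i) + p * umap f (w i)).
    by rewrite -[(c *: u + w) i]/(c * u i + w i) umapD // umapM // mulrDr mulrA.
have [ks [uks ks0 Er]] : exists ks, [/\ uniq ks, forall i k, k \notin ks -> la k (r i) = 0 &
    forall i, r i = \sum_(k <- ks) b k * umap f (la k (r i))].
  have H i : exists ks, [/\ uniq ks, forall k, k \notin ks -> la k (r i) = 0 &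
    r i = \sum_(k <- ks) b k * umap f (la k (r i))] by apply: ex.
  have [ks ksP] := boolp.choice H.
  exists (undup (flatten [seq ks i | i <- enum 'I_n])).
  have sub i : {subset ks i <= undup (flatten [seq ks i | i <- enum 'I_n])}.
    move=> k kk; rewrite mem_undup; apply/flattenP; exists (ks i) => //.
    by apply: map_f; rewrite mem_enum.
  split; first exact: undup_uniq.
    by move=> i k nk; have [_ H0 _] := ksP i; apply: H0; apply: contra nk; apply: sub.
  move=> i; have [ui H0 E] := ksP i; rewrite [LHS]E.
  rewrite [RHS](bigID [in ks i]) /= [X in _ + X]big1 ?addr0; last first.
    by move=> k nk; rewrite (H0 k nk) umap0 // mulr0.
  rewrite -[RHS]big_filter; apply: perm_big; apply: uniq_perm => //.
    by rewrite filter_uniq ?undup_uniq.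
  by move=> k; rewrite mem_filter; case: (boolP (k \in ks i)) => //= /sub ->.
rewrite (_ : r = \sum_(k <- ks) ((fun i => b k * umap f (la k (r i))) : 'I_n -> (uenv P)^o)).
  by apply: span_sum => k _; apply: tr.
apply/funext => i; rewrite [LHS]Er.
by elim: (ks) => [|k s IH]; rewrite ?big_nil ?big_cons // IH.
Qed.

Lemma bk_linear_relations (I : finType) (a : I -> A) (r : I -> uenv P) :
  (forall i, ldeg 1 (a i)) ->
  (forall c : I -> F, \sum_i c i *: a i = 0 -> forall i, c i = 0) ->
  \sum_i r i * uiota (j (a i)) = 0 ->
  @span (uenv P) (I -> (uenv P)^o) (linear_relation_in a) r.
Proof.
move=> ha fa r0.
have re (V : zmodType) (h : I -> V) : \sum_(i < #|I|) h (enum_val i) = \sum_i h i.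
  by rewrite (reindex (@enum_val I predT)) //=; apply: onW_bij; apply: enum_val_bij.
have := @bk_linear_relations_ord #|I| (a \o enum_val) (r \o enum_val) _ _ _.
have l : linear (fun v : 'I_#|I| -> (uenv P)^o => (v \o enum_rank : I -> (uenv P)^o)) by [].
move=> H; have -> : r = mklin l (r \o enum_val).
  by apply/funext => i; rewrite mklinE /= enum_rankK.
apply: linear_span (H _ _ _) => [v [v1 v0]|i|c c0 i|].
- apply: spanI; split=> [i|]; first by apply: v1.
  rewrite -[RHS]v0 -re; apply: eq_bigr => i _.
  by rewrite mklinE /= enum_valK.
- exact: ha.
- have := fa (c \o enum_rank) _ (enum_val i); rewrite /= enum_valK; apply.
  rewrite -re -[RHS]c0; apply: eq_bigr => k _ /=; by rewrite enum_valK.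
- by rewrite -[RHS]r0 -[RHS]re.
Qed.

End Transfer.

(** A functional that kills [s] and all brackets but not [x] defines an action of [L] on F^2 by
    strictly triangular matrices. The left ideal generated by [s] kills the vector (0, 1), while [x]
    does not. *)
Lemma lideal_degree1 (F : fieldType) (L : gradedLieType F) (s : seq L) (x : L) :
  ldeg 1 x -> (forall y, y \in s -> ldeg 1 y) ->
  lideal (map (@uiota F L) s) (uiota x) -> lspan s x.
Proof.
move=> Dx Ds Hx; apply: contrapT => nx.
have [pr [prE prb]] := degree1_projection L.
have sW : subspace (fun v => lspan s (pr v)).
  split=> [|c u v Hu Hv]; first by rewrite linear0; apply: span0.
  by rewrite linearP; apply: spanL.
have [|g gx gW] := exists_functional_sub (v := x) sW; first by rewrite (prE _ Dx).
pose rho (l : L) (p : (F^o * F^o)%type) : (F^o * F^o)%type := (g l * p.2, 0).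
have rl v : linear (rho^~ v).
  move=> c u w; apply: injective_projections; rewrite /= ?scaler0 ?addr0 //.
  by rewrite linearP mulrDl -mulrA.
have rr l : linear (rho l).
  move=> c u w; apply: injective_projections; rewrite /= ?scaler0 ?addr0 //.
  by rewrite mulrDr [g l * (c *: _)]mulrCA.
have [|act [al a1 aM]] := uenv_act rl rr.
  move=> u v p; apply: injective_projections; rewrite /= ?mulr0 ?subr0 //.
  by rewrite gW ?mul0r // prb; apply: span0.
have act0 z : lideal (map (@uiota F L) s) z -> forall r, act (r * z) (0, 1) = 0.
  have actr r : act r 0 = 0.
    elim/uenv_ind: r => [|y r IH|c u v Hu Hv]; first by rewrite a1.
      by rewrite aM IH; apply: injective_projections; rewrite //= mulr0.
    by rewrite al Hu Hv scaler0 addr0.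
  have actA r v : rho v (0, 1) = 0 -> act (r * uiota v) (0, 1) = 0.
    move=> v0; elim/uenv_ind: r => [|y r IH|c u w Hu Hw].
    - by rewrite mul1r -[uiota v]mulr1 aM a1.
    - rewrite -mulrA aM IH; by apply: injective_projections; rewrite //= mulr0.
    - by rewrite mulrDl -scalerAl al Hu Hw scaler0 addr0.
  have al0 : act 0 (0, 1) = 0 := raddf0 (mklin (al (0, 1))).
  have alD u v : act (u + v) (0, 1) = act u (0, 1) + act v (0, 1) := raddfD (mklin (al (0, 1))) u v.
  elim=> [|_ /mapP[v sv ->]|c u w _ Hu _ Hw] r.
  - by rewrite mulr0.
  - apply: actA; apply: injective_projections => //=.
    by rewrite gW ?mul0r // (prE _ (Ds _ sv)); apply: lspan_mem.
  - rewrite mulrDr [c *: u](_ : _ = c * u) // mulrA.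
    by rewrite alD Hu Hw addr0.
have := act0 _ Hx 1; rewrite mul1r -[uiota x]mulr1 aM a1 /rho /= gx mul1r.
by case=> /eqP; rewrite oner_eq0.
Qed.

(** * Colon ideals in the free product *)

Section Colon.
Variables (F : fieldType) (A B P : gradedLieType F).
Variables (iA : {linear A -> P}) (iB : {linear B -> P}).
Hypothesis hP : is_free_product iA iB.
Hypotheses (bkA : bloch_kato A) (bkB : bloch_kato B).

Let A1 : one_generated A. Proof. by case: bkA. Qed.
Let B1 : one_generated B. Proof. by case: bkB. Qed.
Let iAb x y : iA (bracket x y) = bracket (iA x) (iA y).
Proof. by case: hP => -[]. Qed.

(* The half of the argument that takes place in A: syzygies of a family of     *)
(* elements of A + B whose A-components are linearly independent.              *)
Lemma fox_half (I J : finType) (u : I -> P) (w : J -> P) (al : I -> A) (r : I -> uenv P) (q : J -> uenv P) :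
  (forall i, exists b, u i = iA (al i) + iB b) -> (forall k, exists b, w k = iB b) ->
  (forall i, ldeg 1 (al i)) ->
  (forall c : I -> F, \sum_i c i *: al i = 0 -> forall i, c i = 0) ->
  \sum_i r i * uiota (u i) + \sum_k q k * uiota (w k) = 0 ->
  @span (uenv P) (I -> (uenv P)^o) (linear_relation_in iA al) r.
Proof.
move=> Hu Hw Da fa r0; have [D [DA DB]] := fox_derivative hP A1 B1.
apply: bk_linear_relations => //; first exact: free_product_injl hP.
rewrite -[RHS](linear0 D) -[in RHS]r0 linearD !linear_sum [X in _ = _ + X]big1 ?addr0 => [|k _].
  apply: eq_bigr => i _; have [b ->] := Hu i.
  by rewrite linearD mulrDr linearD /= DA DB addr0.
by have [b ->] := Hw k; apply: DB.
Qed.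

(** The Fox derivative removes [w] and the [B]-parts of [d]; what is left is a relation between the
    independent [A]-components of [u] and [d] together. *)
Lemma fox_block (n m l : nat) (u : 'I_n -> P) (d : 'I_m -> P) (w : 'I_l -> P) (fa : P -> A) (fb : P -> B)
    (ind : forall (a : 'I_n -> F) (b : 'I_m -> F), \sum_i a i *: fa (u i) + \sum_k b k *: fa (d k) = 0 ->
       (forall i, a i = 0) /\ (forall k, b k = 0)) r q s :
  (forall i, u i = iA (fa (u i))) -> (forall k, d k = iA (fa (d k)) + iB (fb (d k))) ->
  (forall k, w k = iB (fb (w k))) ->
  (forall i, ldeg 1 (fa (u i))) -> (forall k, ldeg 1 (fa (d k))) ->
  \sum_i r i * uiota (u i) + \sum_k q k * uiota (d k) + \sum_k s k * uiota (w k) = 0 ->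
  exists v : 'I_n + 'I_m -> uenv P,
    @span (uenv P) ('I_n + 'I_m -> (uenv P)^o)
      (linear_relation_in iA (fun i => match i with inl i => fa (u i) | inr k => fa (d k) end)) v
    /\ forall k, v (inr k) = q k.
Proof.
move=> Hu Hd Hw Du Dd r0.
exists (fun i => match i with inl i => r i | inr k => q k end); split=> //.
apply: (@fox_half _ _ (fun i => match i with inl i => u i | inr k => d k end) w _ _ s).
- by move=> [i|k]; [exists 0; rewrite linear0 addr0 | exists (fb (d k))].
- by move=> k; exists (fb (w k)).
- by case.
- by move=> c; rewrite big_sumType => /ind[H1 H2] [].
- by rewrite big_sumType.
Qed.

End Colon.

Section FoxKernel.
Variables (F : fieldType) (A : gradedLieType F) (P : lieAlgType F) (j : {linear A -> P}).
Variables (D : {linear uenv P -> uenv P}) (I : finType) (a : I -> A).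

(** The coefficients of a combination of linear relations lie in the left ideal generated by j(A).
    With [fox_relation1], this separates coefficients coming from the two factors. *)
Lemma fox_relation0 v : (forall r x, D (r * uiota (j x)) = 0) ->
  @span (uenv P) (I -> (uenv P)^o) (linear_relation_in j a) v -> forall i, D (v i) = 0.
Proof.
move=> H Hv i; suff : forall p, D (p * v i) = 0 by move/(_ 1); rewrite mul1r.
elim: Hv => [|{}v [v1 _]|c x y _ Hx _ Hy] p; first by rewrite mulr0 linear0.
  by have [x _ ->] := v1 i; apply: H.
by rewrite -[(c *: x + y) i]/(c * x i + y i) mulrDr mulrA linearD Hx Hy addr0.
Qed.

Lemma fox_relation1 v : (forall r x, D (r * uiota (j x)) = r * uiota (j x)) ->
  @span (uenv P) (I -> (uenv P)^o) (linear_relation_in j a) v -> forall i, D (v i) = v i.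
Proof.
move=> H Hv i; suff : forall p, D (p * v i) = p * v i by move/(_ 1); rewrite mul1r.
elim: Hv => [|{}v [v1 _]|c x y _ Hx _ Hy] p; first by rewrite mulr0 linear0.
  by have [x _ ->] := v1 i; apply: H.
by rewrite -[(c *: x + y) i]/(c * x i + y i) mulrDr mulrA linearD Hx Hy.
Qed.
End FoxKernel.

Section ComponentIndep.
Variables (F : fieldType) (A B P : lmodType F) (iA : {linear A -> P}) (iB : {linear B -> P}).
(** If a combination of u and d has [A]-component 0, it belongs to B, hence to the span of w. As d
    is independent modulo u and w, its part in d is 0, and then the part in u, equal to its
    [A]-component, is 0. *)
Lemma component_indep (u w d : seq P) (fa : P -> A) (fb : P -> B) :
  indep u -> indep d ->
  (forall y z, lspan u y -> lspan w z -> lspan d (y + z) -> y + z = 0) ->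
  (forall i : 'I_(size u), u`_i = iA (fa u`_i)) ->
  (forall k : 'I_(size d), d`_k = iA (fa d`_k) + iB (fb d`_k)) ->
  (forall y z, lspan u y -> lspan d z -> (exists b, y + z = iB b) -> lspan w (y + z)) ->
  forall (a : 'I_(size u) -> F) (b : 'I_(size d) -> F),
    \sum_i a i *: fa u`_i + \sum_k b k *: fa d`_k = 0 ->
    (forall i, a i = 0) /\ (forall k, b k = 0).
Proof.
move=> Iu Id H Hu Hd HB a b E.
set y := \sum_i a i *: u`_i; set z := \sum_k b k *: d`_k.
have uy : lspan u y by apply: span_sum => i _; apply/spanZ/spanI/mem_nth/ltn_ord.
have dz : lspan d z by apply: span_sum => i _; apply/spanZ/spanI/mem_nth/ltn_ord.
have Ey : y = iA (\sum_i a i *: fa u`_i).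
  by rewrite linear_sum; apply: eq_bigr => i _; rewrite linearZ_LR -Hu.
have Ez : z = iA (\sum_k b k *: fa d`_k) + iB (\sum_k b k *: fb d`_k).
  rewrite !linear_sum -big_split; apply: eq_bigr => i _ /=.
  by rewrite !linearZ_LR -scalerDr -Hd.
have wyz : lspan w (y + z).
  apply: HB => //; exists (\sum_k b k *: fb d`_k).
  by rewrite Ey Ez addrA -linearD E linear0 add0r.
have z0 : z = 0.
  have Eyz : z = - y + (y + z) by rewrite addrA addNr add0r.
  rewrite Eyz; apply: H => //; last by rewrite -Eyz.
  by rewrite -scaleN1r; apply: spanZ.
have b0 := indep_free Id z0; split=> //.
apply: (indep_free Iu); rewrite -/y Ey.
have -> : \sum_i a i *: fa u`_i = 0.
  rewrite -[RHS]E [X in _ = _ + X]big1 ?addr0 // => k _; by rewrite b0 scale0r.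
exact: linear0.
Qed.
End ComponentIndep.

Section ColonTheorem.
Variables (F : fieldType) (A B P : gradedLieType F).
Variables (iA : {linear A -> P}) (iB : {linear B -> P}).
Hypothesis hP : is_free_product iA iB.
Hypotheses (bkA : bloch_kato A) (bkB : bloch_kato B).

Let A1 : one_generated A. Proof. by case: bkA. Qed.
Let B1 : one_generated B. Proof. by case: bkB. Qed.

Definition linear_colon (s : seq P) (x : P) (u : uenv P) : Prop :=
  exists y, [/\ ldeg 1 y, u = uiota y & lideal (map (@uiota F P) s) (uiota y * uiota x)].

Lemma lideal_lspan (s : seq P) y : lspan s y -> lideal (map (@uiota F P) s) (uiota y).
Proof.
elim=> [|z sz|c z w _ Hz _ Hw]; first by rewrite linear0; apply: lideal0.
  exact/lideal_mem/map_f.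
by rewrite linearP; apply: lidealD => //; apply: lidealZ.
Qed.

(** Here [c i] is the coefficient of [x] in a_i modulo [s]. A relation with the sum of the v_i a_i
    equal to 0 gives that (sum of c_i v_i) x is minus the sum of the v_i (a_i - c_i x), which lies
    in the left ideal of [s]; when the v_i are linear, so is the sum of the c_i v_i. *)
Lemma colon_block (C : gradedLieType F) (j : {linear C -> P}) (hj : forall n x, ldeg n x -> ldeg n (j x))
    (I : finType) (a : I -> C) (s : seq P) (x : P) (c : I -> F) (r : I -> uenv P) :
  (forall i, lspan s (j (a i) - c i *: x)) ->
  @span (uenv P) (I -> (uenv P)^o) (linear_relation_in j a) r ->
  @span (uenv P) (uenv P)^o (linear_colon s x) (\sum_i c i *: r i).
Proof.
move=> Hc; pose f (v : I -> (uenv P)^o) : (uenv P)^o := \sum_i c i *: (v i : uenv P).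
have fl : linear f.
  move=> k v w; rewrite /f -[RHS]/(k * _ + _) big_distrr -big_split; apply: eq_bigr => i _ /=.
  by rewrite -[(k *: v + w) i]/(k * v i + w i) scalerDr scalerAr.
apply: (linear_span (g := mklin fl)) => v [v1 v0]; apply: spanI.
have [y yP] := boolp.choice (fun i => let: ex_intro2 y Dy Ey := v1 i in
  ex_intro (fun y => ldeg 1 y /\ v i = uiota (j y)) y (conj Dy Ey)).
exists (\sum_i c i *: j (y i)); split.
- elim/big_rec: _ => [|i z _ Dz]; first exact: ldeg0.
  by apply: ldegD => //; apply: ldegZ; apply: hj; case: (yP i).
- rewrite mklinE /f linear_sum; apply: eq_bigr => i _.
  by rewrite linearZ_LR; case: (yP i) => _ ->.
- have -> : uiota (\sum_i c i *: j (y i)) * uiota x = - \sum_i v i * uiota (j (a i) - c i *: x).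
    have H i : v i * uiota (j (a i) - c i *: x) = v i * uiota (j (a i)) - c i *: (v i * uiota x).
      have -> : uiota (j (a i) - c i *: x) = uiota (j (a i)) - c i *: uiota x :> uenv P.
        by rewrite [X in uiota X]addrC -scaleNr uiota_linear scaleNr addrC.
      by rewrite mulrBr -scalerAr.
    rewrite (eq_bigr _ (fun i _ => H i)) sumrB v0 sub0r opprK linear_sum big_distrl.
    by apply: eq_bigr => i _ /=; rewrite (linearZ_LR (@uiota F P)) -scalerAl; case: (yP i) => _ ->.
  rewrite -sub0r; apply: lidealB; first exact: lideal0.
  elim/big_rec: _ => [|i z _ Hz]; first exact: lideal0.
  by apply: lidealD => //; apply/lidealM/lideal_lspan.
Qed.

Lemma sum_mul_iotaL n (g : 'I_n -> P) (q q' : 'I_n -> uenv P) c :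
  \sum_i (c * q i + q' i) * uiota (g i) = c * (\sum_i q i * uiota (g i)) + \sum_i q' i * uiota (g i).
Proof.
by rewrite big_distrr -big_split; apply: eq_bigr => i _ /=; rewrite mulrDl mulrA.
Qed.
Lemma sum_scaleL n (k : 'I_n -> F) (q q' : 'I_n -> uenv P) c :
  \sum_i k i *: (c * q i + q' i) = c * (\sum_i k i *: q i) + \sum_i k i *: q' i.
Proof.
by rewrite big_distrr -big_split; apply: eq_bigr => i _ /=; rewrite scalerDr scalerAr.
Qed.
Lemma sum_scale_mul_iota n (e : 'I_n -> F) (r : uenv P) (g : 'I_n -> P) :
  \sum_i (e i *: r) * uiota (g i) = r * uiota (\sum_i e i *: g i).
Proof.
rewrite linear_sum big_distrr; apply: eq_bigr => i _ /=.
by rewrite linearZ_LR -scalerAl scalerAr.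
Qed.
Lemma sum_scale_scale n (k e : 'I_n -> F) (r : uenv P) :
  \sum_i k i *: (e i *: r) = (\sum_i e i * k i) *: r.
Proof. by rewrite scaler_suml; apply: eq_bigr => i _; rewrite scalerA mulrC. Qed.

(** An element [r] of the colon ideal is the coefficient of [x] in a relation between [s] and [x].
    In a suitable basis this relation decomposes into linear relations over [A] and over [B], and
    [colon_block] turns their coefficients of [x] into elements of degree 1 of the colon ideal. *)
Theorem colon_linear (s : seq P) (x : P) (r : uenv P) :
  ldeg 1 x -> (forall y, y \in s -> ldeg 1 y) -> indep (rcons s x) ->
  lideal (map (@uiota F P) s) (r * uiota x) ->
  @span (uenv P) (uenv P)^o (linear_colon s x) r.
Proof.
move=> Dx Ds Isx Hr; have [Is nx] := indep_rcons Isx.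
pose V := lspan (rcons s x).
have V0 : V 0 by exact: span0.
have VL c y z : V y -> V z -> V (c *: y + z) by exact: spanL.
have V1 v : V v -> ldeg 1 v.
  elim=> [|z|c y z _ Dy _ Dz]; first exact: ldeg0.
    by rewrite mem_rcons inE => /orP[/eqP->|/Ds].
  by apply: ldegD => //; apply: ldegZ.
have fex (v : P) : exists p : (A * B)%type, ldeg 1 v ->
    [/\ ldeg 1 p.1, ldeg 1 p.2 & v = iA p.1 + iB p.2].
  case: (pselect (ldeg 1 v)) => Dv; last by exists 0.
  by have [a [b [Da Db E]]] := free_product_degree1 hP A1 B1 Dv; exists (a, b).
have [f fP] := boolp.choice fex.
pose fa v := (f v).1; pose fb v := (f v).2.
have dis a b : iA a = iB b -> iA a = 0.
  by move=> /(free_product_disjoint hP) ->; apply: linear0.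
have faA v : ldeg 1 v -> (exists a, v = iA a) -> v = iA (fa v).
  move=> Dv [a Ea]; have [_ _ E] := fP v Dv; rewrite {1}E.
  have : iA (a - fa v) = iB (fb v) by rewrite linearB -Ea {1}E addrC addKr.
  by move=> E'; rewrite -/(fb v) -E' (dis _ _ E') addr0.
have fbB v : ldeg 1 v -> (exists b, v = iB b) -> v = iB (fb v).
  move=> Dv [b Eb]; have [_ _ E] := fP v Dv; rewrite {1}E.
  have E2 : v - iB (fb v) = iA (fa v) by rewrite {1}E addrK.
  have : iA (fa v) = iB (b - fb v) by rewrite linearB -Eb E2.
  by move=> /dis; rewrite -/(fa v) => ->; rewrite add0r.
(* The span V of s and x has a basis u ++ w ++ d, with u and w bases of the    *)
(* intersections of V with A and B. The A-components of u ++ d are independent, *)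
(* and so are the B-components of w ++ d. The coefficients of d in a relation   *)
(* thus belong to both U(P) A and U(P) B, hence vanish: the relation splits.    *)
pose VA v := V v /\ exists a, v = iA a; pose VB v := V v /\ exists b, v = iB b.
have sVA : subspace VA.
  split=> [|c y z [Vy [a Ea]] [Vz [b Eb]]]; first by split=> //; exists 0; rewrite linear0.
  by split; [apply: VL | exists (c *: a + b); rewrite Ea Eb linearP].
have sVB : subspace VB.
  split=> [|c y z [Vy [a Ea]] [Vz [b Eb]]]; first by split=> //; exists 0; rewrite linear0.
  by split; [apply: VL | exists (c *: a + b); rewrite Ea Eb linearP].
have [u [Iu uVA] uspan] := subspace_fin sVA (fun v (H : VA v) => H.1).
have [w [Iw wVB] wspan] := subspace_fin sVB (fun v (H : VB v) => H.1).
have uA y : lspan u y -> VA y by apply: span_sub.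
have wB y : lspan w y -> VB y by apply: span_sub.
have Iuw : indep (u ++ w).
  apply: indep_cat_disjoint => // y /uA[_ [a Ea]] /wB[_ [b Eb]].
  by rewrite Ea; apply: (dis a b); rewrite -Ea.
have [d [Id dV tV]] := indep_extend (rcons s x) Iuw.
have [_ Id' disd] := indep_cat Id.
have dspan y : lspan d y -> V y by apply: lspan_sub => z /dV; apply: lspan_mem.
have uV (i : 'I_(size u)) : VA u`_i by apply: uVA; apply: mem_nth.
have wV (i : 'I_(size w)) : VB w`_i by apply: wVB; apply: mem_nth.
have dVi (i : 'I_(size d)) : V d`_i by apply/dspan/lspan_mem/mem_nth.
have Eu (i : 'I_(size u)) : u`_i = iA (fa u`_i) by case: (uV i) => /V1; apply: faA.
have Ew (i : 'I_(size w)) : w`_i = iB (fb w`_i) by case: (wV i) => /V1; apply: fbB.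
have Ed (i : 'I_(size d)) : d`_i = iA (fa d`_i) + iB (fb d`_i) by case: (fP _ (V1 _ (dVi i))).
have tspan v : V v -> exists (cu : 'I_(size u) -> F) (cw : 'I_(size w) -> F) (cd : 'I_(size d) -> F),
    v = \sum_i cu i *: u`_i + \sum_i cw i *: w`_i + \sum_i cd i *: d`_i.
  have sub : forall z, lspan (rcons s x) z -> lspan ((u ++ w) ++ d) z by apply: lspan_sub.
  move=> /sub /lspan_cat[y [z [/lspan_cat[y1 [y2 [uy1 wy2 ->]]] dz ->]]].
  have [cu ->] := lspan_sumE uy1; have [cw ->] := lspan_sumE wy2; have [cd ->] := lspan_sumE dz.
  by exists cu, cw, cd.
(* [ku], [kw] and [kd] are the values on the new basis of the linear form on V that gives the
   coefficient of [x] modulo the span of [s]; [coef_uniq] computes it on any v. *)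
have coef v : V v -> exists c : F, lspan s (v - c *: x) by move=> /lspan_rcons.
have [ku kuP] := boolp.choice (fun i => coef _ (uV i).1).
have [kw kwP] := boolp.choice (fun i => coef _ (wV i).1).
have [kd kdP] := boolp.choice (fun i => coef _ (dVi i)).
have coef_uniq v c (cu : 'I_(size u) -> F) (cw : 'I_(size w) -> F) (cd : 'I_(size d) -> F) : lspan s (v - c *: x) ->
    v = \sum_i cu i *: u`_i + \sum_i cw i *: w`_i + \sum_i cd i *: d`_i ->
    \sum_i cu i * ku i + \sum_i cw i * kw i + \sum_i cd i * kd i = c.
  move=> Hv Ev; set c' := (X in X = c); apply/eqP; rewrite -subr_eq0; apply/negPn/negP => cn0.
  apply: nx; have Hv' : lspan s (v - c' *: x).
    have -> : v - c' *: x = \sum_i cu i *: (u`_i - ku i *: x) + \sum_i cw i *: (w`_i - kw i *: x)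
        + \sum_i cd i *: (d`_i - kd i *: x).
      have E (n : nat) (cc kk : 'I_n -> F) (g : 'I_n -> P) : \sum_i cc i *: (g i - kk i *: x) =
          \sum_i cc i *: g i - (\sum_i cc i * kk i) *: x.
        rewrite scaler_suml -sumrB; apply: eq_bigr => i _.
        by rewrite scalerBr scalerA.
      by rewrite !E Ev /c' !scalerDl !opprD (AC (3*3) ((1*4)*(2*5)*(3*6))).
    apply: spanD; first apply: spanD; apply: span_sum => i _; apply: spanZ.
    - exact: kuP.
    - exact: kwP.
    - exact: kdP.
  have -> : x = (c' - c)^-1 *: ((v - c *: x) - (v - c' *: x)).
    by rewrite opprB [v - _ + _]addrC addrA subrK -scalerBl scalerA mulVf // scale1r.
  by apply/spanZ/spanB.
(* An element of the left ideal of [s] is rewritten on the new basis; the coefficient of [x] in the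
   rewriting is 0. *)
have rel z : lideal (map (@uiota F P) s) z ->
  exists (qu : 'I_(size u) -> uenv P) (qw : 'I_(size w) -> uenv P) (qd : 'I_(size d) -> uenv P),
    \sum_i qu i * uiota u`_i + \sum_i qw i * uiota w`_i + \sum_i qd i * uiota d`_i = z /\
    \sum_i ku i *: qu i + \sum_i kw i *: qw i + \sum_i kd i *: qd i = 0.
  elim=> [|_ /mapP[y sy ->]|c a b _ [qu [qw [qd [<- E2]]]] _ [qu' [qw' [qd' [<- E2']]]]].
  - exists (fun=> 0), (fun=> 0), (fun=> 0); split.
      by rewrite !big1 ?addr0 // => i _; rewrite mul0r.
    by rewrite !big1 ?addr0 // => i _; rewrite scaler0.
  - have Vy : V y by apply: lspan_mem; rewrite mem_rcons inE sy orbT.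
    have [cu [cw [cd Ey]]] := tspan y Vy.
    have Hy : lspan s (y - 0 *: x) by rewrite scale0r subr0; apply: lspan_mem.
    exists (fun i => cu i *: 1), (fun i => cw i *: 1), (fun i => cd i *: 1).
    rewrite !sum_scale_mul_iota !sum_scale_scale !mul1r -!linearD -Ey; split=> //.
    by rewrite -!scalerDl (coef_uniq _ _ _ _ _ Hy Ey) scale0r.
  - exists (fun i => c * qu i + qu' i), (fun i => c * qw i + qw' i), (fun i => c * qd i + qd' i).
    rewrite !sum_mul_iotaL !sum_scaleL -[c *: _]/(c * _); split.
      by rewrite !mulrDr (AC (2*2*2) ((1*3*5)*(2*4*6))).
    by rewrite (AC (2*2*2) ((1*3*5)*(2*4*6))) /= -!mulrDr E2 E2' mulr0 addr0.
have [qu [qw [qd [E0 Er]]]] : exists (qu : 'I_(size u) -> uenv P) (qw : 'I_(size w) -> uenv P)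
    (qd : 'I_(size d) -> uenv P),
    \sum_i qu i * uiota u`_i + \sum_i qw i * uiota w`_i + \sum_i qd i * uiota d`_i = 0 /\
    \sum_i ku i *: qu i + \sum_i kw i *: qw i + \sum_i kd i *: qd i = r.
  have Vx : V x by apply: lspan_mem; rewrite mem_rcons inE eqxx.
  have [cu [cw [cd Ex]]] := tspan x Vx.
  have Hx : lspan s (x - 1 *: x) by rewrite scale1r subrr; apply: span0.
  have [qu [qw [qd [E1 E2]]]] := rel _ Hr.
  (* The relation is r x minus the expression of r x through [s], written on the new basis. Its
     coefficient of [x] is [r]. *)
  exists (fun i => (-1) * qu i + cu i *: r), (fun i => (-1) * qw i + cw i *: r),
    (fun i => (-1) * qd i + cd i *: r).
  rewrite !sum_mul_iotaL !sum_scaleL !sum_scale_mul_iota !sum_scale_scale; split.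
    rewrite (AC (2*2*2) ((1*3*5)*(2*4*6))) /= -!mulrDr E1 -!linearD -Ex.
    by rewrite mulN1r addNr.
  rewrite (AC (2*2*2) ((1*3*5)*(2*4*6))) /= -!mulrDr E2 mulr0 add0r -!scalerDl.
  by rewrite (coef_uniq _ _ _ _ _ Hx Ex) scale1r.
have [D [DA DB]] := fox_derivative hP A1 B1.
have [D' [DB' DA']] := fox_derivative (free_product_sym hP) B1 A1.
have Huwd y z : lspan u y -> lspan w z -> lspan d (y + z) -> y + z = 0.
  move=> Hy Hz; apply: disd; apply: spanD.
    by apply: span_mono Hy => t tt; rewrite mem_cat tt.
  by apply: span_mono Hz => t tt; rewrite mem_cat tt orbT.
have Hwud y z : lspan w y -> lspan u z -> lspan d (y + z) -> y + z = 0.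
  by move=> Hy Hz; rewrite addrC; apply: Huwd.
have Ed' (i : 'I_(size d)) : d`_i = iB (fb d`_i) + iA (fa d`_i) by rewrite addrC -Ed.
have VD y z : V y -> V z -> V (y + z) by exact: spanD.
have indA := component_indep Iu Id' Huwd Eu Ed
  (fun y z Hy Hz Hb => wspan _ (conj (VD _ _ (uA _ Hy).1 (dspan _ Hz)) Hb)).
have indB := component_indep Iw Id' Hwud Ew Ed'
  (fun y z Hy Hz Hb => uspan _ (conj (VD _ _ (wB _ Hy).1 (dspan _ Hz)) Hb)).
have Da v : V v -> ldeg 1 (fa v) by move=> /V1/fP[].
have Db v : V v -> ldeg 1 (fb v) by move=> /V1/fP[].
have [vA [HvA vAE]] := fox_block hP bkA bkB (u := fun i => u`_i) (d := fun i => d`_i) (w := fun i => w`_i)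
  indA (r := qu) (q := qd) (s := qw) Eu Ed Ew (fun i => Da _ (uV i).1) (fun i => Da _ (dVi i))
  (etrans (addrAC _ _ _) E0).
have E0' : \sum_i qw i * uiota w`_i + \sum_i qd i * uiota d`_i + \sum_i qu i * uiota u`_i = 0.
  by rewrite addrC addrA.
have [vB [HvB vBE]] := fox_block (free_product_sym hP) bkB bkA (u := fun i => w`_i) (d := fun i => d`_i)
  (w := fun i => u`_i) indB (r := qw) (q := qd) (s := qu) Ew Ed' Eu (fun i => Db _ (wV i).1)
  (fun i => Db _ (dVi i)) E0'.
(* [D'] is the Fox derivative for [B]: it fixes U(P) B, where [qd k] lies by [HvB], and kills U(P)
   A, where it lies by [HvA]. *)
have qd0 k : qd k = 0.
  have := fox_relation1 DB' HvB (inr k); rewrite vBE => <-.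
  by have := fox_relation0 DA' HvA (inr k); rewrite vAE.
have Ed0 : \sum_i qd i * uiota d`_i = 0 by apply: big1 => i _; rewrite qd0 mul0r.
have Ek0 : \sum_i kd i *: qd i = 0 by apply: big1 => i _; rewrite qd0 scaler0.
have E0A : \sum_i qu i * uiota u`_i + \sum_i qw i * uiota w`_i = 0.
  by rewrite -[RHS]E0 Ed0 addr0.
have E0B : \sum_i qw i * uiota w`_i + \sum_i qu i * uiota u`_i = 0 by rewrite addrC.
have HA : @span (uenv P) ('I_(size u) -> (uenv P)^o) (linear_relation_in iA (fun i : 'I_(size u) => fa u`_i)) qu.
  apply: (fox_half hP bkA bkB (u := fun i : 'I_(size u) => u`_i) (w := fun i : 'I_(size w) => w`_i) (q := qw)) => //.
  - by move=> i; exists 0; rewrite linear0 addr0.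
  - by move=> k; exists (fb w`_k).
  - by move=> i; apply: Da; case: (uV i).
  - move=> c c0; have [|H _] := indA c (fun=> 0); last exact: H.
    by rewrite [X in _ + X]big1 ?addr0 // => k _; rewrite scale0r.
have HB : @span (uenv P) ('I_(size w) -> (uenv P)^o) (linear_relation_in iB (fun i : 'I_(size w) => fb w`_i)) qw.
  apply: (fox_half (free_product_sym hP) bkB bkA (u := fun i : 'I_(size w) => w`_i) (w := fun i : 'I_(size u) => u`_i) (q := qu)) => //.
  - by move=> i; exists 0; rewrite linear0 addr0.
  - by move=> k; exists (fa u`_k).
  - by move=> i; apply: Db; case: (wV i).
  - move=> c c0; have [|H _] := indB c (fun=> 0); last exact: H.
    by rewrite [X in _ + X]big1 ?addr0 // => k _; rewrite scale0r.
rewrite -Er Ek0 addr0; apply: (subspaceD (span_subspace _)).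
  by apply: colon_block HA => [n y|i]; [case: hP => -[_ H] _ _; apply: H | rewrite -Eu].
by apply: colon_block HB => [n y|i]; [case: hP => _ [_ H] _; apply: H | rewrite -Ew].
Qed.
End ColonTheorem.

(** * From linear colon ideals to Koszulness, and passage to subalgebras *)

Section LinearColonsKoszul.
Variables (F : fieldType) (M : gradedLieType F).

(** The good lists are the independent families in M_1. As M_1 is finite-dimensional, the degree 1
    part of a colon ideal has a finite basis, which is again a good list and generates the ideal by
    hypothesis. *)
Lemma linear_colon_koszul (b : seq M) :
  one_generated M -> (forall y, ldeg 1 y -> lspan b y) ->
  (forall s x r, ldeg 1 x -> (forall y, y \in s -> ldeg 1 y) -> indep (rcons s x) ->
     lideal (map (@uiota F M) s) (r * uiota x) ->
     @span (uenv M) (uenv M)^o (linear_colon s x) r) ->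
  koszul M.
Proof.
move=> M1 fin col.
pose Good (y : seq (uenv M)) := exists s : seq M,
  [/\ y = map (@uiota F M) s, forall z, z \in s -> ldeg 1 z & indep s].
apply: (@koszul_criterion _ _ Good).
- by exists [::]; split=> //; apply: indep0.
- move=> y x [s' [E Ds Is]].
  case/lastP: s' E Ds Is => [|s z]; first by case: y.
  rewrite map_rcons => /rcons_inj[-> ->] Dsz Isz.
  have Dz : ldeg 1 z by apply: Dsz; rewrite mem_rcons inE eqxx.
  have Ds t : t \in s -> ldeg 1 t by move=> st; apply: Dsz; rewrite mem_rcons inE st orbT.
  have [Is _] := indep_rcons Isz.
  split; first by exists s.
  pose Y y' := ldeg 1 y' /\ lideal (map (@uiota F M) s) (uiota y' * uiota z).
  have sY : subspace Y.
    split=> [|c u v [Du Hu] [Dv Hv]].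
      by split; [apply: ldeg0 | rewrite linear0 mul0r; apply: lideal0].
    split; first by apply: ldegD => //; apply: ldegZ.
    by rewrite linearP mulrDl -scalerAl; apply: lidealD => //; apply: lidealZ.
  have [t [It tY] Yt] := subspace_fin sY (fun v (H : Y v) => fin v H.1).
  exists (map (@uiota F M) t); first by exists t; split=> // v /tY[].
  move=> r; split=> [Hr|].
    apply: (span_sub (lideal_subspace _) _ (col s z r Dz Ds Isz Hr)) => _ [v [Dv -> Hv]].
    by apply: lideal_lspan; apply: Yt.
  elim=> [|_ /mapP[v tv ->]|c u v _ Hu _ Hv].
  + by rewrite mul0r; apply: lideal0.
  + by case: (tY v tv).
  + by rewrite mulrDl -[c *: u]/(c * u) -mulrA; apply: lidealD => //; apply: lidealM.
- by move=> y x [s [-> Ds _]] /mapP[z sz ->]; apply: uenv_deg_iota; apply: Ds.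
(* A basis of M_1 is a good list generating the augmentation ideal. *)
- have [t [It tD] Dt] := subspace_fin (@ldeg_subspace _ M 1) fin.
  exists (map (@uiota F M) t); first by exists t.
  apply: uaug_gen; apply: M1; first exact: lgen_subalgebra.
  move=> x /Dt; elim=> [|z tz|c u v _ Hu _ Hv]; [exact: lgen0 | exact: lgenI | exact: lgenL].
Qed.
End LinearColonsKoszul.

Section ColonRestriction.
Variables (F : fieldType) (M P : gradedLieType F) (j : {linear M -> P}).
Hypotheses (hj : graded_lie_hom j) (jI : injective j).

Lemma indep_map (s : seq M) : indep s -> indep (map j s).
Proof.
elim=> [|{}s x Is IH nx]; first exact: indep0.
rewrite map_rcons; apply: indepS => // Hx; apply: nx.
by have [y sy /jI <-] := lspan_map Hx.
Qed.

(* The generators y of the colon ideal in U(P) lie in j(M): otherwise y would   *)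
(* be part of a basis of U(P) over U(M), which would put x in the span of s.    *)
Lemma linear_colon_restrict (s : seq M) (x : M) (r : uenv M) :
  ldeg 1 x -> (forall y, y \in s -> ldeg 1 y) -> ~ lspan s x ->
  (forall n y, ldeg n (j y) -> ldeg n y) ->
  @span (uenv P) (uenv P)^o (linear_colon (map j s) (j x)) (umap j r) ->
  @span (uenv M) (uenv M)^o (linear_colon s x) r.
Proof.
move=> Dx Ds nx jD Hr; have [jb _] := hj.
have [K [b [la [k0 [lal laM la1 _ lai]]]]] := uenv_free jb jI.
have la0 k : la k 0 = 0 := linear0 (mklin (lal k)).
have laD k u v : la k (u + v) = la k u + la k v := linearD (mklin (lal k)) u v.
have lak u : la k0 (umap j u) = u by rewrite -[umap j u]mul1r laM la1 mul1r.
have down k z : lideal (map (@uiota F P) (map j s)) z ->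
    lideal (map (@uiota F M) s) (la k z).
  move=> Hz; rewrite -[z]mul1r; move: Hz (1 : uenv P).
  elim=> [|_ /mapP[_ /mapP[y sy ->] ->]|c u v _ Hu _ Hv] p.
  - by rewrite mulr0 la0; apply: lideal0.
  - by rewrite -umap_iota // laM; apply/lidealM/lideal_mem/map_f.
  - by rewrite mulrDr -[c *: u]/(c * u) mulrA laD; apply: lidealD.
rewrite -[r]lak -[umap j r]mul1r; move: Hr (1 : uenv P).
elim=> [|_ [y [Dy -> Hy]]|c u v _ Hu _ Hv] p.
- by rewrite mulr0 la0; apply: span0.
- have [[m Em]|ny] := pselect (exists m, y = j m).
    rewrite Em -umap_iota // laM.
    apply: (@spanZ (uenv M) (uenv M)^o); apply: spanI; exists m.
    split=> //; first by apply: jD; rewrite -Em.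
    by have := down k0 _ Hy; rewrite Em -!umap_iota // -umapM // lak.
  have [|k [a [a0 Ea]]] := lai y; first by move=> m Em; apply: ny; exists m.
  case: nx; apply: lideal_degree1 => //.
  have := down k _ Hy; rewrite -umap_iota // laM Ea -scalerAl mul1r => /(lidealZ a^-1).
  by rewrite scalerA mulVf // scale1r.
- by rewrite mulrDr -[c *: u]/(c * u) mulrA laD; apply: (@spanD (uenv M) (uenv M)^o).
Qed.

End ColonRestriction.

Lemma lideal_umap (F : fieldType) (M P : gradedLieType F) (j : {linear M -> P}) (s : seq M) z :
  graded_lie_hom j -> lideal (map (@uiota F M) s) z ->
  lideal (map (@uiota F P) (map j s)) (umap j z).
Proof.
move=> [jb _]; elim=> [|_ /mapP[y sy ->]|c u v _ Hu _ Hv].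
- by rewrite umap0 //; apply: lideal0.
- by rewrite umap_iota //; apply/lideal_mem/map_f/map_f.
- by rewrite umapD // -[c *: u]/(c * u) umapM //; apply: lidealD => //; apply: lidealM.
Qed.

Lemma lspan_preim (F : fieldType) (V W : lmodType F) (j : {linear V -> W}) (X : V -> Prop) (s : seq W) :
  injective j -> subspace X -> (forall x, X x -> lspan s (j x)) ->
  exists b, forall x, X x -> lspan b x.
Proof.
move=> jI [X0 XL] Xs.
have sY : subspace (fun y => exists2 x, X x & y = j x).
  split=> [|c _ _ [x Xx ->] [y Xy ->]]; first by exists 0; rewrite ?linear0.
  by exists (c *: x + y); [apply: XL | rewrite linearP].
have [|t [_ tX] Xt] := subspace_fin sY (s := s); first by move=> _ [x Xx ->]; apply: Xs.
have [b Eb] : exists b, t = map j b.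
  elim: (t) tX => [|y t' IH] tX; first by exists [::].
  have [x _ ->] := tX y (mem_head _ _).
  by have [|b ->] := IH; [move=> z tz; apply: tX; rewrite inE tz orbT | exists (x :: b)].
exists b => x Xx; have : lspan t (j x) by apply: Xt; exists x.
by rewrite Eb => /lspan_map[y sy /jI <-].
Qed.

Theorem theoremB (F : fieldType) (A B : gradedLieType F)
  (hA : bloch_kato A) (hB : bloch_kato B)
  (fA : finite_dim_degree1 A) (fB : finite_dim_degree1 B)
  (P : gradedLieType F) (iA : {linear A -> P}) (iB : {linear B -> P})
  (hP : is_free_product iA iB) :
  bloch_kato P.
Proof.
have [[A1 _] [B1 _]] := (hA, hB).
split=> [|S S1]; first exact: free_product_one_generated hP A1 B1.
have [[sA [_ EA]] [sB [_ EB]]] := (fA, fB).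
have fin (x : P) : ldeg 1 x -> lspan (map iA sA ++ map iB sB) x.
  move=> /(free_product_degree1 hP A1 B1)[a [b [/EA[c ->] /EB[d ->] ->]]].
  rewrite !linear_sum; apply: spanD; apply: span_sum => i _; rewrite linearZ_LR;
    apply/spanZ/lspan_mem; rewrite mem_cat ?map_f ?orbT ?mem_nth //.
have jI : injective (gsub_incl S) by exact: gsub_incl_inj.
(* The degree 1 part of the subalgebra lies in P_1, which is spanned by finitely many vectors of A_1
   and B_1. *)
have [|b Hb] := lspan_preim jI (@ldeg_subspace _ (gsub S) 1) (s := map iA sA ++ map iB sB).
  by move=> x Dx; apply: fin; apply: (gsub_incl_hom S).2.
apply: (linear_colon_koszul S1 Hb) => s x r Dx Ds Isx Hr.
(* The colon ideal in U(S) is studied through its image in U(P), where [colon_linear] applies. *)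
apply: (linear_colon_restrict (gsub_incl_hom S)) => //; first by case: (indep_rcons Isx).
apply: (colon_linear hP hA hB).
- exact: (gsub_incl_hom S).2.
- by move=> _ /mapP[y sy ->]; apply: (gsub_incl_hom S).2; apply: Ds.
- by rewrite -map_rcons; apply: indep_map.
- by have := lideal_umap (gsub_incl_hom S) Hr; rewrite umapM ?umap_iota //; case: (gsub_incl_hom S).
Qed.
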